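(* Let $G$ be a (fixed) strictly linear-recursive coarse-grained workflow specification and let $g\in L(G)$ be a run whose nodes carry the labels $\psi_V$. Let $l_1,l_2$ be two lists of nodes of $g$, each given by the labels of its nodes and sorted by the post-order of the nodes in the compressed parse tree of $g$. Then the all-pairs reachability query, i.e. the set of all $(u,v)\in l_1\times l_2$ such that there is a path from $u$ to $v$ in $g$, can be answered in time $O(|l_1|+|l_2|+N)$, where $N$ is the number of such pairs; this is linear in the input and output size and hence optimal. (Operations on two words of $\log n$ bits, $n$ the size of $g$, are assumed to take constant time.)
   Context: **Workflows.** A simple workflow $W=(V,E)$ is a finite acyclic directed multigraph. Each node (module) has a name in a finite set $\Sigma$ and each edge has a tag in a finite set $\Gamma$; parallel edges carry different tags. A workflow specification is a graph grammar $G=(\Sigma,\Delta,S,P)$, where $\Delta\subseteq\Sigma$ are the composite modules, $\Sigma\setminus\Delta$ the atomic modules, $S\in\Sigma$ is the start module, and $P$ is a finite set of productions $M\to W$ with $M\in\Delta$ and $W$ a simple workflow with node names in $\Sigma$. Coarse-grained means that every module has a single input and a single output and the output depends on the input; so each right-hand side $W$ has a unique source and a unique sink. Replacing a composite node $v$ by $W$ (for a production $name(v)\to W$) deletes $v$, inserts a copy of $W$, redirects the edges entering $v$ to the source of $W$ and lets the edges leaving $v$ start at the sink of $W$, keeping tags. A run of $G$ is a graph with only atomic nodes obtained from a single node named $S$ by a sequence of replacements; $L(G)$ is the set of runs. **Strict linear recursion.** The production graph $\mathcal P(G)$ is the directed multigraph with vertex set $\Sigma$ having, for each production $M\to W$ and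 each node of $W$ named $M'$, one edge from $M$ to $M'$. $G$ is strictly linear-recursive if all cycles of $\mathcal P(G)$ are vertex-disjoint. A module is recursive if it lies on a cycle. **Labels $\psi_V$.** Fix an ordering of the productions, a topological ordering of the nodes of each right-hand side, an ordering of the cycles of $\mathcal P(G)$, and a first edge for each cycle. The edge of $\mathcal P(G)$ from $M$ to the $i$-th node of the right-hand side of the $k$-th production (with left-hand side $M$) is identified with the pair $(k,i)$. The compressed parse tree $T$ of a run records its derivation: leaves are the atomic nodes of the run, and internal nodes are composite nodes occurring in the derivation or special recursive nodes. The children of a composite node $x$ correspond to the nodes of the right-hand side that replaced $x$, with the following modification for recursion. Whenever a node $x_1$ with a recursive module name is created that does not continue an already started recursion, a recursive node is put in its place, whose children are $x_1,x_2,\dots,x_m$, where $x_{j+1}$ is the node in the replacement of $x_j$ corresponding to the next edge of the cycle (and $x_{j+1}$ is then not a child of $x_j$), the sequence ending when the production applied does not contain the next cycle edge. A tree edge from a composite node $x$ to its child is labeled $(k,i)$ if the child (or, for a recursive node, its first child $x_1$) is the $i$-th node of the right-hand side of the $k$-th production, used to replace $x$. A tree edge from a recursive node to its $i$-th child is labeled $(s,t,i)$ if the recursion unfolds the $s$-th cycle starting from the $t$-th edge of that cycle. The label $\psi_V(v)$ of a node $v$ is the sequence of edge labels on the path from the root of $T$ to $v$. *)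

(* Defs.v *)
From mathcomp Require Import all_boot.
Set Implicit Arguments.
Unset Strict Implicit.
Unset Printing Implicit Defensive.

(** * Workflows and graph grammars *)

(* The nodes of a right-hand side are numbered 0, 1, ... along the fixed
   topological order; [wf_names] lists their names in that order and the triple
   [(i, t, j)] is an edge from node [i] to node [j] with tag [t]. *)
Record workflow (Sigma Gamma : finType) := Workflow {
  wf_names : seq Sigma;
  wf_edges : seq (nat * Gamma * nat) }.

Definition wf_size Sigma Gamma (W : workflow Sigma Gamma) : nat :=
  size (wf_names W).

(* [i < j] on every edge says that the numbering is a topological order, hence
   that the multigraph is acyclic.  Parallel edges carry different tags because
   the triples are pairwise distinct. *)
Definition simple_workflow Sigma Gamma (W : workflow Sigma Gamma) : bool :=
  uniq (wf_edges W) && all (fun e => e.1.1 < e.2 < wf_size W) (wf_edges W).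

Definition is_source Sigma Gamma (W : workflow Sigma Gamma) (i : nat) : bool :=
  ~~ has (fun e => e.2 == i) (wf_edges W).

Definition is_sink Sigma Gamma (W : workflow Sigma Gamma) (i : nat) : bool :=
  ~~ has (fun e => e.1.1 == i) (wf_edges W).

Definition source Sigma Gamma (W : workflow Sigma Gamma) : nat :=
  find (is_source W) (iota 0 (wf_size W)).

Definition sink Sigma Gamma (W : workflow Sigma Gamma) : nat :=
  find (is_sink W) (iota 0 (wf_size W)).

Record production (Sigma Gamma : finType) := Production {
  lhs : Sigma;
  rhs : workflow Sigma Gamma }.

(* The position of a production in [prods] is its rank in the fixed ordering. *)
Record grammar (Sigma Gamma : finType) := Grammar {
  composite : {set Sigma};
  start : Sigma;
  prods : seq (production Sigma Gamma) }.

Definition specification Sigma Gamma (G : grammar Sigma Gamma) : bool :=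
  all (fun p => (lhs p \in composite G) && simple_workflow (rhs p)) (prods G).

Definition coarse_grained Sigma Gamma (G : grammar Sigma Gamma) : bool :=
  all (fun p => let V := iota 0 (wf_size (rhs p)) in
         (count (is_source (rhs p)) V == 1) && (count (is_sink (rhs p)) V == 1))
      (prods G).

Definition lhs_of Sigma Gamma (G : grammar Sigma Gamma) (k : nat) : Sigma :=
  nth (start G) (map (@lhs _ _) (prods G)) k.

Definition rhs_of Sigma Gamma (G : grammar Sigma Gamma) (k : nat) :
    workflow Sigma Gamma :=
  nth (Workflow [::] [::]) (map (@rhs _ _) (prods G)) k.

(** * The production graph and its cycles *)

(* The edge [(k, i)] goes from the left-hand side of production [k] to the name
   of node [i] of its right-hand side (both counted from 0). *)
Definition pedge : Type := (nat * nat)%type.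

Definition is_pedge Sigma Gamma (G : grammar Sigma Gamma) (e : pedge) : bool :=
  (e.1 < size (prods G)) && (e.2 < wf_size (rhs_of G e.1)).

Definition psrc Sigma Gamma (G : grammar Sigma Gamma) (e : pedge) : Sigma :=
  lhs_of G e.1.

Definition ptgt Sigma Gamma (G : grammar Sigma Gamma) (e : pedge) : Sigma :=
  nth (start G) (wf_names (rhs_of G e.1)) e.2.

(* A (simple) cycle, written as its edges in order from some first edge;
   rotating the sequence changes the first edge but not the cycle. *)
Definition is_pcycle Sigma Gamma (G : grammar Sigma Gamma) (c : seq pedge) :
    bool :=
  [&& c != [::], all (is_pedge G) c,
      cycle (fun e f => ptgt G e == psrc G f) c & uniq (map (psrc G) c)].

Definition same_cycle (c d : seq pedge) : Prop := exists n, d = rot n c.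

Definition strictly_linear_recursive Sigma Gamma (G : grammar Sigma Gamma) :
    Prop :=
  forall c d, is_pcycle G c -> is_pcycle G d -> ~ same_cycle c d ->
  forall M, M \in map (psrc G) c -> M \notin map (psrc G) d.

(* [cyc] enumerates the cycles without repetition, each one from its chosen
   first edge. *)
Definition cycle_enumeration Sigma Gamma (G : grammar Sigma Gamma)
    (cyc : seq (seq pedge)) : Prop :=
  [/\ forall c, c \in cyc -> is_pcycle G c,
      forall c, is_pcycle G c -> exists2 d, d \in cyc & same_cycle d c
    & forall s s', s < size cyc -> s' < size cyc ->
        same_cycle (nth [::] cyc s) (nth [::] cyc s') -> s = s'].

Definition recursive Sigma Gamma (G : grammar Sigma Gamma)
    (cyc : seq (seq pedge)) (M : Sigma) : bool :=
  has (fun c => M \in map (psrc G) c) cyc.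

(** * Runs *)

(* A node created by a derivation is named by its history: the start node is
   [[::]], and node [i] of the copy of the [k]-th right-hand side that replaces
   [v] is [rcons v (k, i)].  In particular the copies have fresh nodes. *)
Definition node : Type := seq pedge.

Record graph (Sigma Gamma : finType) := Graph {
  nodes : seq node;
  name : node -> Sigma;
  edges : seq (node * Gamma * node) }.

Definition initial_graph Sigma Gamma (G : grammar Sigma Gamma) :
    graph Sigma Gamma :=
  Graph [:: [::]] (fun _ => start G) [::].

Definition replace Sigma Gamma (G : grammar Sigma Gamma)
    (g : graph Sigma Gamma) (v : node) (k : nat) : graph Sigma Gamma :=
  let W := rhs_of G k in
  let copy i := rcons v (k, i) in
  let V := [seq copy i | i <- iota 0 (wf_size W)] in
  Graph
    ([seq x <- nodes g | x != v] ++ V)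
    (fun x => if x \in V then ptgt G (last (k, 0) x) else name g x)
    ([seq (if e.1.1 == v then copy (sink W) else e.1.1, e.1.2,
           if e.2 == v then copy (source W) else e.2) | e <- edges g]
     ++ [seq (copy e.1.1, e.1.2, copy e.2) | e <- wf_edges W]).

Inductive derived Sigma Gamma (G : grammar Sigma Gamma) :
    graph Sigma Gamma -> Prop :=
| Derived_start : derived G (initial_graph G)
| Derived_replace g v k :
    derived G g -> v \in nodes g -> k < size (prods G) ->
    lhs_of G k = name g v -> derived G (replace G g v k).

Definition run Sigma Gamma (G : grammar Sigma Gamma) (g : graph Sigma Gamma) :
    Prop :=
  derived G g /\ forall v, v \in nodes g -> name g v \notin composite G.

Definition edge_rel Sigma Gamma (g : graph Sigma Gamma) : rel node :=
  fun x y => [exists t : Gamma, (x, t, y) \in edges g].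

(* The path with no edges, from a node to itself, is allowed. *)
Definition reach Sigma Gamma (g : graph Sigma Gamma) (u v : node) : Prop :=
  exists2 p : seq node, path (edge_rel g) u p & last u p = v.

(** * The compressed parse tree and its labels *)

(* The label of a tree edge: [inl (k, i)] below a composite node and
   [inr (s, t, i)] below a recursive node; all indices are counted from 0. *)
Definition entry : Type := (nat * nat + nat * nat * nat)%type.

(* The compressed parse tree is handled as a tree domain: a tree node is
   identified with the sequence of edge labels on its path from the root.  The
   tree consists of the positions of the leaves, i.e. of the run's nodes, and of
   their prefixes. *)
Definition position : Type := seq entry.

(* A node with module [M] that does not continue a recursion goes to place [p],
   unless [M] is recursive: then a recursive node is put at [p] and the new node
   is its first child.  The recursion starts from the edge of the [s]-th cycle
   that leaves [M]. *)
Definition place Sigma Gamma (G : grammar Sigma Gamma)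
    (cyc : seq (seq pedge)) (p : position) (M : Sigma) : position :=
  if recursive G cyc M then
    let s := find (fun c => M \in map (psrc G) c) cyc in
    let t := index M (map (psrc G) (nth [::] cyc s)) in
    rcons p (inr (s, t, 0))
  else p.

(* Given that the composite node at [p] is the [j]-th child (from 0) of a
   recursive node unfolding the [s]-th cycle from its [t]-th edge, tells whether
   [e] is the cycle edge along which the recursion continues. *)
Definition continues (cyc : seq (seq pedge)) (s t j : nat) (e : pedge) : bool :=
  let c := nth [::] cyc s in nth (0, 0) c ((t + j) %% size c) == e.

(* The position of the node created along the production-graph edge [e] when
   the composite node at position [p] is replaced: in a continuing recursion it
   is the next sibling of [p], otherwise a child of [p]. *)
Definition child_position Sigma Gamma (G : grammar Sigma Gamma)
    (cyc : seq (seq pedge)) (p : position) (e : pedge) : position :=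
  let fresh := place G cyc (rcons p (inl e)) (ptgt G e) in
  if p is x :: p' then
    if last x p' is inr (s, t, j) then
      if continues cyc s t j e then rcons (belast x p') (inr (s, t, j.+1))
      else fresh
    else fresh
  else fresh.

Definition psi Sigma Gamma (G : grammar Sigma Gamma)
    (cyc : seq (seq pedge)) (v : node) : position :=
  foldl (child_position G cyc) (place G cyc [::] (start G)) v.

(* Siblings are ordered by the last component of their edge label; the other
   components agree among siblings. *)
Definition sibling_lt (a b : entry) : bool :=
  match a, b with
  | inl (_, i), inl (_, j) => i < j
  | inr (_, _, i), inr (_, _, j) => i < j
  | _, _ => false
  end.

(* Post-order: a tree node comes after its descendants, and the subtrees of
   siblings come one after the other. *)
Fixpoint postorder_le (p q : position) : bool :=
  match p, q with
  | _, [::] => true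
  | [::], _ :: _ => false
  | a :: p', b :: q' => if a == b then postorder_le p' q' else sibling_lt a b
  end.

Definition query_list Sigma Gamma (G : grammar Sigma Gamma)
    (cyc : seq (seq pedge)) (g : graph Sigma Gamma) (l : seq node) : Prop :=
  {subset l <= nodes g} /\
  sorted (fun u v => postorder_le (psi G cyc u) (psi G cyc v)) l.

(** * Word RAM *)

(* Programs of a RAM with structured control flow, finitely many registers
   (per program), an addressable memory and a write-only output.  [Fetch x y] is
   x := mem[y] and [Store x y] is mem[x] := y; [If] and [While] test whether a
   register is nonzero. *)
Inductive cmd :=
| Skip
| Const (x n : nat)
| Add (x y z : nat)
| Sub (x y z : nat)
| Fetch (x y : nat)
| Store (x y : nat)
| Write (x : nat)
| Seq (c1 c2 : cmd)
| If (x : nat) (c1 c2 : cmd)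
| While (x : nat) (c : cmd).

Record state := State {
  regs : nat -> nat;
  mem : nat -> nat;
  output : seq nat }.

Definition upd (f : nat -> nat) (x v : nat) : nat -> nat :=
  fun y => if y == x then v else f y.

Definition set_reg (st : state) (x v : nat) : state :=
  State (upd (regs st) x v) (mem st) (output st).

(* [exec B P st t st']: with words ranging over [0, B), [P] started in [st]
   halts in [st'] after [t] elementary operations.  An overflow is an error: the
   operation then has no transition.  Subtraction is truncated. *)
Inductive exec (B : nat) : cmd -> state -> nat -> state -> Prop :=
| Exec_skip st : exec B Skip st 1 st
| Exec_const st x n : n < B -> exec B (Const x n) st 1 (set_reg st x n)
| Exec_add st x y z : regs st y + regs st z < B ->
    exec B (Add x y z) st 1 (set_reg st x (regs st y + regs st z))
| Exec_sub st x y z :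
    exec B (Sub x y z) st 1 (set_reg st x (regs st y - regs st z))
| Exec_fetch st x y :
    exec B (Fetch x y) st 1 (set_reg st x (mem st (regs st y)))
| Exec_store st x y :
    exec B (Store x y) st 1
      (State (regs st) (upd (mem st) (regs st x) (regs st y)) (output st))
| Exec_write st x :
    exec B (Write x) st 1
      (State (regs st) (mem st) (rcons (output st) (regs st x)))
| Exec_seq st st1 st2 c1 c2 t1 t2 :
    exec B c1 st t1 st1 -> exec B c2 st1 t2 st2 ->
    exec B (Seq c1 c2) st (t1 + t2) st2
| Exec_if st st1 x c1 c2 t :
    exec B (if regs st x != 0 then c1 else c2) st t st1 ->
    exec B (If x c1 c2) st t.+1 st1
| Exec_while_end st x c : regs st x = 0 -> exec B (While x c) st 1 st
| Exec_while_loop st st1 st2 x c t1 t2 :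
    regs st x != 0 -> exec B c st t1 st1 -> exec B (While x c) st1 t2 st2 ->
    exec B (While x c) st (t1 + t2).+1 st2.

(** * The all-pairs reachability query *)

Definition encode_entry (a : entry) : seq nat :=
  match a with
  | inl (k, i) => [:: 0; k; i; 0]
  | inr (s, t, i) => [:: 1; s; t; i]
  end.

Definition encode_label (p : position) : seq nat :=
  size p :: flatten (map encode_entry p).

Definition encode_list (l : seq position) : seq nat :=
  size l :: flatten (map encode_label l).

Definition query_input Sigma Gamma (G : grammar Sigma Gamma)
    (cyc : seq (seq pedge)) (l1 l2 : seq node) : seq nat :=
  encode_list (map (psi G cyc) l1) ++ encode_list (map (psi G cyc) l2).

Definition initial_state (input : seq nat) : state :=
  State (fun _ => 0) (nth 0 input) [::].

(* [pairs] lists the set of answers without repetition, so its size is the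
   number of pairs. *)
Definition is_answer Sigma Gamma (g : graph Sigma Gamma) (l1 l2 : seq node)
    (pairs : seq (node * node)) : Prop :=
  uniq pairs /\
  forall u v, (u, v) \in pairs <-> [/\ u \in l1, v \in l2 & reach g u v].

(* From the labels in [l1] and [l2], and with words ranging over [0, B), [P]
   writes the labels of [pairs] and halts, all in time [t]. *)
Definition computes Sigma Gamma (G : grammar Sigma Gamma)
    (cyc : seq (seq pedge)) (B : nat) (P : cmd) (l1 l2 : seq node)
    (t : nat) (pairs : seq (node * node)) : Prop :=
  exists2 st, exec B P (initial_state (query_input G cyc l1 l2)) t st
    & output st = flatten [seq encode_label (psi G cyc uv.1) ++
                               encode_label (psi G cyc uv.2) | uv <- pairs].

(* Main.v *)
Require Import Defs.
From mathcomp Require Import all_boot zify.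
Set Implicit Arguments.
Unset Strict Implicit.
Unset Printing Implicit Defensive.

(* Two nodes [u], [v] of a run separate in the copy of one right-hand side, and
   reachability between the corresponding nodes of the right-hand side decides
   the query.  In the compressed parse tree they separate either below a
   composite node, or below a recursive node; in the latter case the node that
   lies deeper in the recursion is inside the copy of the cycle node of the
   production applied where the other one left the recursion.  Hence, at a given
   level of the tree, the answers [v] for a given [u] that leaves a recursion
   first, or that separates below a composite node towards a given child, are
   none or consecutive elements of the second list, and symmetrically for a
   given [v] that leaves a recursion first.  The lists are in tree order, so for
   each level and kind of separation one sweep with a non-returning pointer
   outputs these pairs, and each pair is output by exactly one sweep.  There are
   boundedly many levels: an edge of the tree below a composite node decreases
   the number of modules reachable in the production graph, because a cycle
   through it would be the one that the recursion unfolds.  Repetitions are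
   removed from the lists first, as a sweep would otherwise read the copies of a
   node once for every partner. *)

(** * Reachability in a run *)

(** The program sees labels only, never the run, and both its text and its constants may depend on
    nothing but the grammar. The obstacle is that most pairs may fail, so every failed comparison
    has to be charged to an outer element, to an inner element that is discarded for good, or to an
    output. This is what dictates the roles in a sweep: in a recursion the node that leaves first
    must be the outer one, since its label alone decides the query. Indeed the cycle has only one
    edge out of the left-hand side of the production applied there, so the cycle node is known
    without reading the deeper label. Below a composite node both child numbers matter; there are
    boundedly many, so one sweep is made for each child of the second node, and reachability inside
    the right-hand side becomes a finite table expanded into the test. A node paired with itself
    separates nowhere and gets a sweep of its own. The tests order labels by sibling positions
    alone; this suffices because the labels of two distinct nodes agree up to a level where both
    have an entry, of the same kind and with different sibling positions. *)

Section Workflow.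
Variables (Sigma Gamma : finType).
Implicit Types (W : workflow Sigma Gamma).

Definition wf_edge W (i j : nat) : bool :=
  has (fun e => (e.1.1 == i) && (e.2 == j)) (wf_edges W).

(** Reachability has to be a boolean, because its values are built into the tests of the program.
    Node numbers increase along edges, so [wf_size W] units of fuel suffice. *)
Fixpoint wf_reach_in W (n i j : nat) : bool :=
  (i == j) || if n is m.+1 then
    has (fun e => (e.1.1 == i) && wf_reach_in W m e.2 j) (wf_edges W)
  else false.

Definition wf_reach W (i j : nat) : bool := wf_reach_in W (wf_size W) i j.

Lemma wf_edgeP W i j :
  reflect (exists t, (i, t, j) \in wf_edges W) (wf_edge W i j).
Proof.
apply: (iffP hasP) => [[[[a t] b] /= e_in /andP[/eqP<- /eqP<-]]|[t e_in]].
  by exists t.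
by exists (i, t, j); rewrite //= !eqxx.
Qed.

Lemma simple_wf_edge W i j : simple_workflow W -> wf_edge W i j -> i < j < wf_size W.
Proof.
by case/andP=> _ /allP lt_e /wf_edgeP[t /lt_e].
Qed.

(** Each edge raises the node number by at least one. This bounds the length of paths and also gives
    acyclicity. *)
Lemma wf_path_size W i p :
  simple_workflow W -> path (wf_edge W) i p -> size p + i <= last i p.
Proof.
move=> sW; elim: p i => //= j p IHp i /andP[/(simple_wf_edge sW) lt_ij /IHp]; lia.
Qed.

Lemma wf_reach_inP W n i j :
  reflect (exists2 p, size p <= n & path (wf_edge W) i p && (last i p == j))
          (wf_reach_in W n i j).
Proof.
elim: n i => [|n IHn] i /=.
  rewrite orbF; apply: (iffP eqP) => [<-|[[|//] _ /= /eqP//]].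
  by exists [::] => //=.
apply: (iffP orP) => [[/eqP<-|/hasP[[[a t] b] e_in /= /andP[/eqP ea]]]|].
- by exists [::] => //=.
- case/IHn=> p sp /andP[pp lp]; exists (b :: p) => //=.
  by rewrite pp lp !andbT; apply/wf_edgeP; exists t; rewrite -ea.
case=> [[|b p]] /= sp; first by left.
case/andP=> /andP[/wf_edgeP[t e_in] pp] lp; right; apply/hasP.
exists (i, t, b) => //=; rewrite eqxx /=; apply/IHn; exists p => //.
by rewrite pp.
Qed.

Lemma wf_last_size W i p :
  simple_workflow W -> p != [::] -> path (wf_edge W) i p -> last i p < wf_size W.
Proof.
move=> sW; case/lastP: p => // p j _; rewrite rcons_path last_rcons.
by case/andP=> _ /(simple_wf_edge sW)/andP[].
Qed.

Lemma wf_reachP W i j : simple_workflow W ->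
  reflect (exists2 p, path (wf_edge W) i p & last i p = j) (wf_reach W i j).
Proof.
move=> sW; apply: (iffP (wf_reach_inP _ _ _ _)) => [[p _ /andP[pp /eqP]]|[p pp lp]].
  by exists p.
exists p; last by rewrite pp lp eqxx.
case: (eqVneq p [::]) => [->//|p0].
by have := wf_path_size sW pp; have := wf_last_size sW p0 pp; lia.
Qed.

Lemma wf_reach_refl W i : wf_reach W i i.
Proof. by rewrite /wf_reach; case: (wf_size W) => [|n] /=; rewrite eqxx. Qed.

Lemma wf_edge_reach W i j : simple_workflow W -> wf_edge W i j -> wf_reach W i j.
Proof.
by move=> sW e; apply/(wf_reachP _ _ sW); exists [:: j]; rewrite //= e.
Qed.

Lemma wf_reach_trans W j i k : simple_workflow W ->
  wf_reach W i j -> wf_reach W j k -> wf_reach W i k.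
Proof.
move=> sW /(wf_reachP _ _ sW)[p pp <-] /(wf_reachP _ _ sW)[q pq <-].
by apply/(wf_reachP _ _ sW); exists (p ++ q); rewrite ?cat_path ?pp ?last_cat.
Qed.

Lemma wf_reach_leq W i j : simple_workflow W -> wf_reach W i j -> i <= j.
Proof.
move=> sW /(wf_reachP _ _ sW)[p pp <-]; have := wf_path_size sW pp; lia.
Qed.

Lemma count1_find (T : eqType) (x0 : T) (a : pred T) s x :
  count a s = 1 -> x \in s -> a x -> x = nth x0 s (find a s).
Proof.
elim: s => //= y s IHs; rewrite inE.
case: ifP => ay /=.
  rewrite add1n => -[/eqP c0] /orP[/eqP-> //|xs] ax.
  move: c0; rewrite -leqn0 leqNgt -has_count.
  by move/hasPn/(_ x xs); rewrite ax.
rewrite add0n => c1 /orP[/eqP->|]; first by rewrite ay.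
exact: IHs.
Qed.

Definition unique_ends W : bool :=
  let V := iota 0 (wf_size W) in
  (count (is_source W) V == 1) && (count (is_sink W) V == 1).

Lemma find_iota_nth (a : pred nat) n : has a (iota 0 n) ->
  nth 0 (iota 0 n) (find a (iota 0 n)) = find a (iota 0 n).
Proof.
by move=> ha; rewrite nth_iota ?add0n //; rewrite has_find size_iota in ha.
Qed.

Lemma source_lt W : unique_ends W -> source W < wf_size W.
Proof.
case/andP=> /eqP c1 _; rewrite /source -[ltnRHS](size_iota 0) -has_find.
by rewrite has_count c1.
Qed.

Lemma sink_lt W : unique_ends W -> sink W < wf_size W.
Proof.
case/andP=> _ /eqP c1; rewrite /sink -[ltnRHS](size_iota 0) -has_find.
by rewrite has_count c1.
Qed.

(** Strong induction on [i]: a node without incoming edge is the unique source, and any other node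
    has a predecessor with a smaller number. The dual lemma for the sink inducts on
    [wf_size W - i]. *)
Lemma source_reach W i : simple_workflow W -> unique_ends W -> i < wf_size W ->
  wf_reach W (source W) i.
Proof.
move=> sW uW; have [/eqP c1 _] := andP uW.
elim/ltn_ind: i => i IHi lt_i.
case: (boolP (is_source W i)) => [si|].
  have hs : has (is_source W) (iota 0 (wf_size W)) by rewrite has_count c1.
  rewrite /source -(find_iota_nth hs).
  rewrite -(count1_find 0 c1 _ si) ?wf_reach_refl //.
  by rewrite mem_iota /= add0n.
rewrite negbK => /hasP[[[a t] b] e_in /= /eqP eb].
have e : wf_edge W a i by apply/wf_edgeP; exists t; rewrite -eb.
have lt_ai := simple_wf_edge sW e.
by apply: (wf_reach_trans sW (IHi a _ _)); rewrite ?wf_edge_reach //; lia.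
Qed.

Lemma reach_sink W i : simple_workflow W -> unique_ends W -> i < wf_size W ->
  wf_reach W i (sink W).
Proof.
move=> sW uW; have [_ /eqP c1] := andP uW.
have [n] := ubnP (wf_size W - i); elim: n i => // n IHn i lt_n lt_i.
case: (boolP (is_sink W i)) => [si|].
  have hs : has (is_sink W) (iota 0 (wf_size W)) by rewrite has_count c1.
  rewrite /sink -(find_iota_nth hs).
  rewrite -(count1_find 0 c1 _ si) ?wf_reach_refl //.
  by rewrite mem_iota /= add0n.
rewrite negbK => /hasP[[[a t] b] e_in /= /eqP ea].
have e : wf_edge W i b by apply/wf_edgeP; exists t; rewrite -ea.
have lt_ai := simple_wf_edge sW e.
apply: (wf_reach_trans sW (wf_edge_reach sW e) (IHn _ _ _)); lia.
Qed.

End Workflow.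

(** * Reachability in a graph and the effect of one replacement *)

Section Reach.
Variables (Sigma Gamma : finType).
Implicit Types (g : graph Sigma Gamma).

Lemma edge_relP g x y :
  reflect (exists t, (x, t, y) \in edges g) (edge_rel g x y).
Proof. exact: existsP. Qed.

Lemma reach_refl g x : reach g x x.
Proof. by exists [::]. Qed.

Lemma reach_trans g y x z : reach g x y -> reach g y z -> reach g x z.
Proof.
move=> [p pp <-] [q pq <-].
by exists (p ++ q); rewrite ?cat_path ?pp ?last_cat.
Qed.

Lemma edge_reach g x y : edge_rel g x y -> reach g x y.
Proof. by move=> e; exists [:: y]; rewrite //= e. Qed.

Lemma reach_ind_left g z (P : node -> Prop) :
  P z -> (forall x y, edge_rel g x y -> reach g y z -> P y -> P x) ->
  forall x, reach g x z -> P x.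
Proof.
move=> Pz Pe x [p]; elim: p x => [|y p IHp] x /=; first by move=> _ ->.
by case/andP=> e pp lp; apply: (Pe _ y e); [exists p | apply: IHp].
Qed.

Lemma reach_homo g g' (f : node -> node) :
  (forall x y, edge_rel g x y -> reach g' (f x) (f y)) ->
  forall x y, reach g x y -> reach g' (f x) (f y).
Proof.
move=> fe x y; elim/reach_ind_left: x / => [|x z e _]; first exact: reach_refl.
exact/reach_trans/fe.
Qed.

(* The nodes [x] and [y] are created below the same composite node, in the
   copies of the nodes [i] and [j] of the right-hand side [k]. *)
Definition diverge (x y : node) (k i j : nat) : Prop :=
  exists h a b, [/\ x = h ++ (k, i) :: a, y = h ++ (k, j) :: b & i != j].

Variable G : grammar Sigma Gamma.
Hypotheses (hspec : specification G) (hcoarse : coarse_grained G).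

Lemma rhs_ofP k : k < size (prods G) -> simple_workflow (rhs_of G k) && unique_ends (rhs_of G k).
Proof.
move=> lt_k; pose p0 := Production (start G) (rhs_of G k).
rewrite /rhs_of (nth_map p0) //.
have /(all_nthP p0)/(_ _ lt_k)/andP[_ ->] := hspec.
by have /(all_nthP p0)/(_ _ lt_k) := hcoarse.
Qed.

Section Replace.
Variables (g : graph Sigma Gamma) (v : node) (k : nat).
Hypotheses (lt_k : k < size (prods G)) (v_in : v \in nodes g).
Hypothesis edges_g : forall x y, edge_rel g x y ->
  [/\ x \in nodes g, y \in nodes g & x != y].

Let W := rhs_of G k.
Let copy i := rcons v (k, i).
Let g' := replace G g v k.

(** Freshness and the absence of closed paths at [v] follow from the invariant in [derived_nodes];
    they are assumed here so that its inductive step can use this section. *)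
Hypothesis fresh : forall i, copy i \notin nodes g.
Hypothesis no_back : forall y, y \in nodes g -> y != v -> reach g v y -> ~ reach g y v.

Let sW : simple_workflow W. Proof. by have /andP[] := rhs_ofP lt_k. Qed.
Let uW : unique_ends W. Proof. by have /andP[] := rhs_ofP lt_k. Qed.

Lemma copy_inj i j : copy i = copy j -> i = j.
Proof. by move/rcons_inj=> -[]. Qed.

Lemma copy_neq i x : x \in nodes g -> x != copy i.
Proof. by move=> x_in; apply: contraNneq (fresh i) => <-. Qed.

(** An old edge of [g'] starts at the outward image of its source and ends at the inward image of
    its target. In the opposite direction [proj] contracts the copy of [W] to [v]. *)
Let redirect_out x := if x == v then copy (sink W) else x.
Let redirect_in x := if x == v then copy (source W) else x.
Let proj x := if x \in nodes g then x else v.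

Lemma replace_edgeP x y : reflect
  ((exists x0 y0, [/\ edge_rel g x0 y0, x = redirect_out x0 & y = redirect_in y0])
   \/ (exists i j, [/\ wf_edge W i j, x = copy i & y = copy j]))
  (edge_rel g' x y).
Proof.
apply: (iffP (edge_relP _ _ _)) => [[t]|].
  rewrite mem_cat => /orP[] /mapP[[[a u] b] /= e_in [-> _ ->]].
    by left; exists a, b; split=> //; apply/edge_relP; exists u.
  by right; exists a, b; split=> //; apply/wf_edgeP; exists u.
case=> [[x0 [y0 [/edge_relP[t e_in] -> ->]]]|[i [j [/wf_edgeP[t e_in] -> ->]]]];
  exists t; rewrite mem_cat; apply/orP; [left|right]; apply/mapP.
  by exists (x0, t, y0).
by exists (i, t, j).
Qed.

Lemma reach_copy i j : wf_reach W i j -> reach g' (copy i) (copy j).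
Proof.
case/(wf_reachP _ _ sW)=> p; elim: p i => [|l p IHp] i /=.
  by move=> _ ->; apply: reach_refl.
case/andP=> e pp lp; apply: reach_trans (IHp _ pp lp).
by apply/edge_reach/replace_edgeP; right; exists i, l.
Qed.

(** A path of [g] through [v] is continued across the copy from its source to its sink; this is
    where coarse-grainedness enters. *)
Lemma redirect_in_out x : reach g' (redirect_in x) (redirect_out x).
Proof.
rewrite /redirect_in /redirect_out; case: eqP => _; last exact: reach_refl.
exact/reach_copy/source_reach/sink_lt.
Qed.

Lemma redirect_edge x y : edge_rel g x y -> reach g' (redirect_out x) (redirect_in y).
Proof. by move=> e; apply/edge_reach/replace_edgeP; left; exists x, y. Qed.

Lemma reach_redirect_in x y :
  reach g x y -> reach g' (redirect_in x) (redirect_in y).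
Proof.
apply: reach_homo => {}x {}y /redirect_edge; exact/reach_trans/redirect_in_out.
Qed.

Lemma reach_redirect_out x y :
  reach g x y -> reach g' (redirect_out x) (redirect_out y).
Proof.
apply: reach_homo => {}x {}y /redirect_edge e.
exact: reach_trans e (redirect_in_out y).
Qed.

Lemma proj_out x : x \in nodes g -> proj (redirect_out x) = x.
Proof.
rewrite /redirect_out; case: eqP => [->|_] x_in; last by rewrite /proj x_in.
by rewrite /proj (negPf (fresh _)).
Qed.

Lemma proj_in x : x \in nodes g -> proj (redirect_in x) = x.
Proof.
rewrite /redirect_in; case: eqP => [->|_] x_in; last by rewrite /proj x_in.
by rewrite /proj (negPf (fresh _)).
Qed.

Lemma proj_copy i : proj (copy i) = v.
Proof. by rewrite /proj (negPf (fresh _)). Qed.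

(** Under [proj] an edge of [g'] becomes an edge of [g] or collapses to [v]. *)
Lemma reach_proj x y : reach g' x y -> reach g (proj x) (proj y).
Proof.
apply: reach_homo => {}x {}y /replace_edgeP[].
  case=> x0 [y0 [e -> ->]]; have [x_in y_in _] := edges_g e.
  by rewrite proj_out // proj_in //; apply: edge_reach.
by case=> i [j [_ -> ->]]; rewrite !proj_copy; apply: reach_refl.
Qed.

Lemma reach_replace_old x y : x \in nodes g -> y \in nodes g -> x != v -> y != v ->
  reach g' x y <-> reach g x y.
Proof.
move=> x_in y_in xv yv; split=> [/reach_proj|/reach_redirect_in].
  by rewrite /proj x_in y_in.
by rewrite /redirect_in (negPf xv) (negPf yv).
Qed.

Lemma reach_replace_to x i : x \in nodes g -> x != v -> i < wf_size W ->
  reach g' x (copy i) <-> reach g x v.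
Proof.
move=> x_in xv lt_i; split=> [/reach_proj|/reach_redirect_in].
  by rewrite /proj x_in (negPf (fresh _)).
rewrite /redirect_in (negPf xv) eqxx => r; apply: reach_trans r _.
exact/reach_copy/source_reach.
Qed.

Lemma reach_replace_from y i : y \in nodes g -> y != v -> i < wf_size W ->
  reach g' (copy i) y <-> reach g v y.
Proof.
move=> y_in yv lt_i; split=> [/reach_proj|/reach_redirect_out].
  by rewrite /proj y_in (negPf (fresh _)).
rewrite /redirect_out (negPf yv) eqxx => r; apply: reach_trans _ r.
exact/reach_copy/reach_sink.
Qed.

(* A path that leaves the copy cannot return to it, since [g] has no path from
   a successor of [v] back to [v]. *)
Lemma reach_replace_copy i j : reach g' (copy i) (copy j) <-> wf_reach W i j.
Proof.
split; last exact: reach_copy.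
move=> r; suff /(_ _ r i erefl) : forall x, reach g' x (copy j) -> forall i, x = copy i -> wf_reach W i j by [].
move=> x; elim/reach_ind_left: x / => [l /copy_inj->|x y e r' IH l ex]; first exact: wf_reach_refl.
case/replace_edgeP: e => [[x0 [y0 [e ex0 ey]]]|[a [b [e ea eb]]]].
  have [x_in y_in neq_xy] := edges_g e.
  have ex0v : x0 = v.
    by move: ex0; rewrite ex /redirect_out; case: eqP => // _ /eqP; rewrite eq_sym (negPf (copy_neq _ x_in)).
  have := reach_proj r'; rewrite ey proj_in // proj_copy => back.
  case: (no_back y_in _ _ back); first by rewrite -ex0v eq_sym.
  by apply: edge_reach; rewrite -ex0v.
have -> : l = a by apply: copy_inj; rewrite -ea.
exact: wf_reach_trans (wf_edge_reach sW e) (IH _ eb).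
Qed.

Lemma mem_replace x : x \in nodes g' ->
  (x \in nodes g /\ x != v) \/ exists2 i, i < wf_size W & x = copy i.
Proof.
rewrite mem_cat mem_filter => /orP[/andP[-> ->]|/mapP[i]]; first by left.
by rewrite mem_iota add0n => lt_i ->; right; exists i.
Qed.

Lemma replace_mem x : x \in nodes g -> x != v -> x \in nodes g'.
Proof. by rewrite mem_cat mem_filter => -> ->. Qed.

Lemma replace_mem_copy i : i < wf_size W -> copy i \in nodes g'.
Proof.
by move=> lt_i; rewrite mem_cat; apply/orP; right; apply/map_f; rewrite mem_iota.
Qed.

Lemma replace_edges x y : edge_rel g' x y ->
  [/\ x \in nodes g', y \in nodes g' & x != y].
Proof.
case/replace_edgeP=> [[x0 [y0 [/edges_g[x_in y_in neq_xy] -> ->]]]|[i [j [e -> ->]]]]; last first.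
  have lt_ij := simple_wf_edge sW e.
  by split; [apply: replace_mem_copy; lia|apply: replace_mem_copy; lia|apply/eqP=> /copy_inj; lia].
split.
- rewrite /redirect_out; case: eqP => [_|/eqP xv]; last exact: replace_mem.
  exact/replace_mem_copy/sink_lt.
- rewrite /redirect_in; case: eqP => [_|/eqP xv]; last exact: replace_mem.
  exact/replace_mem_copy/source_lt.
rewrite /redirect_in /redirect_out; case: (eqVneq x0 v) => [ex|xv]; case: (eqVneq y0 v) => [ey|yv] //.
- by rewrite ex ey eqxx in neq_xy.
- by rewrite eq_sym; apply: copy_neq.
exact: copy_neq.
Qed.

End Replace.

(** A later replacement leaves reachability between old nodes unchanged, and every node of the new
    copy is related to the old nodes as [v] was. Both directions of reachability are kept in the
    invariant, because together they exclude closed paths. *)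
Lemma derived_nodes g : derived G g ->
  (forall x y, edge_rel g x y -> [/\ x \in nodes g, y \in nodes g & x != y]) /\
  (forall x y, x \in nodes g -> y \in nodes g -> x != y ->
   exists k i j, [/\ [/\ k < size (prods G), i < wf_size (rhs_of G k) & j < wf_size (rhs_of G k)],
     diverge x y k i j,
     reach g x y <-> wf_reach (rhs_of G k) i j
   & reach g y x <-> wf_reach (rhs_of G k) j i]).
Proof.
elim=> [|{}g v k dg [edges_g IH] v_in lt_k _].
  split=> [x y /edge_relP[t]|x y] //=.
  by rewrite !inE => /eqP-> /eqP->; rewrite eqxx.
(* Distinct nodes of [g] diverge, whereas [v] is a prefix of [rcons v (k, i)]. *)
have fresh i : rcons v (k, i) \notin nodes g.
  apply/negP=> c_in; have [|k' [i' [j' [_ [h [a [b [ev ec neq_ij]]]] _ _]]]] := IH _ _ v_in c_in.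
    by apply/eqP=> /(congr1 size); rewrite size_rcons; lia.
  move: ec; rewrite ev -cats1 -catA /= => /eqP; rewrite eqseq_cat // eqxx /= eqseq_cons.
  by case/andP=> /eqP[eij]; rewrite eij eqxx in neq_ij.
(* Paths both ways would give [i' <= j' <= i'] in a topologically ordered right-hand side. *)
have no_back y : y \in nodes g -> y != v -> reach g v y -> ~ reach g y v.
  move=> y_in yv r1 r2; have [|k' [i' [j' [[lt_k' _ _] [h [a [b [_ _ neq_ij]]]] e1 e2]]]] := IH _ _ v_in y_in.
    by rewrite eq_sym.
  have /andP[sW _] := rhs_ofP lt_k'.
  have := wf_reach_leq sW (e1.1 r1); have := wf_reach_leq sW (e2.1 r2).
  by move: neq_ij; lia.
split; first by apply: replace_edges.
(* An old node and a node of the copy diverge where the old node and [v] did. *)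
have mixed x i : x \in nodes g -> x != v -> i < wf_size (rhs_of G k) -> exists k' i' j',
    [/\ [/\ k' < size (prods G), i' < wf_size (rhs_of G k') & j' < wf_size (rhs_of G k')],
     diverge x (rcons v (k, i)) k' i' j',
     reach (replace G g v k) x (rcons v (k, i)) <-> wf_reach (rhs_of G k') i' j'
   & reach (replace G g v k) (rcons v (k, i)) x <-> wf_reach (rhs_of G k') j' i'].
  move=> x_in xv lt_i; have [k' [i' [j' [lts [h [a [b [ex ev neq_ij]]]] e1 e2]]]] := IH _ _ x_in v_in xv.
  exists k', i', j'; split=> //.
  - by exists h, a, (rcons b (k, i)); rewrite ev rcons_cat.
  - by rewrite -e1; apply: reach_replace_to.
  by rewrite -e2; apply: reach_replace_from.
move=> x y /mem_replace[[x_in xv]|[i lt_i ->]] /mem_replace[[y_in yv]|[j lt_j ->]] neq_xy.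
- have [k' [i' [j' [lts d e1 e2]]]] := IH _ _ x_in y_in neq_xy.
  by exists k', i', j'; split=> //; [rewrite -e1|rewrite -e2]; apply: reach_replace_old.
- exact: mixed.
- have [k' [i' [j' [[lt1 lt2 lt3] [h [a [b [ex ey neq_ij]]]] e1 e2]]]] := mixed y i y_in yv lt_i.
  exists k', j', i'; split=> //; exists h, b, a; split=> //; by rewrite eq_sym.
exists k, i, j; split=> //.
- exists v, [::], [::]; rewrite !cats1; split=> //.
  by apply: contraNneq neq_xy => ->.
- exact: reach_replace_copy.
exact: reach_replace_copy.
Qed.

End Reach.

(** * Labels *)

Section Labels.
Variables (Sigma Gamma : finType) (G : grammar Sigma Gamma) (cyc : seq (seq pedge)).
Hypothesis hcyc : cycle_enumeration G cyc.

Lemma placeP p M :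
  (recursive G cyc M = false /\ place G cyc p M = p) \/
  exists s t, [/\ recursive G cyc M, place G cyc p M = rcons p (inr (s, t, 0)),
    s < size cyc, t < size (nth [::] cyc s)
    & psrc G (nth (0, 0) (nth [::] cyc s) t) = M].
Proof.
rewrite /place; case: ifP => [rM|_]; last by left.
right; set s := find _ _; set t := index _ _.
have M_in : M \in map (psrc G) (nth [::] cyc s) by apply: (nth_find [::] rM).
have lt_t : t < size (nth [::] cyc s) by rewrite -(size_map (psrc G)) index_mem.
exists s, t; split=> //; first by rewrite -has_find.
by rewrite -(nth_map _ (start G)) // nth_index.
Qed.

Lemma place_cat p M : exists r, place G cyc p M = p ++ r.
Proof.
rewrite /place; case: ifP => _; last by exists [::]; rewrite cats0.
by eexists; rewrite -cats1.
Qed.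

(** Only the last entry of a position is inspected, and only it can change. *)
Lemma child_position_rcons q x e :
  let fresh := place G cyc (rcons (rcons q x) (inl e)) (ptgt G e) in
  child_position G cyc (rcons q x) e =
    if x is inr (s, t, j) then
      if continues cyc s t j e then rcons q (inr (s, t, j.+1)) else fresh
    else fresh.
Proof.
by case: q => [|y q] /=; rewrite ?last_rcons ?belast_rcons; case: x => [[]|[[]]].
Qed.

(** Once present, an [inl] entry stays in the labels of all descendants. An [inr] entry, treated
    next, keeps its cycle and its first edge, but its index grows as long as it is last and the
    recursion continues. *)
Lemma child_position_below_inl p e r f :
  exists r', child_position G cyc (p ++ inl e :: r) f = p ++ inl e :: r'.
Proof.
have fresh q : exists r', place G cyc (p ++ inl e :: q) (ptgt G f) = p ++ inl e :: r'.
  by have [r' ->] := place_cat (p ++ inl e :: q) (ptgt G f); exists (q ++ r'); rewrite -catA.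
case/lastP: r => [|r x].
  by rewrite cats1 child_position_rcons -cats1 -cats1 -catA; apply: fresh.
rewrite -rcons_cons -rcons_cat child_position_rcons -cats1 -cats1 -!catA /= -?cats1.
case: x => [?|[[s t] m]]; first exact: fresh.
case: ifP => _; last exact: fresh.
by rewrite -cats1 -catA; exists (r ++ [:: inr (s, t, m.+1)]).
Qed.

Lemma child_position_below_inr p s t m r f :
  exists m' r', m <= m' /\
    child_position G cyc (p ++ inr (s, t, m) :: r) f = p ++ inr (s, t, m') :: r'.
Proof.
have fresh q : exists m' r', m <= m' /\ place G cyc (p ++ inr (s, t, m) :: q) (ptgt G f) = p ++ inr (s, t, m') :: r'.
  have [r' ->] := place_cat (p ++ inr (s, t, m) :: q) (ptgt G f).
  by exists m, (q ++ r'); rewrite -catA.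
case/lastP: r => [|r x].
  rewrite cats1 child_position_rcons; case: ifP => _.
    by exists m.+1, [::]; rewrite cats1.
  by rewrite -cats1 -cats1 -catA; apply: fresh.
rewrite -rcons_cons -rcons_cat child_position_rcons -cats1 -cats1 -!catA /= -?cats1.
case: x => [?|[[s' t'] m']]; first exact: fresh.
case: ifP => _; last exact: fresh.
by exists m, (r ++ [:: inr (s', t', m'.+1)]); rewrite -cats1 -catA.
Qed.

Lemma psi_rcons v e : psi G cyc (rcons v e) = child_position G cyc (psi G cyc v) e.
Proof. by rewrite /psi -cats1 foldl_cat. Qed.

Lemma psi_cat_inl h e a p r :
  psi G cyc (rcons h e) = p ++ inl e :: r ->
  exists r', psi G cyc (h ++ e :: a) = p ++ inl e :: r'.
Proof.
move=> ep; elim/last_ind: a => [|a f [r' IH]]; first by rewrite cats1 ep; exists r.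
rewrite -rcons_cons -rcons_cat psi_rcons IH; exact: child_position_below_inl.
Qed.

Lemma psi_cat_inr h e a p s t m r :
  psi G cyc (rcons h e) = p ++ inr (s, t, m) :: r ->
  exists m' r', m <= m' /\ psi G cyc (h ++ e :: a) = p ++ inr (s, t, m') :: r'.
Proof.
move=> ep; elim/last_ind: a => [|a f [m' [r' [le_m IH]]]].
  by rewrite cats1 ep; exists m, r.
rewrite -rcons_cons -rcons_cat psi_rcons IH.
have [m'' [r'' [le_m' ->]]] := child_position_below_inr p s t m' r' f.
by exists m'', r''; split=> //; apply: leq_trans le_m'.
Qed.

Lemma psi_last_cycle v q s t m : psi G cyc v = rcons q (inr (s, t, m)) -> s < size cyc.
Proof.
have from_place p M : (forall q s t m, p = rcons q (inr (s, t, m)) -> s < size cyc) ->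
    forall q s t m, place G cyc p M = rcons q (inr (s, t, m)) -> s < size cyc.
  move=> IH q' s' t' m'; case: (placeP p M) => [[_ ->]|[s0 [t0 [_ -> lt_s _ _]]]]; first exact: IH.
  by move/rcons_inj=> -[_ <-].
elim/last_ind: v q s t m => [|v e IH] q s t m.
  by apply: from_place => -[].
rewrite psi_rcons; case/lastP: (psi G cyc v) IH => [|q' x] IH.
  by apply: from_place => -[|? []].
have no_inl q0 s0 t0 m0 : rcons (rcons q' x) (inl e) = rcons q0 (inr (s0, t0, m0)) -> s0 < size cyc.
  by move/rcons_inj=> -[].
rewrite child_position_rcons; case: x IH no_inl => [?|[[s' t'] m']] IH no_inl; first exact: from_place.
case: ifP => _; last exact: from_place.
by move/rcons_inj=> -[_ <- _ _]; apply: (IH _ _ _ _ erefl).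
Qed.

Lemma cyc_neq0 s : s < size cyc -> nth [::] cyc s != [::].
Proof. by case: hcyc => is_c _ _ /(mem_nth [::])/is_c/and4P[]. Qed.

Lemma continues_mem s t j e : s < size cyc -> continues cyc s t j e ->
  e \in nth [::] cyc s.
Proof.
move=> /cyc_neq0 c0 /eqP<-; apply: mem_nth.
by rewrite ltn_mod lt0n size_eq0.
Qed.

Lemma continues_inj s t j e f :
  continues cyc s t j e -> continues cyc s t j f -> e = f.
Proof. by move=> /eqP<- /eqP<-. Qed.

(** In [Split_left] the recursion is left by [P] from its child [m] through [(k, i)], while [Q] goes
    on along the cycle edge [(k, j)] and ends below a later child [m']; [Split_right] is the mirror
    image. *)
Variant split_labels (k i j : nat) (P Q : position) : Prop :=
| Split_composite p a b of P = p ++ inl (k, i) :: a & Q = p ++ inl (k, j) :: b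
| Split_left p s t m m' a b of P = p ++ inr (s, t, m) :: inl (k, i) :: a
    & Q = p ++ inr (s, t, m') :: b & m < m' & s < size cyc & (k, j) \in nth [::] cyc s
| Split_right p s t m m' a b of P = p ++ inr (s, t, m') :: a
    & Q = p ++ inr (s, t, m) :: inl (k, j) :: b & m < m' & s < size cyc & (k, i) \in nth [::] cyc s.

Lemma split_labelsP x y k i j : diverge x y k i j ->
  split_labels k i j (psi G cyc x) (psi G cyc y).
Proof.
case=> h [a [b [-> -> neq_ij]]].
pose fresh e := place G cyc (rcons (psi G cyc h) (inl e)) (ptgt G e).
have freshE e : exists r, fresh e = psi G cyc h ++ inl e :: r.
  rewrite /fresh; have [r ->] := place_cat (rcons (psi G cyc h) (inl e)) (ptgt G e).
  by exists r; rewrite cat_rcons.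
have composite : psi G cyc (rcons h (k, i)) = fresh (k, i) ->
    psi G cyc (rcons h (k, j)) = fresh (k, j) ->
    split_labels k i j (psi G cyc (h ++ (k, i) :: a)) (psi G cyc (h ++ (k, j) :: b)).
  have [r ->] := freshE (k, i); have [r' ->] := freshE (k, j).
  move=> /(psi_cat_inl a)[c ->] /(psi_cat_inl b)[d ->].
  exact: (@Split_composite _ _ _ _ _ (psi G cyc h) c d).
have fresh_inl e p f : psi G cyc h = rcons p (inl f) -> psi G cyc (rcons h e) = fresh e.
  by move=> eh; rewrite psi_rcons /fresh eh child_position_rcons.
(* The constructor depends on whether [h] is a child of a recursive node and, if so, on which of the
   two edges continues the recursion; at most one does, as [i != j]. *)
case/lastP eh: {-}(psi G cyc h) => [|p [e|[[s t] m]]].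
- by apply: composite; rewrite psi_rcons /fresh eh.
- by apply: composite; apply: fresh_inl eh.
have lt_s := psi_last_cycle eh.
case ci : (continues cyc s t m (k, i)); case cj : (continues cyc s t m (k, j)).
- by have [eij] := continues_inj ci cj; rewrite eij eqxx in neq_ij.
- have ei : psi G cyc (rcons h (k, i)) = p ++ inr (s, t, m.+1) :: [::].
    by rewrite psi_rcons eh child_position_rcons ci cats1.
  have ej : psi G cyc (rcons h (k, j)) = fresh (k, j).
    by rewrite psi_rcons eh child_position_rcons cj /fresh eh.
  have [m' [c [le_m ->]]] := psi_cat_inr a ei.
  have [r er] := freshE (k, j); rewrite er in ej; have [d ->] := psi_cat_inl b ej.
  rewrite eh cat_rcons; apply: (@Split_right _ _ _ _ _ p s t m m') => //.
  exact: continues_mem ci.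
- have ej : psi G cyc (rcons h (k, j)) = p ++ inr (s, t, m.+1) :: [::].
    by rewrite psi_rcons eh child_position_rcons cj cats1.
  have ei : psi G cyc (rcons h (k, i)) = fresh (k, i).
    by rewrite psi_rcons eh child_position_rcons ci /fresh eh.
  have [m' [c [le_m ->]]] := psi_cat_inr b ej.
  have [r er] := freshE (k, i); rewrite er in ei; have [d ->] := psi_cat_inl a ei.
  rewrite eh cat_rcons; apply: (@Split_left _ _ _ _ _ p s t m m') => //.
  exact: continues_mem cj.
by apply: composite; rewrite psi_rcons /fresh eh child_position_rcons ?ci ?cj.
Qed.

(** * Strict linear recursion bounds the depth of the tree *)

Hypothesis hslr : strictly_linear_recursive G.

(** The production graph without multiplicities, as a boolean relation on a finite type, so that
    [connect] applies. *)
Definition module_edge (M N : Sigma) : bool :=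
  [exists k : 'I_(size (prods G)), [exists i : 'I_(wf_size (rhs_of G k)),
    (psrc G (val k, val i) == M) && (ptgt G (val k, val i) == N)]].

Lemma module_edgeP M N :
  reflect (exists e, [/\ is_pedge G e, psrc G e = M & ptgt G e = N]) (module_edge M N).
Proof.
apply: (iffP existsP) => [[k /existsP[i /andP[/eqP eM /eqP eN]]]|].
  by exists (val k, val i); rewrite /is_pedge /= !ltn_ord.
move=> [[k i] [/andP[/= lt_k lt_i] eM eN]].
by exists (Ordinal lt_k); apply/existsP; exists (Ordinal lt_i); rewrite eM eN !eqxx.
Qed.

Lemma module_path_edges e p : path module_edge (ptgt G e) p ->
  exists es, [/\ all (is_pedge G) es, map (psrc G) es = belast (ptgt G e) p,
    path (fun e f => ptgt G e == psrc G f) e es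
    & ptgt G (last e es) = last (ptgt G e) p].
Proof.
elim: p e => [|N p IHp] e /=; first by move=> _; exists [::].
case/andP=> /module_edgeP[f [fe eM <-]] /IHp[es [ha hm hp hl]].
by exists (f :: es); rewrite /= fe ha hm hp hl eM eqxx.
Qed.

(** A return path is first shortened to one without repeated modules; closing it with [e] then gives
    a simple cycle. *)
Lemma pcycle_through e : is_pedge G e ->
  connect module_edge (ptgt G e) (psrc G e) -> exists2 c, is_pcycle G c & e \in c.
Proof.
move=> e_ok /connectP[p0 /shortenP[p pp up _] lp].
have [es [ha hm hp hl]] := module_path_edges pp.
exists (e :: es); last by rewrite inE eqxx.
rewrite /is_pcycle /= e_ok ha rcons_path hp /= hl -lp eqxx hm lp /=.
by move: up; rewrite lastI rcons_uniq.
Qed.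

Definition module_rank (M : Sigma) : nat := #|connect module_edge M|.

(** What the target reaches, the source reaches too; the inclusion is strict exactly when the target
    does not reach the source. *)
Lemma module_rank_edge e : is_pedge G e ->
  module_rank (ptgt G e) <= module_rank (psrc G e) ?= iff connect module_edge (ptgt G e) (psrc G e).
Proof.
move=> e_ok.
have ed : connect module_edge (psrc G e) (ptgt G e).
  by apply/connect1/module_edgeP; exists e.
have sub : connect module_edge (ptgt G e) \subset connect module_edge (psrc G e).
  by apply/subsetP=> N; apply: connect_trans ed.
split; first exact: subset_leq_card.
rewrite /module_rank; case: (boolP (connect _ _ (psrc G e))) => [back|nback].
  apply/eqP/eq_card => N; apply/idP/idP; first by move/(subsetP sub).
  exact: connect_trans back.
apply/negbTE; rewrite neq_ltn; apply/orP; left; apply: proper_card.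
apply/properP; split=> //; exists (psrc G e) => //; exact: connect0.
Qed.

Lemma pcycle_next c i : is_pcycle G c ->
  ptgt G (nth (0, 0) c (i %% size c)) = psrc G (nth (0, 0) c (i.+1 %% size c)).
Proof.
case: c => // e c /and4P[_ _ cc _]; set n := size (e :: c).
have lt_i : i %% n < n by rewrite ltn_mod.
have -> : i.+1 %% n = (i %% n).+1 %% n by rewrite -[in LHS]addn1 -modnDml addn1.
have := pathP (0, 0) cc (i %% n); rewrite size_rcons => /(_ lt_i)/eqP.
have -> : nth (0, 0) (e :: rcons c e) (i %% n) = nth (0, 0) (e :: c) (i %% n).
  by rewrite -rcons_cons nth_rcons lt_i.
move->; congr psrc; rewrite nth_rcons.
move: lt_i; rewrite /n /= ltnS leq_eqVlt => /orP[/eqP->|lt_i].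
  by rewrite ltnn eqxx modnn.
by rewrite lt_i [(_ %% _).+1 %% _]modn_small /=.
Qed.

Lemma pcycle_edge_inj c e f : is_pcycle G c -> e \in c -> f \in c ->
  psrc G e = psrc G f -> e = f.
Proof.
case/and4P=> _ _ _ uc e_in f_in eq_src.
suff ei : index e c = index f c by rewrite -(nth_index (0, 0) e_in) ei nth_index.
apply/eqP; rewrite -(nth_uniq (start G) _ _ uc) ?size_map ?index_mem //.
by rewrite !(nth_map (0, 0)) ?index_mem // !nth_index // eq_src.
Qed.

(** The invariant that makes labels and modules agree: inside a recursion the index in the label
    locates [M] on its cycle, and no recursive module occurs outside a recursion. *)
Definition tracked (p : position) (M : Sigma) : Prop :=
  (forall q s t m, p = rcons q (inr (s, t, m)) ->
     s < size cyc /\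
     psrc G (nth (0, 0) (nth [::] cyc s) ((t + m) %% size (nth [::] cyc s))) = M) /\
  (recursive G cyc M -> exists q s t m, p = rcons q (inr (s, t, m))).

Lemma place_tracked p M : (forall q s t m, p <> rcons q (inr (s, t, m))) ->
  tracked (place G cyc p M) M.
Proof.
move=> np; case: (placeP p M) => [[rM ->]|[s [t [rM -> lt_s lt_t eM]]]].
  by split=> [q s t m /np//|]; rewrite rM.
split=> [q s' t' m' /rcons_inj[_ <- <- <-]|_]; last by exists p, s, t, 0.
by rewrite addn0 modn_small.
Qed.

(** The cycle through [e] shares a module with the cycle being unfolded, so strict linear recursion
    identifies the two; on a simple cycle the source determines the edge. *)
Lemma continues_same_cycle q s t m e : is_pedge G e ->
  tracked (rcons q (inr (s, t, m))) (psrc G e) ->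
  connect module_edge (ptgt G e) (psrc G e) -> continues cyc s t m e.
Proof.
move=> e_ok [tr _] /(pcycle_through e_ok)[c c_ok e_in].
have [lt_s src_s] := tr q s t m erefl.
case: hcyc => is_c _ _; have cs_ok := is_c _ (mem_nth [::] lt_s).
have lt_m : (t + m) %% size (nth [::] cyc s) < size (nth [::] cyc s).
  by rewrite ltn_mod lt0n size_eq0 cyc_neq0.
case: (boolP (e \in nth [::] cyc s)) => [e_s|ne_s].
  by apply/eqP; apply: (pcycle_edge_inj cs_ok) => //; apply: mem_nth.
have nsame : ~ same_cycle (nth [::] cyc s) c.
  by case=> n ec; move: e_in; rewrite ec mem_rot (negPf ne_s).
have M_in : psrc G e \in map (psrc G) (nth [::] cyc s).
  by rewrite -src_s; apply/map_f/mem_nth.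
by have := hslr cs_ok c_ok nsame M_in; rewrite map_f.
Qed.

Lemma recursive_edge e : is_pedge G e ->
  connect module_edge (ptgt G e) (psrc G e) -> recursive G cyc (psrc G e).
Proof.
move=> e_ok /(pcycle_through e_ok)[c c_ok e_in].
case: hcyc => _ /(_ _ c_ok)[d d_in [n ec]] _.
by apply/hasP; exists d => //; apply: map_f; rewrite -(mem_rot n) -ec.
Qed.

(** The potential has weight 2 on the rank because a fresh child adds at most two entries, an [inl]
    and possibly an [inr], while its rank drops. A continuing recursion leaves the length of the
    label as it is. *)
Lemma child_tracked p e : is_pedge G e -> tracked p (psrc G e) ->
  tracked (child_position G cyc p e) (ptgt G e) /\
  size (child_position G cyc p e) + 2 * module_rank (ptgt G e)
    <= size p + 2 * module_rank (psrc G e).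
Proof.
move=> e_ok tr; have [le_r lt_r] := module_rank_edge e_ok.
have fresh_tr : tracked (place G cyc (rcons p (inl e)) (ptgt G e)) (ptgt G e).
  by apply: place_tracked => q s t m /rcons_inj.
have size_fresh : size (place G cyc (rcons p (inl e)) (ptgt G e)) <= size p + 2.
  by rewrite /place; case: ifP; rewrite ?size_rcons; lia.
have fresh : ~~ connect module_edge (ptgt G e) (psrc G e) ->
    size (place G cyc (rcons p (inl e)) (ptgt G e)) + 2 * module_rank (ptgt G e)
    <= size p + 2 * module_rank (psrc G e).
  by move=> nc; move: lt_r; rewrite (negPf nc); lia.
case/lastP: p tr fresh fresh_tr {size_fresh} => [|q x] tr fresh fresh_tr.
  (* An edge that leads back has a recursive source, and then [tracked] demands a last [inr]
     entry. *)
  split=> //; apply: fresh; apply/negP => /(recursive_edge e_ok)/(tr.2).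
  by case=> -[|? ?] [? [? []]].
rewrite child_position_rcons; case: x tr fresh fresh_tr => [f|[[s t] m]] tr fresh fresh_tr.
  split=> //; apply: fresh; apply/negP => /(recursive_edge e_ok)/(tr.2).
  by case=> ? [? [? [? /rcons_inj]]].
case: ifP => [ce|/negbT nce]; last first.
  by split=> //; apply: fresh; apply: contra nce; apply: continues_same_cycle tr.
split; last by rewrite !size_rcons; lia.
have [lt_s _] := tr.1 q s t m erefl.
split=> [q' s' t' m' /rcons_inj[_ <- <- <-]|_]; last by exists q, s, t, m.+1.
split=> //; case: hcyc => is_c _ _; rewrite addnS -pcycle_next; last exact/is_c/mem_nth.
by move/eqP: ce => /= ->.
Qed.

Lemma derived_tracked g : derived G g -> forall v, v \in nodes g ->
  tracked (psi G cyc v) (name g v) /\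
  size (psi G cyc v) + 2 * module_rank (name g v) <= 1 + 2 * module_rank (start G).
Proof.
elim=> [|{}g v k dg IH v_in lt_k lhs_k] x.
  rewrite inE => /eqP->; split; first by apply: place_tracked => -[].
  by rewrite /psi /= /place; case: ifP => _ /=; lia.
rewrite mem_cat mem_filter /=; case: ifP => [/mapP[i]|_]; last by rewrite orbF => /andP[_ /IH].
rewrite mem_iota add0n /= => lt_i -> _; rewrite last_rcons psi_rcons.
have e_ok : is_pedge G (k, i) by rewrite /is_pedge /= lt_k lt_i.
have [tr le] := IH _ v_in; rewrite -lhs_k -[lhs_of G k]/(psrc G (k, i)) in tr le.
by have [tr' le'] := child_tracked e_ok tr; split=> //; apply: leq_trans le' le.
Qed.

Lemma psi_size_bounded : exists D, forall g, derived G g ->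
  forall v, v \in nodes g -> size (psi G cyc v) <= D.
Proof.
by exists (1 + 2 * module_rank (start G)) => g dg v v_in; have [_] := derived_tracked dg v_in; lia.
Qed.

End Labels.

(** * Sweeps over sorted lists *)

Section Sweep.
Variables (T U : eqType) (act : pred T) (before inside : T -> pred U).

Definition drop_while (V : Type) (a : pred V) (s : seq V) := drop (find (predC a) s) s.
Definition take_while (V : Type) (a : pred V) (s : seq V) := take (find (predC a) s) s.

(** What lies before the range of [p] is dropped for good. The range itself is output but stays in
    the list, as the next active element may have the same range. *)
Fixpoint sweep (ps : seq T) (qs : seq U) : seq (T * U) :=
  if ps is p :: ps' then
    if act p then
      let qs' := drop_while (before p) qs in
      [seq (p, q) | q <- take_while (inside p) qs'] ++ sweep ps' qs'
    else sweep ps' qs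
  else [::].

Lemma filter_all_false (V : eqType) (a : pred V) s : {in s, forall x, ~~ a x} -> filter a s = [::].
Proof.
elim: s => //= x s IHs a0; rewrite (negPf (a0 x _)) ?mem_head // IHs // => y ys.
by apply: a0; rewrite inE ys orbT.
Qed.

Variables (rT : rel T) (rU : rel U).

(** The three hypotheses say that along [qs] the predicate [before p] holds on an initial segment,
    that [inside p] leaves no gap after that segment, and that the two are disjoint. *)
Lemma filter_insideE p qs : pairwise rU qs ->
  {in qs &, forall q q', rU q q' -> before p q' -> before p q} ->
  {in qs &, forall q q', rU q q' -> inside p q' -> before p q || inside p q} ->
  {in qs, forall q, before p q -> ~~ inside p q} ->
  filter (inside p) qs = take_while (inside p) (drop_while (before p) qs).
Proof.
elim: qs => //= q qs IHqs /andP[rq rqs] M2 M3 M4.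
have sub : {subset qs <= q :: qs} by move=> x xs; rewrite inE xs orbT.
rewrite /drop_while /=; case: (boolP (before p q)) => /= [bq|nb]; last first.
  rewrite /take_while /=; case: (boolP (inside p q)) => /= [iq|ni]; last first.
    apply: filter_all_false => x xs; apply/negP => ix.
    have := M3 q x (mem_head _ _) (sub _ xs) (allP rq _ xs) ix.
    by rewrite (negPf nb) (negPf ni).
  congr cons.
  have nbs x : x \in qs -> ~~ before p x.
    move=> xs; apply: contra nb; exact: M2 (mem_head _ _) (sub _ xs) (allP rq _ xs).
  rewrite IHqs //; last first.
  - by move=> x /sub; apply: M4.
  - by move=> x y /sub xs /sub; apply: M3.
  - by move=> x y /sub xs /sub; apply: M2.
  rewrite /drop_while; case: qs nbs {IHqs rq rqs M2 M3 M4 sub} => //= x qs nbs.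
  by rewrite nbs ?mem_head.
rewrite (negPf (M4 _ (mem_head _ _) bq)) IHqs //.
- by move=> x y /sub xs /sub; apply: M2.
- by move=> x y /sub xs /sub; apply: M3.
by move=> x /sub; apply: M4.
Qed.

Lemma drop_whileP (V : eqType) (a : pred V) s :
  exists pre, s = pre ++ drop_while a s /\ {in pre, forall x, a x}.
Proof.
exists (take (find (predC a) s) s); rewrite cat_take_drop; split=> //.
elim: s => //= x s IHs; case: ifPn => //= /negPn ax y.
by rewrite inE => /orP[/eqP->|/IHs].
Qed.

(* The pointer into the second list never has to move back: what lies before
   the range of one element of the first list lies before the later ranges. *)
Lemma sweepE ps qs : pairwise rT ps -> pairwise rU qs ->
  {in ps &, forall p p', rT p p' -> act p -> act p' -> {in qs, forall q, before p q -> before p' q}} ->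
  {in ps, forall p, act p -> [/\
  {in qs &, forall q q', rU q q' -> before p q' -> before p q},
  {in qs &, forall q q', rU q q' -> inside p q' -> before p q || inside p q} &
  {in qs, forall q, before p q -> ~~ inside p q}]} ->
  sweep ps qs = [seq (p, q) | p <- [seq p <- ps | act p], q <- [seq q <- qs | inside p q]].
Proof.
elim: ps qs => //= p ps IHps qs /andP[rp rps] rqs M1 M.
have sub : {subset ps <= p :: ps} by move=> x xs; rewrite inE xs orbT.
case: ifP => ap /=; last first.
  apply: IHps => // [x y /sub xs /sub|x /sub]; [exact: M1|exact: M].
have [M2 M3 M4] := M _ (mem_head _ _) ap.
rewrite filter_insideE //; congr cat.
have [pre [eqs bpre]] := drop_whileP (before p) qs.
set qs' := drop_while _ _ in eqs *.
have subq : {subset qs' <= qs} by move=> x xs; rewrite eqs mem_cat xs orbT.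
rewrite IHps //.
- congr flatten; apply/eq_in_map => x; rewrite mem_filter => /andP[ax xs].
  have [_ _ M4'] := M _ (sub _ xs) ax.
  rewrite eqs filter_cat [filter _ pre]filter_all_false //= => y ys.
  have yqs : y \in qs by rewrite eqs mem_cat ys.
  apply: M4' => //; apply: M1 (bpre _ ys); rewrite ?mem_head ?sub //.
  exact: (allP rp).
- by move: rqs; rewrite eqs pairwise_cat => /and3P[].
- move=> x y /sub xs /sub ys rxy ax ay q /subq; exact: M1.
move=> x /sub xs ax; have [M2' M3' M4'] := M _ xs ax; split.
- move=> y z /subq ys /subq; exact: M2'.
- move=> y z /subq ys /subq; exact: M3'.
move=> y /subq; exact: M4'.
Qed.

End Sweep.

(* A missing entry is represented by the tag 2; the last field is the position
   of the tree node among its siblings. *)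
Definition entry_fields (a : option entry) : seq nat :=
  match a with
  | None => [:: 2; 0; 0; 0; 0]
  | Some (inl (k, i)) => [:: 0; k; i; 0; i]
  | Some (inr (s, t, i)) => [:: 1; s; t; i; i]
  end.

Definition field (p : position) (l f : nat) : nat :=
  nth 0 (entry_fields (onth p l)) f.

(** The order of the tree is read off these numbers alone. A missing entry counts as 0, which does
    no harm: labels of distinct nodes of a run differ here at a level present in both. *)
Notation ix p l := (field p l 4).

(* An operand is the field [f] at level [l] of the first ([b = false]) or of
   the second label. *)
Definition operand : Type := (bool * nat * nat)%type.

(** Tests are syntax because they are used twice: as predicates on labels, through [holds], and as
    code, through [branch]. *)
Inductive test :=
| TTrue
| TLt (x y : operand)
| TEqc (x : operand) (n : nat)
| TLtc (x : operand) (n : nat)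
| TNot (a : test)
| TAnd (a b : test).

Definition operand_val (p q : position) (x : operand) : nat :=
  field (if x.1.1 then q else p) x.1.2 x.2.

Fixpoint holds (t : test) (p q : position) : bool :=
  match t with
  | TTrue => true
  | TLt x y => operand_val p q x < operand_val p q y
  | TEqc x n => operand_val p q x == n
  | TLtc x n => operand_val p q x < n
  | TNot a => ~~ holds a p q
  | TAnd a b => holds a p q && holds b p q
  end.

Definition TOr a b := TNot (TAnd (TNot a) (TNot b)).
Definition TAll (s : seq test) := foldr TAnd TTrue s.
Definition TAny (s : seq test) := foldr TOr (TNot TTrue) s.
Definition TEq x y := TAnd (TNot (TLt x y)) (TNot (TLt y x)).

Lemma holds_TOr a b p q : holds (TOr a b) p q = holds a p q || holds b p q.
Proof. by rewrite /= negb_and !negbK. Qed.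

Lemma holds_TEq x y p q : holds (TEq x y) p q = (operand_val p q x == operand_val p q y).
Proof. by rewrite /= -!leqNgt eqn_leq andbC. Qed.

Lemma holds_TAll s p q : holds (TAll s) p q = all (fun t => holds t p q) s.
Proof. by elim: s => //= t s ->. Qed.

Lemma holds_TAny s p q : holds (TAny s) p q = has (fun t => holds t p q) s.
Proof.
elim: s => //= t s IHs.
by rewrite -[~~ _]/(holds (TOr t (TAny s)) p q) holds_TOr IHs.
Qed.

Definition same_upto (d : nat) : test :=
  TAll [seq TEq (false, l, 4) (true, l, 4) | l <- iota 0 d].

(** It is the second label that comes first, by a sibling position at one of the first [d]
    levels. *)
Fixpoint precedes (d : nat) : test :=
  if d is d'.+1 then
    TOr (precedes d') (TAnd (same_upto d') (TLt (true, d', 4) (false, d', 4)))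
  else TNot TTrue.

Lemma same_uptoP d p q :
  reflect (forall l, l < d -> ix p l = ix q l) (holds (same_upto d) p q).
Proof.
rewrite holds_TAll all_map; apply: (iffP allP) => [s l lt_l|s l].
  have := s l; rewrite mem_iota /= add0n => /(_ lt_l).
  by rewrite -[_ && _]/(holds (TEq _ _) p q) holds_TEq => /eqP.
rewrite mem_iota /= add0n => /s e.
by rewrite -[_ && _]/(holds (TEq (false, l, 4) (true, l, 4)) p q) holds_TEq /operand_val /= e.
Qed.

Definition first_diff (p q : position) (l : nat) : Prop :=
  (forall l', l' < l -> ix p l' = ix q l') /\ ix p l < ix q l.

Lemma precedesP d p q :
  reflect (exists2 l, l < d & first_diff q p l) (holds (precedes d) p q).
Proof.
elim: d => [|d IHd]; first by apply: (iffP idP) => // -[].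
rewrite -[precedes _]/(TOr (precedes d) (TAnd _ _)) holds_TOr.
apply: (iffP orP) => [[/IHd[l lt_l f]|]|[l]].
- by exists l => //; apply: ltnW.
- by case/andP=> /same_uptoP s lt; exists d => //; split=> // l /s ->.
rewrite ltnS leq_eqVlt => /orP[/eqP->|lt_l] f; last by left; apply/IHd; exists l.
right; case: f => s lt; apply/andP; split=> //.
by apply/same_uptoP => l' /s ->.
Qed.

(** The order that tests can observe. For nodes of a derived graph it follows from [postorder_le],
    see [lab_tree_le]. *)
Definition tree_le (p q : position) : Prop := p = q \/ exists l, first_diff p q l.

(** [swapped] makes the second list the outer one. In [before_test] and [inside_test], [below] and
    [within] count only for labels that agree on the levels less than [depth]: they mark the inner
    labels to be skipped and those to be output. *)
Record pass := Pass {
  swapped : bool;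
  depth : nat;
  active : test;
  below : test;
  within : test }.

Definition before_test P := TOr (precedes (depth P)) (TAnd (same_upto (depth P)) (below P)).
Definition inside_test P := TAnd (same_upto (depth P)) (within P).

(** Conditions on the comparison at the level [depth P] that yield the hypotheses of [sweepE] for
    whole labels. *)
Definition monotone_pass (P : pass) : Prop :=
  [/\ forall p p' q, ix p (depth P) <= ix p' (depth P) -> holds (below P) p q -> holds (below P) p' q,
      forall p q q', ix q (depth P) <= ix q' (depth P) -> holds (below P) p q' -> holds (below P) p q,
      forall p q q', ix q (depth P) <= ix q' (depth P) -> holds (within P) p q' ->
        holds (below P) p q || holds (within P) p q
    & forall p q, holds (below P) p q -> ~~ holds (within P) p q].

Lemma before_testP P p q : holds (before_test P) p q <->
  (exists2 l, l < depth P & first_diff q p l) \/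
  ((forall l, l < depth P -> ix p l = ix q l) /\ holds (below P) p q).
Proof.
rewrite holds_TOr; split.
  by case/orP=> [/precedesP|/andP[/same_uptoP]]; [left|right].
by case=> [/precedesP->|[/same_uptoP s b]] //=; rewrite s b orbT.
Qed.

Lemma inside_testP P p q : holds (inside_test P) p q <->
  (forall l, l < depth P -> ix p l = ix q l) /\ holds (within P) p q.
Proof. by split=> [/andP[/same_uptoP]|[/same_uptoP s w]] //=; rewrite s. Qed.

Lemma first_diff_trans p q r l l' :
  first_diff p q l -> first_diff q r l' -> exists2 m, m <= minn l l' & first_diff p r m.
Proof.
move=> [s1 lt1] [s2 lt2]; exists (minn l l') => //; split.
  by move=> k; rewrite leq_min => /andP[/s1 -> /s2].
case: (ltngtP l l') lt1 lt2 => [lt|lt|<-] lt1 lt2; last exact: ltn_trans lt1 lt2.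
- by rewrite -s2.
- by rewrite s1.
Qed.

(** If [q] already precedes [p] at a level less than [depth P], transitivity suffices. Otherwise [p]
    and [p'] either first differ at such a level, where [q] then precedes [p'], or agree on all of
    them, and the comparison at [depth P] decides. The next two lemmas argue in the same way. *)
Lemma before_mono P p p' q : monotone_pass P -> tree_le p p' ->
  holds (before_test P) p q -> holds (before_test P) p' q.
Proof.
case=> m1 _ _ _ [<-//|[l fl]] /before_testP[[l' lt_l' fl']|[s b]]; apply/before_testP.
  have [m le_m fm] := first_diff_trans fl' fl.
  left; exists m => //; apply: leq_ltn_trans lt_l'; apply: leq_trans le_m _; exact: geq_minl.
have [sl lt_l] := fl; have [le_l|lt_ld] := leqP (depth P) l.
  right; split=> [k lt_k|]; first by rewrite -sl ?s //; apply: leq_trans le_l.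
  apply: m1 b; move: le_l; rewrite leq_eqVlt => /orP[/eqP->|/sl->] //; exact: ltnW.
left; exists l => //; split=> [k lt_k|]; last by rewrite -s.
by rewrite -s ?sl //; apply: ltn_trans lt_ld.
Qed.

Lemma before_anti P p q q' : monotone_pass P -> tree_le q q' ->
  holds (before_test P) p q' -> holds (before_test P) p q.
Proof.
case=> _ m2 _ _ [<-//|[l fl]] /before_testP[[l' lt_l' fl']|[s b]]; apply/before_testP.
  have [m le_m fm] := first_diff_trans fl fl'.
  left; exists m => //; apply: leq_ltn_trans lt_l'; apply: leq_trans le_m _; exact: geq_minr.
have [sl lt_l] := fl; have [le_l|lt_ld] := leqP (depth P) l.
  right; split=> [k lt_k|]; first by rewrite sl ?s //; apply: leq_trans le_l.
  apply: m2 b; move: le_l; rewrite leq_eqVlt => /orP[/eqP->|/sl->] //; exact: ltnW.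
left; exists l => //; split=> [k lt_k|]; last by rewrite s.
by rewrite s ?sl //; apply: ltn_trans lt_ld.
Qed.

Lemma inside_convex P p q q' : monotone_pass P -> tree_le q q' ->
  holds (inside_test P) p q' -> holds (before_test P) p q || holds (inside_test P) p q.
Proof.
case=> _ _ m3 _ [<-->|[l fl] /inside_testP[s w]]; first by rewrite orbT.
have [sl lt_l] := fl; have [le_l|lt_ld] := leqP (depth P) l.
  have s' k : k < depth P -> ix p k = ix q k.
    by move=> lt_k; rewrite sl ?s //; apply: leq_trans le_l.
  have le_d : ix q (depth P) <= ix q' (depth P).
    by move: le_l; rewrite leq_eqVlt => /orP[/eqP->|/sl->] //; exact: ltnW.
  case/orP: (m3 _ _ _ le_d w) => h; apply/orP; [left|right].
    by apply/before_testP; right.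
  by apply/inside_testP.
apply/orP; left; apply/before_testP; left; exists l => //; split; last by rewrite s.
by move=> k lt_k; rewrite s ?sl //; apply: ltn_trans lt_ld.
Qed.

Lemma before_not_inside P p q : monotone_pass P ->
  holds (before_test P) p q -> ~~ holds (inside_test P) p q.
Proof.
case=> _ _ _ m4 /before_testP[[l lt_l [_ lt]]|[s /m4 nw]]; apply/negP=> /inside_testP[s' w].
  by rewrite s' // ltnn in lt.
by rewrite w in nw.
Qed.

Definition pass_sweep P (ps qs : seq position) : seq (position * position) :=
  sweep (fun p => holds (active P) p p) (holds (before_test P)) (holds (inside_test P)) ps qs.

Definition pass_pairs P (ps qs : seq position) : seq (position * position) :=
  if swapped P then [seq (x.2, x.1) | x <- pass_sweep P qs ps] else pass_sweep P ps qs.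

Lemma pass_sweepE P (le : rel position) ps qs : monotone_pass P ->
  pairwise le ps -> pairwise le qs ->
  {in ps &, forall p p', le p p' -> tree_le p p'} ->
  {in qs &, forall q q', le q q' -> tree_le q q'} ->
  pass_sweep P ps qs = [seq (p, q) | p <- [seq p <- ps | holds (active P) p p],
                                     q <- [seq q <- qs | holds (inside_test P) p q]].
Proof.
move=> mP rps rqs Lp Lq; apply: (sweepE rps rqs) => [p p' p_in p'_in le_p _ _ q _|p _ _].
  exact/before_mono/Lp.
split=> [q q' q_in q'_in le_q|q q' q_in q'_in le_q|q _].
- exact/before_anti/Lq.
- exact/inside_convex/Lq.
exact: before_not_inside.
Qed.

(** * Passes for a grammar *)

Lemma onth_cat (T : Type) (p r : seq T) x : onth (p ++ x :: r) (size p) = Some x.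
Proof. by elim: p. Qed.

Lemma onth_cat_left (T : Type) (p r : seq T) l : l < size p -> onth (p ++ r) l = onth p l.
Proof. by elim: p l => //= x p IHp [|l] //=; apply: IHp. Qed.

Lemma onth_cat_S (T : Type) (p r : seq T) x y : onth (p ++ x :: y :: r) (size p).+1 = Some y.
Proof. by elim: p. Qed.

Lemma field_cat p a r f : field (p ++ a :: r) (size p) f = nth 0 (entry_fields (Some a)) f.
Proof. by rewrite /field onth_cat. Qed.

Lemma field_cat_S p a b r f : field (p ++ a :: b :: r) (size p).+1 f = nth 0 (entry_fields (Some b)) f.
Proof. by rewrite /field onth_cat_S. Qed.

Lemma field_cat_left p r l f : l < size p -> field (p ++ r) l f = field p l f.
Proof. by move=> lt_l; rewrite /field onth_cat_left. Qed.

Section Passes.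
Variables (Sigma Gamma : finType) (G : grammar Sigma Gamma) (cyc : seq (seq pedge)).
Hypothesis hcyc : cycle_enumeration G cyc.

Definition rhs_bound : nat := \max_(k < size (prods G)) wf_size (rhs_of G k).

Lemma rhs_boundP k i : k < size (prods G) -> i < wf_size (rhs_of G k) -> i < rhs_bound.
Proof.
move=> lt_k lt_i; apply: leq_trans lt_i _.
exact: (leq_bigmax (Ordinal lt_k)).
Qed.

Definition composite_entry (b : bool) (d k i : nat) : test :=
  TAll [:: TEqc (b, d, 0) 0; TEqc (b, d, 1) k; TEqc (b, d, 2) i].

Definition recursive_entry (b : bool) (d s : nat) : test :=
  TAll [:: TEqc (b, d, 0) 1; TEqc (b, d, 1) s].

(** The grammar being fixed, the reachability tables of its right-hand sides are expanded into a
    disjunction. The case [i = j] is left out: there the labels do not separate at this level. *)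
Definition composite_active (d j : nat) : test :=
  TAny [seq TAny [seq composite_entry false d k i
                 | i <- iota 0 (wf_size (rhs_of G k)) & (i != j) && wf_reach (rhs_of G k) i j]
       | k <- iota 0 (size (prods G))].

(* [rel W i x] is reachability in [W] from [i] to the node [x] on the cycle, or
   conversely. *)
Definition recursive_active (rel : workflow Sigma Gamma -> nat -> nat -> bool) (d : nat) : test :=
  TAny [seq TAny [seq TAny [seq TAnd (recursive_entry false d s) (composite_entry false d.+1 e.1 i)
                           | i <- iota 0 (wf_size (rhs_of G e.1)) & rel (rhs_of G e.1) i e.2]
                 | e <- nth [::] cyc s]
       | s <- iota 0 (size cyc)].

Definition later (d : nat) : test := TLt (false, d, 4) (true, d, 4).

(** Kind 0, used at depth [D] only, pairs a node with itself. Kinds 1 and 2 serve a recursion that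
    is left first by the node of the first or of the second list; kind [j.+3] serves a separation
    below a composite node with the second node in child [j]. *)
Definition pass_at (d c : nat) : pass :=
  match c with
  | 0 => Pass false d TTrue (TNot TTrue) TTrue
  | 1 => Pass false d (recursive_active (fun W i x => wf_reach W i x) d) (TNot (later d)) (later d)
  | 2 => Pass true d (recursive_active (fun W i x => wf_reach W x i) d) (TNot (later d)) (later d)
  | j.+3 => Pass false d (composite_active d j) (TLtc (true, d, 4) j) (TEqc (true, d, 4) j)
  end.

Lemma pass_at_monotone d c : monotone_pass (pass_at d c).
Proof.
case: c => [|[|[|j]]]; split=> p q r //=; rewrite /operand_val /=; try lia.
by move: r; rewrite /= /operand_val /=; lia.
Qed.

Lemma composite_activeP d j p :
  reflect (exists k i, [/\ [/\ k < size (prods G), i < wf_size (rhs_of G k), i != j & wf_reach (rhs_of G k) i j],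
     field p d 0 = 0, field p d 1 = k & field p d 2 = i])
    (holds (composite_active d j) p p).
Proof.
rewrite holds_TAny has_map; apply: (iffP hasP) => [[k]|[k [i [[lt_k lt_i neq_ij r] e0 e1 e2]]]].
  rewrite mem_iota /= add0n => lt_k; rewrite holds_TAny has_map => /hasP[i].
  rewrite mem_filter mem_iota /= add0n => /andP[/andP[neq_ij r] lt_i].
  rewrite /operand_val /= => /and4P[/eqP e0 /eqP e1 /eqP e2 _].
  by exists k, i.
exists k; rewrite ?mem_iota //= holds_TAny has_map; apply/hasP; exists i.
  by rewrite mem_filter mem_iota neq_ij r.
by rewrite /= /operand_val /= e0 e1 e2 !eqxx.
Qed.

Lemma recursive_activeP (rel : workflow Sigma Gamma -> nat -> nat -> bool) d p :
  reflect (exists s e i, [/\ [/\ s < size cyc, e \in nth [::] cyc s, i < wf_size (rhs_of G e.1) & rel (rhs_of G e.1) i e.2],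
     field p d 0 = 1 /\ field p d 1 = s, field p d.+1 0 = 0, field p d.+1 1 = e.1 & field p d.+1 2 = i])
    (holds (recursive_active rel d) p p).
Proof.
rewrite holds_TAny has_map; apply: (iffP hasP) => [[s]|[s [e [i [[lt_s e_in lt_i r] [e0 e1] e2 e3 e4]]]]].
  rewrite mem_iota /= add0n => lt_s; rewrite holds_TAny has_map => /hasP[e e_in].
  rewrite /= holds_TAny has_map => /hasP[i].
  rewrite mem_filter mem_iota /= add0n => /andP[r lt_i].
  rewrite /operand_val /= => /andP[/and3P[/eqP e0 /eqP e1 _]] /and4P[/eqP e2 /eqP e3 /eqP e4 _].
  by exists s, e, i.
exists s; rewrite ?mem_iota //= holds_TAny has_map; apply/hasP; exists e => //=.
rewrite holds_TAny has_map; apply/hasP; exists i.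
  by rewrite mem_filter mem_iota r.
by rewrite /= /operand_val /= e0 e1 e2 e3 e4 !eqxx.
Qed.

Definition emits (x : nat * nat) (p q : position) : bool :=
  let P := pass_at x.1 x.2 in
  if swapped P then holds (active P) q q && holds (inside_test P) q p
  else holds (active P) p p && holds (inside_test P) p q.

(** The length [2 + rhs_bound] accounts for kinds 1 and 2 and for one kind [j.+3] for each
    [j < rhs_bound]. *)
Definition pass_indices (D : nat) : seq (nat * nat) :=
  (D, 0) :: [seq (d, c) | d <- iota 0 D, c <- iota 1 (2 + rhs_bound)].

Lemma pass_indices_uniq D : uniq (pass_indices D).
Proof.
rewrite /pass_indices cons_uniq; apply/andP; split; last first.
  by apply: (@allpairs_uniq _ _ _ pair) => [||[? ?] [? ?] _ _ [-> ->]] //; apply: iota_uniq.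
by apply/negP=> /allpairsP[[d c] [_]]; rewrite mem_iota /= => /andP[c0 _] [_ ec]; rewrite -ec in c0.
Qed.

Lemma mem_pass_indices D d c : ((d, c) \in pass_indices D) =
  ((d == D) && (c == 0)) || ((d < D) && (0 < c < 3 + rhs_bound)).
Proof.
rewrite inE xpair_eqE; congr orb; apply/allpairsP/idP => [[[a b] [+ + [-> ->]]]|].
  by rewrite !mem_iota; cbn [fst snd]; lia.
move=> /andP[lt_d lt_c]; exists (d, c); rewrite !mem_iota; cbn [fst snd]; split=> //; lia.
Qed.

(* [l] is the level at which the two labels separate; there, they are labels
   of sibling edges. *)
Definition separate (D : nat) (p q : position) (l : nat) : Prop :=
  [/\ l < D, forall l', l' < l -> ix p l' = ix q l', ix p l != ix q l & field p l 0 = field q l 0].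

Lemma separate_first D p q l l' : separate D p q l ->
  (forall m, m < l' -> ix p m = ix q m) -> l' <= l.
Proof. by case=> _ _ /eqP ne _ same; rewrite leqNgt; apply/negP => /same. Qed.

Lemma separate_le D p q l l' : separate D p q l -> ix p l' <> ix q l' -> l <= l'.
Proof. by case=> _ same _ _ ne; rewrite leqNgt; apply/negP => /same. Qed.

(** Agreement on the levels less than the depth puts the depth at or before [l]; the tests at the
    depth force a difference there, which puts it at or after [l]. Kind 0 would need agreement on
    all [D] levels. *)
Lemma emits_cases D x p q l : separate D p q l -> x \in pass_indices D -> emits x p q ->
  x.1 = l /\
  [\/ [/\ x.2 = 1, holds (recursive_active (fun W i x => wf_reach W i x) l) p p & ix p l < ix q l],
      [/\ x.2 = 2, holds (recursive_active (fun W i x => wf_reach W x i) l) q q & ix q l < ix p l]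
    | exists j, [/\ x.2 = j.+3, holds (composite_active l j) p p & ix q l = j]].
Proof.
case: x => d c sep; rewrite mem_pass_indices => dc.
have dl : (forall m, m < d -> ix p m = ix q m) -> ix p d <> ix q d -> d = l.
  move=> same ne; have := separate_first sep same; have := separate_le sep ne; lia.
rewrite /emits; case: c dc => [|[|[|j]]] dc /andP[act /inside_testP[/= same w]]; simpl fst; simpl snd.
- have := separate_first sep same; case: sep; move: dc; lia.
- rewrite /operand_val /= in w.
  have ed : d = l by apply: dl => //; lia.
  by subst d; split=> //; apply: Or31.
- rewrite /operand_val /= in w.
  have ed : d = l by apply: dl => [m /same|] //; lia.
  by subst d; split=> //; apply: Or32.
rewrite /operand_val /= in w.
have [k [i [[_ _ neq_ij _] e0 _ e2]]] := composite_activeP _ _ _ act.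
have e4 : ix p d = i.
  move: e0 e2; rewrite /field; case: (onth p d) => [[[? ?]|[[? ?] ?]]|] //=.
have ed : d = l by apply: dl => //; move/eqP: w; rewrite e4 => ->; exact/eqP.
by subst d; split=> //; apply: Or33; exists j; split=> //; apply/eqP.
Qed.

(** At the separating level the tag tells composite from recursive, the direction of the inequality
    tells kind 1 from kind 2, and the sibling position of [q] gives [j]. *)
Lemma emits_inj D x y p q l : separate D p q l -> x \in pass_indices D -> y \in pass_indices D ->
  emits x p q -> emits y p q -> x = y.
Proof.
move=> sep x_in y_in /(emits_cases sep x_in)[ex cx] /(emits_cases sep y_in)[ey cy].
have [_ _ _ tags] := sep.
suff e2 : x.2 = y.2 by rewrite [x]surjective_pairing [y]surjective_pairing ex ey e2.
case: cx => [[-> a1 lt1]|[-> a1 lt1]|[j [-> a1 ej]]]; case: cy => [[-> a2 lt2]|[-> a2 lt2]|[j' [-> a2 ej']]] //; try (by lia).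
- have [s [e [i [_ [t0 _] _ _ _]]]] := recursive_activeP _ _ _ a1.
  have [k' [i' [_ t0' _ _]]] := composite_activeP _ _ _ a2; lia.
- have [s [e [i [_ [t0 _] _ _ _]]]] := recursive_activeP _ _ _ a1.
  have [k' [i' [_ t0' _ _]]] := composite_activeP _ _ _ a2; lia.
- have [s [e [i [_ [t0 _] _ _ _]]]] := recursive_activeP _ _ _ a2.
  have [k' [i' [_ t0' _ _]]] := composite_activeP _ _ _ a1; lia.
have [s [e [i [_ [t0 _] _ _ _]]]] := recursive_activeP _ _ _ a2.
have [k' [i' [_ t0' _ _]]] := composite_activeP _ _ _ a1; lia.
Qed.

Lemma cat_separate D p q r x y a b : p = r ++ x :: a -> q = r ++ y :: b ->
  nth 0 (entry_fields (Some x)) 4 != nth 0 (entry_fields (Some y)) 4 ->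
  nth 0 (entry_fields (Some x)) 0 = nth 0 (entry_fields (Some y)) 0 ->
  size p <= D -> separate D p q (size r).
Proof.
move=> -> -> ne0 eq0; rewrite size_cat /= => le_D; split; first by lia.
- by move=> l' lt_l; rewrite !field_cat_left.
- by rewrite !field_cat.
by rewrite !field_cat.
Qed.

Lemma split_separate D k i j p q : split_labels cyc k i j p q -> i != j -> size p <= D ->
  exists l, separate D p q l.
Proof.
case=> [r a b ep eq|r s t m m' a b ep eq lt_m _ _|r s t m m' a b ep eq lt_m _ _] ne le_D;
  exists (size r); apply: (cat_separate ep eq) => //=; lia.
Qed.

Lemma split_emits D k i j p q : split_labels cyc k i j p q ->
  i != j -> size p <= D ->
  [/\ k < size (prods G), i < wf_size (rhs_of G k) & j < wf_size (rhs_of G k)] ->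
  (exists2 x, x \in pass_indices D & emits x p q) <-> wf_reach (rhs_of G k) i j.
Proof.
move=> sp neq_ij le_D [lt_k lt_i lt_j].
(* On a simple cycle only one edge leaves the left-hand side of production [k], so the edge found by
   the test is the one that the deeper node followed. *)
have cyc_uniq s e j' : s < size cyc -> e \in nth [::] cyc s -> (k, j') \in nth [::] cyc s -> e.1 = k -> e.2 = j'.
  move=> lt_s e_in j_in ek; case: hcyc => is_c _ _.
  have /(_ e (k, j')) := pcycle_edge_inj (is_c _ (mem_nth [::] lt_s)).
  by rewrite /psrc ek /= => ->.
case: sp => [r a b ep eq|r s t m m' a b ep eq lt_m lt_s j_in|r s t m m' a b ep eq lt_m lt_s i_in].
- have sep : separate D p q (size r) by apply: (cat_separate ep eq).
  split=> [[x x_in /(emits_cases sep x_in)[_]]|wr].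
    rewrite ep eq => -[[_ /recursive_activeP[s [e [i' [_ [+ _] _ _ _]]]]]|[_ /recursive_activeP[s [e [i' [_ [+ _] _ _ _]]]]]|[j' [_ /composite_activeP[k' [i' [[_ _ _ r'] _]]]]]];
      rewrite !field_cat //=.
    by move=> -> -> ->.
  have [lt_l same _ _] := sep.
  exists (size r, j.+3); first by rewrite mem_pass_indices lt_l; have := rhs_boundP lt_k lt_j; lia.
  apply/andP; split.
    by apply/composite_activeP; exists k, i; rewrite ep !field_cat.
  by apply/inside_testP; split=> //=; rewrite /operand_val /= eq field_cat /=.
- have sep : separate D p q (size r) by apply: (cat_separate ep eq) => //=; lia.
  split=> [[x x_in /(emits_cases sep x_in)[_]]|wr].
    rewrite ep eq => -[[_ /recursive_activeP[s' [e [i' [[lt_s' e_in _ r'] [_ +] _]]]]]|[_ _]|[j' [_ /composite_activeP[k' [i' [_ + _ _]]]]]];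
      rewrite ?field_cat ?field_cat_S //=; last by lia.
    by move=> es; subst s' => ek ei; rewrite -(cyc_uniq _ _ _ lt_s e_in j_in (esym ek)) ek ei.
  have [lt_l same _ _] := sep.
  exists (size r, 1); first by rewrite mem_pass_indices lt_l; lia.
  apply/andP; split.
    by apply/recursive_activeP; exists s, (k, j), i; rewrite ep !field_cat !field_cat_S.
  by apply/inside_testP; split=> //=; rewrite /operand_val /= ep eq !field_cat /=.
have sep : separate D p q (size r) by apply: (cat_separate ep eq) => //=; lia.
split=> [[x x_in /(emits_cases sep x_in)[_]]|wr].
  rewrite ep eq => -[[_ _]|[_ /recursive_activeP[s' [e [i' [[lt_s' e_in _ r'] [_ +] _]]]]]|[j' [_ /composite_activeP[k' [i' [_ + _ _]]]]]];
    rewrite ?field_cat ?field_cat_S //=; first by lia.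
  by move=> es; subst s' => ek ei; rewrite -(cyc_uniq _ _ _ lt_s e_in i_in (esym ek)) ek ei.
have [lt_l same _ _] := sep.
exists (size r, 2); first by rewrite mem_pass_indices lt_l; lia.
apply/andP; split.
  by apply/recursive_activeP; exists s, (k, i), j; rewrite eq !field_cat !field_cat_S.
apply/inside_testP; split=> [l' lt_l'|] /=; first by rewrite same.
by rewrite /operand_val /= ep eq !field_cat /=.
Qed.

End Passes.

(** * The answer as a union of passes *)

Lemma sibling_lt_trans : transitive sibling_lt.
Proof. by case=> [[? ?]|[[? ?] ?]] [[? ?]|[[? ?] ?]] [[? ?]|[[? ?] ?]] //=; apply: ltn_trans. Qed.

Lemma sibling_lt_irr : irreflexive sibling_lt.
Proof. by case=> [[? ?]|[[? ?] ?]] /=; rewrite ltnn. Qed.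

Lemma postorder_le_trans : transitive postorder_le.
Proof.
elim=> [|b q IHq] [|a p] [|c r] //=.
case: (eqVneq a b) => [->|nab]; first by case: (eqVneq b c) => [_|_ _]; [apply: IHq|].
case: (eqVneq b c) => [<-|nbc]; first by rewrite (negPf nab).
move=> lt1 lt2; have lt := sibling_lt_trans lt1 lt2.
by case: eqP => // eac; rewrite eac sibling_lt_irr in lt.
Qed.

Lemma postorder_le_cat r p q : postorder_le (r ++ p) (r ++ q) = postorder_le p q.
Proof. by elim: r => //= x r IHr; rewrite eqxx. Qed.

Lemma tree_le_anti p q : tree_le p q -> tree_le q p -> p = q.
Proof.
case=> // -[l f] [//|[l' f']]; have [m _ [_]] := first_diff_trans f f'.
by rewrite ltnn.
Qed.

Lemma undup_map_in (T U : eqType) (f : T -> U) s :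
  {in s &, injective f} -> undup (map f s) = map f (undup s).
Proof.
elim: s => //= x s IHs inj.
have sub y : y \in s -> y \in x :: s by move=> ys; rewrite inE ys orbT.
rewrite IHs; last by move=> y z /sub ys /sub; apply: inj.
have -> : (f x \in map f s) = (x \in s).
  apply/mapP/idP => [[y ys exy]|xs]; last by exists x.
  by rewrite (inj x y _ _ exy) ?mem_head ?sub.
by case: ifP.
Qed.

Lemma uniq_flatten_map (T U : eqType) (f : T -> seq U) s : uniq s ->
  {in s, forall x, uniq (f x)} ->
  (forall x y z, x \in s -> y \in s -> z \in f x -> z \in f y -> x = y) ->
  uniq (flatten (map f s)).
Proof.
elim: s => //= x s IHs /andP[x_s us] uf disj.
have sub y : y \in s -> y \in x :: s by move=> ys; rewrite inE ys orbT.
rewrite cat_uniq uf ?mem_head //= IHs // => [|y /sub|y z t /sub ys /sub]; last exact: disj.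
- rewrite andbT; apply/hasPn => z /flatten_mapP[y ys zy]; apply/negP => zx.
  by move: x_s; rewrite (disj x y z) ?mem_head ?ys // sub.
exact: uf.
Qed.

(** * Repetitions in sorted lists *)

Section Dedup.
Variable (T : eqType).

(** [x] is the last element kept. In a sorted list equal elements are adjacent, so one comparison
    per element is enough. *)
Fixpoint dedup_after (x : T) (s : seq T) : seq T :=
  if s is y :: s' then
    if y == x then dedup_after x s' else y :: dedup_after y s'
  else [::].

Lemma dedup_after_undup (r : rel T) x s : pairwise r (x :: s) ->
  {in x :: s &, forall y z, r y z -> r z y -> y = z} ->
  x :: dedup_after x s = undup (x :: s).
Proof.
elim: s x => // y s IHs x; rewrite /= => /andP[/andP[rxy rxs] /andP[rys rs]] anti.
have sub z : z \in y :: s -> z \in [:: x, y & s] by move=> zs; rewrite inE zs orbT.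
case: (eqVneq y x) => [eyx|neq_yx].
  rewrite eyx in_cons eqxx IHs //= ?rxs //.
  by move=> z t zs ts; apply: anti; apply: sub; rewrite -eyx in zs ts *.
(* A later occurrence of [x] would lie on both sides of [y], against antisymmetry. *)
have -> : (x \in y :: s) = false.
  apply/negP; rewrite inE eq_sym (negPf neq_yx) /= => xs.
  have := anti x y (mem_head _ _) (sub _ (mem_head _ _)) rxy (allP rys _ xs).
  by move=> e; rewrite e eqxx in neq_yx.
rewrite (IHs y) //= ?rys // => z t zs ts; exact: anti (sub _ zs) (sub _ ts).
Qed.

Lemma dedup_after_sorted (r : rel T) x s : x \notin s -> pairwise r s ->
  {in s &, forall y z, r y z -> r z y -> y = z} -> dedup_after x s = undup s.
Proof.
case: s => // y s; rewrite inE negb_or eq_sym => /andP[/negPf /= -> _].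
exact: dedup_after_undup.
Qed.

End Dedup.

(** * The answer as a list of node pairs and as a list of label pairs *)

Section Answer.
Variables (Sigma Gamma : finType) (G : grammar Sigma Gamma) (cyc : seq (seq pedge)).
Hypotheses (hspec : specification G) (hcoarse : coarse_grained G).
Hypotheses (hcyc : cycle_enumeration G cyc).
Variables (g : graph Sigma Gamma) (D : nat).
Hypothesis dg : derived G g.
Hypothesis size_psi : forall v, v \in nodes g -> size (psi G cyc v) <= D.

Let lab := psi G cyc.

Lemma lab_separate u v : u \in nodes g -> v \in nodes g -> u != v ->
  (exists l, separate D (lab u) (lab v) l) /\
  ((exists2 x, x \in pass_indices G D & emits G cyc x (lab u) (lab v)) <-> reach g u v).
Proof.
move=> u_in v_in neq_uv; have [_ /(_ _ _ u_in v_in neq_uv)] := derived_nodes hspec hcoarse dg.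
case=> k [i [j [lts d e1 _]]]; have sp := split_labelsP hcyc d.
case: d => h [a [b [_ _ neq_ij]]]; split.
  by apply: (split_separate sp neq_ij); apply: size_psi.
rewrite e1; apply: (split_emits hcyc sp neq_ij) => //; exact: size_psi.
Qed.

Lemma lab_inj : {in nodes g &, injective lab}.
Proof.
move=> u v u_in v_in e; apply/eqP/negP => /negP neq_uv.
have [[l [_ _ /eqP ne _]] _] := lab_separate u_in v_in neq_uv.
by case: ne; rewrite e.
Qed.

(** Labels of distinct nodes are never prefixes of one another, so post-order is decided by two
    sibling entries. *)
Lemma lab_tree_le u v : u \in nodes g -> v \in nodes g ->
  postorder_le (lab u) (lab v) -> tree_le (lab u) (lab v).
Proof.
move=> u_in v_in; case: (eqVneq u v) => [->|neq_uv]; first by left.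
have [_ /(_ _ _ u_in v_in neq_uv)] := derived_nodes hspec hcoarse dg.
case=> k [i [j [_ d _ _]]]; have sp := split_labelsP hcyc d.
have lt r x y a b : x != y -> sibling_lt x y ->
    ix (r ++ x :: a) (size r) < ix (r ++ y :: b) (size r).
  by move=> _; rewrite !field_cat; case: x => [[? ?]|[[? ?] ?]]; case: y => [[? ?]|[[? ?] ?]].
have fd r x y a b : x != y -> postorder_le (r ++ x :: a) (r ++ y :: b) ->
    tree_le (r ++ x :: a) (r ++ y :: b).
  move=> ne; rewrite postorder_le_cat /= (negPf ne) => /(lt r x y a b ne) lt_xy.
  right; exists (size r); split=> // l lt_l; by rewrite !field_cat_left.
rewrite /lab; case: d sp => h [a0 [b0 [_ _ neq_ij]]].
case=> [r a b -> ->|r s t m m' a b -> -> lt_m _ _|r s t m m' a b -> -> lt_m _ _]; apply: fd; apply/eqP => -[].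
- exact/eqP.
- lia.
- lia.
Qed.

Lemma emits_lab_inj u v x y : u \in nodes g -> v \in nodes g ->
  x \in pass_indices G D -> y \in pass_indices G D ->
  emits G cyc x (lab u) (lab v) -> emits G cyc y (lab u) (lab v) -> x = y.
Proof.
move=> u_in v_in x_in y_in ex ey; case: (eqVneq u v) => [euv|neq_uv]; last first.
  by have [[l sep] _] := lab_separate u_in v_in neq_uv; apply: emits_inj sep x_in y_in ex ey.
(* A node meets itself in kind 0 only: [later] is irreflexive, and kind [j.+3] asks for a child
   other than [j] and equal to [j]. *)
suff h : forall z, z \in pass_indices G D -> emits G cyc z (lab u) (lab v) -> z = (D, 0).
  by rewrite (h x) // (h y).
case=> d c; rewrite mem_pass_indices -euv => dc.
case: c dc => [|[|[|j]]] dc /andP[act /inside_testP[_]]; rewrite /= /operand_val /= ?ltnn //.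
  by move=> _; have -> : d = D by move: dc; clear; lia.
move/eqP; have [k [i [[_ _ neq_ij _] e0 _ e2]]] := composite_activeP _ _ _ _ act.
move: e0 e2 neq_ij; rewrite /field; case: (onth _ d) => [[[? ?]|[[? ?] ?]]|] //= _ -> /eqP ne.
by move=> e; case: ne.
Qed.

Lemma emits_same p : emits G cyc (D, 0) p p.
Proof. by apply/andP; split=> //; apply/inside_testP. Qed.

Lemma reach_emits u v : u \in nodes g -> v \in nodes g ->
  (exists2 x, x \in pass_indices G D & emits G cyc x (lab u) (lab v)) <-> reach g u v.
Proof.
move=> u_in v_in; case: (eqVneq u v) => [<-|neq_uv]; last by case: (lab_separate u_in v_in neq_uv).
split=> _; first exact: reach_refl.
exists (D, 0); last exact: emits_same.
by rewrite mem_pass_indices !eqxx.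
Qed.

Section Lists.
Variables l1 l2 : seq node.
Hypotheses (hl1 : query_list G cyc g l1) (hl2 : query_list G cyc g l2).

Lemma query_pairwise l : query_list G cyc g l -> pairwise postorder_le (map lab l).
Proof.
case=> _ so; rewrite -sorted_pairwise ?sorted_map //; exact: postorder_le_trans.
Qed.

Lemma query_anti l : query_list G cyc g l ->
  {in map lab l &, forall p q, postorder_le p q -> postorder_le q p -> p = q}.
Proof.
case=> sub _ p q /mapP[u /sub u_in ->] /mapP[v /sub v_in ->] le1 le2.
by apply: tree_le_anti; apply: lab_tree_le.
Qed.

Lemma query_undup l : query_list G cyc g l -> undup (map lab l) = map lab (undup l).
Proof.
by case=> sub _; apply: undup_map_in => u v /sub u_in /sub v_in; apply: lab_inj.
Qed.

(** The loops are nested as in the sweep, since the output is compared with the answer as a sequence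
    and not only as a set. *)
Definition pass_nodes (x : nat * nat) : seq (node * node) :=
  let P := pass_at G cyc x.1 x.2 in
  if swapped P then
    [seq (u, v) | v <- [seq v <- undup l2 | holds (active P) (lab v) (lab v)],
                  u <- [seq u <- undup l1 | holds (inside_test P) (lab v) (lab u)]]
  else
    [seq (u, v) | u <- [seq u <- undup l1 | holds (active P) (lab u) (lab u)],
                  v <- [seq v <- undup l2 | holds (inside_test P) (lab u) (lab v)]].

Lemma mem_pass_nodes x u v :
  ((u, v) \in pass_nodes x) = [&& u \in l1, v \in l2 & emits G cyc x (lab u) (lab v)].
Proof.
rewrite /pass_nodes /emits; case: ifP => _.
  apply/allpairsPdep/and3P => [[v' [u' []]]|[u_in v_in /andP[a i]]].
    by rewrite !mem_filter !mem_undup => /andP[a v_in] /andP[i u_in] [-> ->]; rewrite u_in v_in a i.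
  by exists v, u; rewrite !mem_filter !mem_undup u_in v_in a i.
apply/allpairsPdep/and3P => [[u' [v' []]]|[u_in v_in /andP[a i]]].
  by rewrite !mem_filter !mem_undup => /andP[a u_in] /andP[i v_in] [-> ->]; rewrite u_in v_in a i.
by exists u, v; rewrite !mem_filter !mem_undup u_in v_in a i.
Qed.

Lemma pass_nodes_uniq x : uniq (pass_nodes x).
Proof.
rewrite /pass_nodes; case: ifP => _.
all: apply: allpairs_uniq_dep; rewrite ?filter_uniq ?undup_uniq //.
- by move=> v _; rewrite filter_uniq ?undup_uniq.
- by move=> [a b] [c d] _ _ /= [-> ->].
- by move=> v _; rewrite filter_uniq ?undup_uniq.
by move=> [a b] [c d] _ _ /= [-> ->].
Qed.

Definition answer : seq (node * node) := flatten [seq pass_nodes x | x <- pass_indices G D].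

Lemma answerP : is_answer g l1 l2 answer.
Proof.
case: (hl1) => sub1 _; case: (hl2) => sub2 _; split.
  apply: uniq_flatten_map => [|x _|x y [u v] x_in y_in]; first exact: pass_indices_uniq.
    exact: pass_nodes_uniq.
  rewrite !mem_pass_nodes => /and3P[u_in v_in em1] /and3P[_ _ em2].
  exact: emits_lab_inj (sub1 _ u_in) (sub2 _ v_in) x_in y_in em1 em2.
move=> u v; split.
  case/flatten_mapP=> x x_in; rewrite mem_pass_nodes => /and3P[u_in v_in em].
  by split=> //; apply/(reach_emits (sub1 _ u_in) (sub2 _ v_in)); exists x.
move=> [u_in v_in /(reach_emits (sub1 _ u_in) (sub2 _ v_in))[x x_in em]].
by apply/flatten_mapP; exists x => //; rewrite mem_pass_nodes u_in v_in.
Qed.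

Lemma answer_labels : [seq (lab uv.1, lab uv.2) | uv <- answer] =
  flatten [seq pass_pairs (pass_at G cyc x.1 x.2) (undup (map lab l1)) (undup (map lab l2))
          | x <- pass_indices G D].
Proof.
rewrite /answer map_flatten -map_comp; congr flatten; apply: eq_map => x /=.
have le_lab l : query_list G cyc g l ->
    {in undup (map lab l) &, forall p q, postorder_le p q -> tree_le p q}.
  case=> sub _ p q; rewrite !mem_undup => /mapP[u /sub u_in ->] /mapP[v /sub v_in ->].
  exact: lab_tree_le.
have pw l : query_list G cyc g l -> pairwise postorder_le (undup (map lab l)).
  by move=> hl; apply: subseq_pairwise (undup_subseq _) (query_pairwise hl).
rewrite /pass_pairs /pass_nodes; have mP := pass_at_monotone G cyc x.1 x.2; case: ifP => _.
  rewrite (pass_sweepE mP (pw _ hl2) (pw _ hl1) (le_lab _ hl2) (le_lab _ hl1)).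
  rewrite !query_undup // !filter_map !map_allpairs allpairs_mapl.
  congr flatten; apply: eq_map => v /=; by rewrite filter_map -map_comp.
rewrite (pass_sweepE mP (pw _ hl1) (pw _ hl2) (le_lab _ hl1) (le_lab _ hl2)).
rewrite !query_undup // !filter_map !map_allpairs allpairs_mapl.
congr flatten; apply: eq_map => v /=; by rewrite filter_map -map_comp.
Qed.

End Lists.
End Answer.

(** * A time-bounded program logic *)

Section Logic.
Variable B : nat.

(** Total correctness with a time bound. The existence of an execution includes that nothing
    overflows. *)
Definition ct (c : cmd) (st : state) (T : nat) (Q : state -> Prop) : Prop :=
  exists t st', [/\ exec B c st t st', t <= T & Q st'].

Lemma ct_conseq (T : nat) (Q : state -> Prop) c st T' (Q' : state -> Prop) :
  ct c st T Q -> T <= T' -> (forall st', Q st' -> Q' st') -> ct c st T' Q'.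
Proof. by move=> [t [st' [e le q]]] le' h; exists t, st'; split=> //; [lia|apply: h]. Qed.

Lemma ct_le T c st T' Q : ct c st T Q -> T <= T' -> ct c st T' Q.
Proof. by move=> h le; apply: ct_conseq h le _. Qed.

Lemma ct_seq c1 c2 st T1 T2 Q :
  ct c1 st T1 (fun st1 => ct c2 st1 T2 Q) -> ct (Seq c1 c2) st (T1 + T2) Q.
Proof.
case=> t1 [st1 [e1 le1 [t2 [st2 [e2 le2 q]]]]].
by exists (t1 + t2), st2; split=> //; [apply: Exec_seq e1 e2|lia].
Qed.

Lemma ct_then c1 c2 st T1 T2 (R Q : state -> Prop) :
  ct c1 st T1 R -> (forall st1, R st1 -> ct c2 st1 T2 Q) -> ct (Seq c1 c2) st (T1 + T2) Q.
Proof. by move=> h1 h2; apply: ct_seq; apply: ct_conseq h1 _ h2. Qed.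

Lemma ct_skip st (Q : state -> Prop) : Q st -> ct Skip st 1 Q.
Proof. by exists 1, st; split=> //; constructor. Qed.

Lemma ct_const st x n (Q : state -> Prop) : n < B -> Q (set_reg st x n) -> ct (Const x n) st 1 Q.
Proof. by move=> lt q; exists 1, (set_reg st x n); split=> //; constructor. Qed.

Lemma ct_add st x y z (Q : state -> Prop) : regs st y + regs st z < B ->
  Q (set_reg st x (regs st y + regs st z)) -> ct (Add x y z) st 1 Q.
Proof. by move=> lt q; eexists 1, _; split; [constructor|by []|]. Qed.

Lemma ct_sub st x y z (Q : state -> Prop) :
  Q (set_reg st x (regs st y - regs st z)) -> ct (Defs.Sub x y z) st 1 Q.
Proof. by move=> q; eexists 1, _; split; [constructor|by []|]. Qed.

Lemma ct_fetch st x y (Q : state -> Prop) :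
  Q (set_reg st x (Defs.mem st (regs st y))) -> ct (Fetch x y) st 1 Q.
Proof. by move=> q; eexists 1, _; split; [constructor|by []|]. Qed.

Lemma ct_store st x y (Q : state -> Prop) :
  Q (State (regs st) (upd (Defs.mem st) (regs st x) (regs st y)) (output st)) -> ct (Store x y) st 1 Q.
Proof. by move=> q; eexists 1, _; split; [constructor|by []|]. Qed.

Lemma ct_write st x (Q : state -> Prop) :
  Q (State (regs st) (Defs.mem st) (rcons (output st) (regs st x))) -> ct (Write x) st 1 Q.
Proof. by move=> q; eexists 1, _; split; [constructor|by []|]. Qed.

Lemma ct_if st x c1 c2 T1 T2 Q :
  (regs st x != 0 -> ct c1 st T1 Q) -> (regs st x = 0 -> ct c2 st T2 Q) ->
  ct (If x c1 c2) st (maxn T1 T2).+1 Q.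
Proof.
move=> h1 h2; case: (eqVneq (regs st x) 0) => [e|ne].
  case: (h2 e) => t [st' [ex le q]]; exists t.+1, st'; split=> //; last by lia.
  by constructor; rewrite e eqxx.
case: (h1 ne) => t [st' [ex le q]]; exists t.+1, st'; split=> //; last by lia.
by constructor; rewrite ne.
Qed.

Lemma ct_while_end st x c (Q : state -> Prop) : regs st x = 0 -> Q st -> ct (While x c) st 1 Q.
Proof. by move=> e q; exists 1, st; split=> //; constructor. Qed.

Lemma ct_while_loop st x c T1 T2 Q : regs st x != 0 ->
  ct c st T1 (fun st1 => ct (While x c) st1 T2 Q) -> ct (While x c) st (T1 + T2).+1 Q.
Proof.
move=> ne [t1 [st1 [e1 le1 [t2 [st2 [e2 le2 q]]]]]].
by exists (t1 + t2).+1, st2; split=> //; [apply: Exec_while_loop ne e1 e2|lia].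
Qed.

End Logic.

(** A frame condition: [R] contains the registers that may change. *)
Definition keep (R : pred nat) (st st' : state) : Prop :=
  [/\ forall r, ~~ R r -> regs st' r = regs st r, Defs.mem st' = Defs.mem st & output st' = output st].

Lemma keep_refl R st : keep R st st.
Proof. by []. Qed.

Lemma keep_trans (R : pred nat) st1 st2 st3 : keep R st1 st2 -> keep R st2 st3 -> keep R st1 st3.
Proof.
by move=> [r1 m1 o1] [r2 m2 o2]; split=> [r nr||]; rewrite ?r2 ?r1 ?m2 ?o2.
Qed.

Lemma keep_sub (R R' : pred nat) st1 st2 : subpred R R' -> keep R st1 st2 -> keep R' st1 st2.
Proof. by move=> sub [r m o]; split=> // x nx; apply: r; apply: contra nx; apply: sub. Qed.

Lemma keep_set (R : pred nat) st st' x v : R x -> keep R st st' -> keep R st (set_reg st' x v).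
Proof.
move=> Rx [r m o]; split=> // y ny; rewrite /= /upd ifN ?r //.
by apply: contraNneq ny => ->.
Qed.

Lemma regs_set st x v r : regs (set_reg st x v) r = if r == x then v else regs st r.
Proof. by []. Qed.

(* Registers 0-3 are scratch and 4-15 control the loops.  The labels of a pair
   are held in the even ([b = false]) and in the odd registers from 16 on. *)
Definition size_reg (b : bool) : nat := 16 + b.
Definition field_reg (b : bool) (l f : nat) : nat := 18 + b + (5 * l + f).*2.
Definition scratch (r : nat) : bool := r < 4.
Definition block (b : bool) (r : nat) : bool := (r < 4) || ((16 <= r) && (odd r == b)).

Lemma field_reg_neq b l f b' l' f' : f < 5 -> f' < 5 ->
  (field_reg b l f == field_reg b' l' f') = [&& b == b', l == l' & f == f'].
Proof. by rewrite /field_reg; case: b; case: b'; lia. Qed.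

Lemma field_reg_block b l f : block b (field_reg b l f).
Proof. by rewrite /block /field_reg !oddD odd_double; case: b => /=; lia. Qed.

(** * Labels in registers and tests as code *)

Section Label.
Variables (B H : nat).
(** All [H] levels are present, those beyond the label with the fields of [None], so that tests need
    not know its length. *)
Definition loaded (b : bool) (p : position) (st : state) : Prop :=
  regs st (size_reg b) = size p /\
  forall l f, l < H -> f < 5 -> regs st (field_reg b l f) = field p l f.

Lemma loaded_keep (R : pred nat) b p st st' : (forall r, R r -> ~~ block b r || (r < 4)) ->
  keep R st st' -> loaded b p st -> loaded b p st'.
Proof.
move=> sub [r _ _] [s f]; split=> [|l k lt_l lt_k].
  rewrite r //; apply/negP => /sub; rewrite /block /size_reg; by case: b {sub s f}.
rewrite r ?f //; apply/negP => /sub; rewrite field_reg_block /field_reg; lia.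
Qed.

Definition operand_reg (x : operand) : nat := field_reg x.1.1 x.1.2 x.2.
Definition operand_ok (x : operand) : bool := (x.1.2 < H) && (x.2 < 5).

Fixpoint test_ok (t : test) : bool :=
  match t with
  | TTrue => true
  | TLt x y => operand_ok x && operand_ok y
  | TEqc x n | TLtc x n => operand_ok x && (n < B)
  | TNot a => test_ok a
  | TAnd a b => test_ok a && test_ok b
  end.

(** Both continuations are passed down and no truth value is computed. [TAnd] copies [c2], which
    lengthens the program but adds nothing to its time. Subtraction being truncated, an equality
    takes two of them. *)
Fixpoint branch (t : test) (c1 c2 : cmd) : cmd :=
  match t with
  | TTrue => c1
  | TLt x y => Seq (Defs.Sub 0 (operand_reg y) (operand_reg x)) (If 0 c1 c2)
  | TEqc x n => Seq (Const 1 n) (Seq (Defs.Sub 0 (operand_reg x) 1)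
      (If 0 c2 (Seq (Defs.Sub 0 1 (operand_reg x)) (If 0 c2 c1))))
  | TLtc x n => Seq (Const 1 n) (Seq (Defs.Sub 0 1 (operand_reg x)) (If 0 c1 c2))
  | TNot a => branch a c2 c1
  | TAnd a b => branch a (branch b c1 c2) c2
  end.

Fixpoint branch_cost (t : test) : nat :=
  match t with
  | TTrue => 0
  | TLt _ _ => 2
  | TEqc _ _ => 5
  | TLtc _ _ => 3
  | TNot a => branch_cost a
  | TAnd a b => branch_cost a + branch_cost b
  end.

Lemma operand_regE p q st x : loaded false p st -> loaded true q st -> operand_ok x ->
  regs st (operand_reg x) = operand_val p q x.
Proof. by move=> [_ lp] [_ lq] /andP[lt_l lt_f]; case: x lt_l lt_f => [[[] l] f] /= *; rewrite ?lp ?lq. Qed.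

Lemma operand_reg_ge x : 18 <= operand_reg x.
Proof. by rewrite /operand_reg /field_reg; lia. Qed.

Lemma loaded_scratch b p st st' : keep scratch st st' -> loaded b p st -> loaded b p st'.
Proof. by apply: loaded_keep => r; rewrite /scratch => ->; rewrite orbT. Qed.

Lemma ct_branch t p q c1 c2 st T Q : loaded false p st -> loaded true q st -> test_ok t ->
  (forall st', keep scratch st st' -> ct B (if holds t p q then c1 else c2) st' T Q) ->
  ct B (branch t c1 c2) st (T + branch_cost t) Q.
Proof.
elim: t c1 c2 T st => [|x y|x n|x n|a IHa|a IHa b IHb] c1 c2 T st lp lq /=.
- by move=> _ h; rewrite addn0; apply: h.
- case/andP=> okx oky h.
  have h' := h _ (keep_set (x := 0) (operand_val p q y - operand_val p q x) isT (keep_refl scratch st)).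
  eapply ct_le.
    apply: ct_seq; apply: ct_sub; rewrite !(operand_regE lp lq) //.
    apply: (@ct_if _ _ _ _ _ T T); rewrite regs_set /= => e.
      by move: h'; rewrite ifT //; lia.
    by move: h'; rewrite ifF //; lia.
  by lia.
- case/andP=> okx lt_n h.
  have rx v : regs (set_reg st 1 v) (operand_reg x) = operand_val p q x.
    by rewrite -(operand_regE lp lq okx) /= /upd gtn_eqF // (leq_trans _ (operand_reg_ge x)).
  have rx' v w : regs (set_reg (set_reg st 1 v) 0 w) (operand_reg x) = operand_val p q x.
    by rewrite -(rx v) /= /upd !gtn_eqF // (leq_trans _ (operand_reg_ge x)).
  eapply ct_le.
    apply: ct_seq; apply: ct_const => //; apply: ct_seq; apply: ct_sub; rewrite rx regs_set /=.
    apply: (@ct_if _ _ _ _ _ T T.+2); rewrite regs_set /= => e.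
      apply: ct_le (leqnn T); move: (h _ (keep_set (x := 0) (operand_val p q x - n) isT (keep_set (x := 1) n isT (keep_refl scratch st)))).
      by rewrite ifF //; lia.
    apply: (@ct_le _ (1 + (maxn T T).+1)); last by lia.
    apply: ct_seq; apply: ct_sub; rewrite rx' !regs_set /=.
    apply: ct_if; rewrite regs_set /= => e'.
      move: (h _ (keep_set (x := 0) (n - operand_val p q x) isT (keep_set (x := 0) (operand_val p q x - n) isT (keep_set (x := 1) n isT (keep_refl scratch st))))).
      by rewrite ifF //; lia.
    move: (h _ (keep_set (x := 0) (n - operand_val p q x) isT (keep_set (x := 0) (operand_val p q x - n) isT (keep_set (x := 1) n isT (keep_refl scratch st))))).
    by rewrite ifT //; lia.
  by lia.
- case/andP=> okx lt_n h.
  have rx v : regs (set_reg st 1 v) (operand_reg x) = operand_val p q x.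
    by rewrite -(operand_regE lp lq okx) /= /upd gtn_eqF // (leq_trans _ (operand_reg_ge x)).
  have h' := h _ (keep_set (x := 0) (n - operand_val p q x) isT (keep_set (x := 1) n isT (keep_refl scratch st))).
  eapply ct_le.
    apply: ct_seq; apply: ct_const => //; apply: ct_seq; apply: ct_sub; rewrite rx regs_set /=.
    apply: (@ct_if _ _ _ _ _ T T); rewrite regs_set /= => e.
      by move: h'; rewrite ifT //; lia.
    by move: h'; rewrite ifF //; lia.
  by lia.
- move=> oka h; apply: IHa => // st' k; have := h _ k; by case: (holds a p q).
case/andP=> oka okb h; rewrite [branch_cost a + _]addnC addnA.
apply: IHa => // st' k; case ha: (holds a p q).
  apply: IHb => //; [exact: loaded_scratch lp|exact: loaded_scratch lq|].
  by move=> st'' k'; have := h _ (keep_trans k k'); rewrite ha.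
by have := h _ k; rewrite ha /= => h'; apply: ct_le h' _; lia.
Qed.

(* Register 3 holds the constant 1. *)
Definition fetch_field (b : bool) (l f : nat) : cmd :=
  Seq (Fetch (field_reg b l f) 2) (Add 2 2 3).

(** Field 4 repeats the sibling position, which is the third number of a recursive entry and the
    second of a composite one; hence the branch on the tag. *)
Definition load_entry (b : bool) (l : nat) : cmd :=
  Seq (Const 0 l) (Seq (Defs.Sub 0 (size_reg b) 0)
    (If 0
      (Seq (fetch_field b l 0) (Seq (fetch_field b l 1) (Seq (fetch_field b l 2) (Seq (fetch_field b l 3)
        (Seq (Const 0 0) (If (field_reg b l 0) (Add (field_reg b l 4) (field_reg b l 3) 0)
                                               (Add (field_reg b l 4) (field_reg b l 2) 0)))))))
      (Seq (Const (field_reg b l 0) 2) (Seq (Const (field_reg b l 1) 0) (Seq (Const (field_reg b l 2) 0)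
        (Seq (Const (field_reg b l 3) 0) (Const (field_reg b l 4) 0))))))).

Fixpoint load_levels (b : bool) (h : nat) : cmd :=
  if h is h'.+1 then Seq (load_levels b h') (load_entry b h') else Skip.

Definition load_label (b : bool) : cmd :=
  Seq (Fetch (size_reg b) 2) (Seq (Const 3 1) (Seq (Add 2 2 3) (load_levels b H))).

(** The strict bound covers the address just behind the label, where loading and scanning leave the
    pointer. *)
Definition label_at (m : nat -> nat) (a : nat) (p : position) : Prop :=
  [/\ forall f, f < size (encode_label p) -> m (a + f) = nth 0 (encode_label p) f,
      a + size (encode_label p) < B & all (fun x => x < B) (encode_label p)].

Lemma size_encode_entry e : size (encode_entry e) = 4.
Proof. by case: e => [[]|[[]]]. Qed.

Lemma size_encode_label p : size (encode_label p) = (4 * size p).+1.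
Proof.
rewrite /= size_flatten /shape -map_comp; congr S.
by elim: p => //= e p ->; rewrite size_encode_entry mulnS.
Qed.

Lemma nth_encode_label p l f : l < size p -> f < 4 ->
  nth 0 (encode_label p) (1 + (4 * l + f)) = field p l f.
Proof.
rewrite add1n /=; elim: p l => //= e p IHp [|l] lt_l lt_f; rewrite nth_cat size_encode_entry.
  rewrite muln0 add0n lt_f /field /=; case: e => [[? ?]|[[? ?] ?]]; by case: f lt_f {IHp} => [|[|[|[|f]]]].
rewrite ifF; last by lia.
by rewrite -[RHS]IHp //; congr nth; lia.
Qed.

Lemma label_at_field m a p l f : label_at m a p -> l < size p -> f < 4 ->
  m (a + (1 + (4 * l + f))) = field p l f.
Proof.
case=> h _ _ lt_l lt_f; rewrite h ?nth_encode_label // size_encode_label; lia.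
Qed.

Hypothesis lt_B : maxn H 8 < B.

Lemma field_lt m a p l f : label_at m a p -> field p l f < B.
Proof.
case=> _ _ /allP all_lt.
case: (ltnP l (size p)) => [lt_l|ge_l]; last first.
  rewrite /field onth_default // /=; case: f => [|[|[|[|[|f]]]]] /=; rewrite ?nth_nil; lia.
have lt4 g : g < 4 -> field p l g < B.
  move=> lt_g; rewrite -nth_encode_label //; apply/all_lt/mem_nth.
  by rewrite size_encode_label; lia.
case: (ltnP f 4) => [/lt4//|]; case: (ltnP f 5) => [lt5 ge4|ge5 _]; last first.
  by rewrite /field nth_default; [lia|case: (onth p l) => [[[? ?]|[[? ?] ?]]|] //=].
have -> : f = 4 by lia.
move: (lt4 2 isT) (lt4 3 isT); rewrite /field.
by case: (onth p l) => [[[? ?]|[[? ?] ?]]|] //=.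
Qed.

End Label.

(** * Transfer of labels *)

Lemma onth_lt (T : Type) (x0 : T) s i : i < size s -> onth s i = Some (nth x0 s i).
Proof. by elim: s i => //= x s IHs [|i] //=; apply: IHs. Qed.

Section Label.
Variables (B H : nat).
Lemma field_reg_ctl b l f r : r < 18 -> (field_reg b l f == r) = false.
Proof. by rewrite /field_reg; lia. Qed.

Lemma ctl_field_reg b l f r : r < 18 -> (r == field_reg b l f) = false.
Proof. by rewrite /field_reg; lia. Qed.

Lemma size_reg_lt b : size_reg b < 18.
Proof. by case: b. Qed.

Lemma field_regE b l f :
  ((field_reg b l f == 0) = false) * ((field_reg b l f == 1) = false) *
  ((field_reg b l f == 2) = false) * ((field_reg b l f == 3) = false) *
  ((0 == field_reg b l f) = false) * ((1 == field_reg b l f) = false) *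
  ((2 == field_reg b l f) = false) * ((3 == field_reg b l f) = false).
Proof. by rewrite !field_reg_ctl // !ctl_field_reg. Qed.

Lemma field_reg_same b l f f' : f < 5 -> f' < 5 ->
  (field_reg b l f == field_reg b l f') = (f == f').
Proof. by move=> lt_f lt_f'; rewrite field_reg_neq // !eqxx. Qed.

Lemma size_reg_eq b r : r < 4 -> (size_reg b == r) = false.
Proof. by rewrite /size_reg; lia. Qed.

Definition entry_block (b : bool) (l r : nat) : bool :=
  [|| r == 0, r == 2 | has (fun f => r == field_reg b l f) (iota 0 5)].

Lemma field_reg_entry b l f : f < 5 -> entry_block b l (field_reg b l f).
Proof.
by move=> lt_f; apply/or3P/Or33/hasP; exists f; rewrite ?mem_iota.
Qed.

Lemma entry_block_field b l l' f : l' != l -> f < 5 -> ~~ entry_block b l (field_reg b l' f).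
Proof.
move=> ne lt_f; rewrite /entry_block ?field_reg_ctl //=.
by rewrite ?field_reg_neq // (negPf ne) eqxx.
Qed.

Lemma entry_block_block b l r : entry_block b l r -> block b r.
Proof.
case/or3P=> [/eqP->|/eqP->|/hasP[f _ /eqP->]] //; exact: field_reg_block.
Qed.

Lemma ct_fetch_field b l f a st (Q : state -> Prop) : regs st 2 = a -> regs st 3 = 1 -> a + 1 < B ->
  Q (set_reg (set_reg st (field_reg b l f) (Defs.mem st a)) 2 (a + 1)) ->
  ct B (fetch_field b l f) st 2 Q.
Proof.
move=> r2 r3 lt_a q; eapply ct_le; [apply: ct_seq; apply: ct_fetch; rewrite r2; apply: ct_add|by []].
  by rewrite !regs_set ?field_regE // r2 r3.
by rewrite !regs_set ?field_regE // r2 r3.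
Qed.

Lemma ct_fetch_entry b l p a st :
  regs st 3 = 1 -> l < size p -> label_at B (Defs.mem st) a p -> regs st 2 = a + (1 + 4 * l) ->
  forall c T Q,
  (forall st', keep (entry_block b l) st st' -> regs st' 2 = a + (1 + 4 * l.+1) ->
     (forall f, f < 4 -> regs st' (field_reg b l f) = field p l f) -> ct B c st' T Q) ->
  ct B (Seq (fetch_field b l 0) (Seq (fetch_field b l 1) (Seq (fetch_field b l 2) (Seq (fetch_field b l 3) c))))
    st (8 + T) Q.
Proof.
move=> r3 lt_lp hp r2 c T Q hc.
have ltB : a + (4 * size p).+1 < B by case: hp => _; rewrite size_encode_label.
have m k : k < 4 -> Defs.mem st (a + (1 + 4 * l) + k) = field p l k.
  by move=> lt_k; rewrite -(label_at_field hp) //; congr Defs.mem; lia.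
apply: (@ct_le _ (2 + (2 + (2 + (2 + T))))); last by lia.
apply: ct_seq; apply: (@ct_fetch_field _ _ _ (a + (1 + 4 * l) + 0)).
- by rewrite r2 addn0.
- by [].
- by lia.
apply: ct_seq; apply: (@ct_fetch_field _ _ _ (a + (1 + 4 * l) + 1)).
- by rewrite regs_set -addnA.
- by rewrite !regs_set field_regE.
- by lia.
apply: ct_seq; apply: (@ct_fetch_field _ _ _ (a + (1 + 4 * l) + 2)).
- by rewrite regs_set -addnA.
- by rewrite !regs_set !field_regE.
- by lia.
apply: ct_seq; apply: (@ct_fetch_field _ _ _ (a + (1 + 4 * l) + 3)).
- by rewrite regs_set -addnA.
- by rewrite !regs_set !field_regE.
- by lia.
apply: hc.
- by do 4 (apply: keep_set => //; apply: keep_set; first exact: field_reg_entry).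
- by rewrite regs_set /=; lia.
by case=> [|[|[|[|f]]]] // _; rewrite !regs_set !field_regE ?field_reg_same //= m.
Qed.

Hypothesis lt_B : maxn H 8 < B.

(** The minimum expresses that the pointer in register 2 stays at the end of the label once all
    entries have been read. *)
Lemma ct_load_entry b l p a st :
  regs st (size_reg b) = size p -> regs st 3 = 1 -> l < H -> size p <= H ->
  label_at B (Defs.mem st) a p -> regs st 2 = a + (1 + 4 * minn l (size p)) ->
  ct B (load_entry b l) st 20 (fun st' =>
    [/\ keep (entry_block b l) st st', regs st' 2 = a + (1 + 4 * minn l.+1 (size p))
      & forall f, f < 5 -> regs st' (field_reg b l f) = field p l f]).
Proof.
move=> rs r3 lt_l le_H hp r2.
rewrite /load_entry; eapply ct_le.
  apply: ct_seq; apply: ct_const; first by lia.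
  apply: ct_seq; apply: ct_sub; apply: (@ct_if _ _ _ _ _ 12 9); rewrite !regs_set /= ?size_reg_eq // ?rs => e.
    have lt_lp : l < size p by lia.
    have e2 : minn l (size p) = l by lia.
    have e2' : minn l.+1 (size p) = l.+1 by lia.
    rewrite e2 in r2; rewrite e2'.
    apply: (@ct_le _ (8 + (1 + 2))) => //.
    apply: (ct_fetch_entry (p := p) (a := a)) => // st1 k1 r12 f1.
    have k1' : keep (entry_block b l) st st1.
      by apply: keep_trans k1; do 2 apply: keep_set => //.
    have f4 : field p l 4 = if field p l 0 == 0 then field p l 2 else field p l 3.
      by rewrite /field (onth_lt (inl (0, 0)) lt_lp); case: (nth _ p l) => [[? ?]|[[? ?] ?]].
    have lt_f f : field p l f < B by apply: (field_lt lt_B _ _ hp).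
    apply: ct_seq; apply: ct_const; first by lia.
    apply: (@ct_if _ _ _ _ _ 1 1); rewrite regs_set field_regE f1 // => e0; apply: ct_add;
      rewrite !regs_set field_regE f1 //= ?addn0 //.
    - split; first by apply: keep_set; [exact: field_reg_entry|exact: keep_set].
        exact: r12.
      move: f4; rewrite (negPf e0) => f4.
      by case=> [|[|[|[|[|f]]]]] // _; rewrite /upd !field_regE !field_reg_same //= ?f1 ?f4.
    split; first by apply: keep_set; [exact: field_reg_entry|exact: keep_set].
      exact: r12.
    move: f4; rewrite e0 eqxx => f4.
    by case=> [|[|[|[|[|f]]]]] // _; rewrite /upd !field_regE !field_reg_same //= ?f1 ?f4.
  have ge_lp : size p <= l by lia.
  have e2' : minn l.+1 (size p) = minn l (size p) by lia.
  apply: (@ct_le _ (1 + (1 + (1 + (1 + 1))))) => //.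
  do 4 (apply: ct_seq; apply: ct_const; first by lia).
  apply: ct_const; first by lia.
  rewrite e2'; split.
  - do 5 (apply: keep_set; first exact: field_reg_entry).
    by do 2 apply: keep_set => //.
  - by rewrite !regs_set !field_regE.
  have fN f : field p l f = nth 0 [:: 2; 0; 0; 0; 0] f by rewrite /field onth_default.
  by case=> [|[|[|[|[|f]]]]] // _; rewrite fN !regs_set !field_reg_same.
by [].
Qed.

Definition load_cost : nat := 4 + 20 * H.+1.

Lemma ct_load_levels b h p a st :
  regs st (size_reg b) = size p -> regs st 3 = 1 -> h <= H -> size p <= H ->
  label_at B (Defs.mem st) a p -> regs st 2 = a + 1 ->
  ct B (load_levels b h) st (1 + 20 * h) (fun st' =>
    [/\ keep (fun r => block b r && (r != 3) && (r != size_reg b)) st st', regs st' 2 = a + (1 + 4 * minn h (size p))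
      & forall l f, l < h -> f < 5 -> regs st' (field_reg b l f) = field p l f]).
Proof.
elim: h => [|h IHh] rs r3 le_h le_H hp r2 /=.
  by apply: ct_le (leqnn _); rewrite muln0 addn0; apply: ct_skip; split=> //; rewrite min0n r2.
eapply ct_le.
  apply: ct_then; first by apply: IHh => //; apply: ltnW.
  move=> st1 [k1 r21 f1]; have [kr km _] := k1.
  apply: ct_conseq (leqnn _) _.
    apply: (@ct_load_entry b h p a) => //.
    - by rewrite kr // eqxx andbF.
    - by rewrite kr // andbF.
    - by rewrite km.
  move=> st2 [k2 r22 f2]; have [kr2 _ _] := k2; split=> //.
    apply: keep_trans k1 (keep_sub _ k2) => r er; rewrite (entry_block_block er) /=.
    case/or3P: er => [/eqP->|/eqP->|/hasP[f _ /eqP->]] //; rewrite field_reg_ctl //=.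
    by rewrite field_reg_ctl ?size_reg_lt.
  move=> l f; rewrite ltnS leq_eqVlt; case: (eqVneq l h) => [->|ne] /= lt_l lt_f; first exact: f2.
  by rewrite kr2 ?f1 // entry_block_field.
by lia.
Qed.

Lemma ct_load_label b p a st : regs st 2 = a -> size p <= H -> label_at B (Defs.mem st) a p ->
  ct B (load_label H b) st load_cost (fun st' => keep (block b) st st' /\ loaded H b p st').
Proof.
move=> r2 le_H hp.
have ltB : a + (4 * size p).+1 < B by case: hp => _; rewrite size_encode_label.
have m0 : Defs.mem st a = size p.
  by case: hp => /(_ 0); rewrite addn0 => ->.
eapply ct_le.
  apply: ct_seq; apply: ct_fetch; apply: ct_seq; apply: ct_const; first by lia.
  apply: ct_seq; apply: ct_add; rewrite !regs_set /= ?size_reg_eq //= ?r2; first by lia.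
  apply: ct_conseq (leqnn _) _.
    apply: (@ct_load_levels b H p a) => //; rewrite !regs_set /= ?eqxx ?size_reg_eq //=.
  move=> st' [k _ f].
  have k' : keep (block b) st st'.
    apply: keep_trans (keep_sub _ k); last by move=> r /andP[/andP[]].
    by do 3 (apply: keep_set; first by case: b {f k}).
  split=> //; split=> //; case: k => kr _ _; rewrite kr ?eqxx ?andbF //.
  by rewrite !regs_set /= eqxx ?size_reg_eq.
by rewrite /load_cost; lia.
Qed.

Definition write_entry (b : bool) (l : nat) : cmd :=
  Seq (Const 0 l) (Seq (Defs.Sub 0 (size_reg b) 0)
    (If 0 (Seq (Write (field_reg b l 0)) (Seq (Write (field_reg b l 1))
            (Seq (Write (field_reg b l 2)) (Write (field_reg b l 3))))) Skip)).

Fixpoint write_levels (b : bool) (h : nat) : cmd :=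
  if h is h'.+1 then Seq (write_levels b h') (write_entry b h') else Skip.

Definition write_label (b : bool) : cmd := Seq (Write (size_reg b)) (write_levels b H).

Definition emit (o : seq nat) (R : pred nat) (st st' : state) : Prop :=
  [/\ forall r, ~~ R r -> regs st' r = regs st r, Defs.mem st' = Defs.mem st & output st' = output st ++ o].

Lemma emit_trans o1 o2 R st1 st2 st3 : emit o1 R st1 st2 -> emit o2 R st2 st3 -> emit (o1 ++ o2) R st1 st3.
Proof.
move=> [r1 m1 e1] [r2 m2 e2]; split=> [r nr||]; first by rewrite r2 ?r1.
  by rewrite m2.
by rewrite e2 e1 catA.
Qed.

Lemma keep_emit R st st' : keep R st st' -> emit [::] R st st'.
Proof. by case=> r m e; split; rewrite ?cats0. Qed.

Lemma emit_sub o (R R' : pred nat) st st' : subpred R R' -> emit o R st st' -> emit o R' st st'.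
Proof. by move=> sub [r m e]; split=> // x nx; apply: r; apply: contra nx; apply: sub. Qed.

Lemma loaded_emit o b p st st' : emit o scratch st st' -> loaded H b p st -> loaded H b p st'.
Proof.
case=> r m _ lp.
apply: (@loaded_scratch _ _ _ st (State (regs st') (Defs.mem st') (output st))) => //.
Qed.

Lemma encode_entryE p l : l < size p ->
  encode_entry (nth (inl (0, 0)) p l) = [:: field p l 0; field p l 1; field p l 2; field p l 3].
Proof.
move=> lt_l; rewrite /field (onth_lt (inl (0, 0)) lt_l).
by case: (nth _ _ _) => [[? ?]|[[? ?] ?]].
Qed.

Lemma ct_write_levels b h p st : loaded H b p st -> h <= H ->
  ct B (write_levels b h) st (1 + 8 * h) (emit (flatten (map encode_entry (take h p))) scratch st).
Proof.
elim: h => [|h IHh] lp le_h /=; first by apply: ct_skip; rewrite take0; apply/keep_emit/keep_refl.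
eapply ct_le.
  apply: ct_then; first by apply: IHh => //; apply: ltnW.
  move=> st1 k1; have [rs f1] := loaded_emit k1 lp.
  rewrite /write_entry; apply: ct_seq; apply: ct_const; first by lia.
  apply: ct_seq; apply: ct_sub; apply: (@ct_if _ _ _ _ _ 4 1); rewrite !regs_set /= ?size_reg_eq // ?rs => e.
    have lt_h : h < size p by lia.
    apply: (@ct_le _ (1 + (1 + (1 + 1)))) => //.
    do 3 (apply: ct_seq; apply: ct_write); apply: ct_write.
    rewrite (take_nth (inl (0, 0))) // map_rcons flatten_rcons encode_entryE //.
    apply: emit_trans k1 _; split=> [r nr||] //=.
      by rewrite /upd; case: eqP nr => // ->.
    by rewrite /upd ?field_regE // !f1 // -!cats1 -!catA.
  apply: ct_skip; rewrite take_oversize; last by lia.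
  have -> : p = take h p by rewrite take_oversize //; lia.
  rewrite -[flatten _]cats0; apply: emit_trans k1 _; apply: keep_emit; do 2 apply: keep_set => //.
by lia.
Qed.

Definition write_cost : nat := 2 + 8 * H.

Lemma ct_write_label b p st : loaded H b p st -> size p <= H ->
  ct B (write_label b) st write_cost (emit (encode_label p) scratch st).
Proof.
move=> lp le_H; eapply ct_le.
  apply: ct_seq; apply: ct_write; apply: ct_conseq (leqnn _) _.
    by apply: (@ct_write_levels b H p).
  move=> st' k; rewrite take_oversize // in k.
  rewrite /encode_label -cat1s; apply: emit_trans k; split=> //=.
  by case: lp => -> _; rewrite cats1.
by rewrite /write_cost; lia.
Qed.

End Label.

(** * The program for a pass *)

Section Pass.
Variable H : nat.

(* Registers 7, 8 and 9 delimit the two arrays of pointers to labels; 11, 12 and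
   13 are the outer pointer, the pointer to the first inner label that is not
   skipped, and the pointer to the inner label being output. *)
Definition check (flag idx stop : nat) (t : test) : cmd :=
  Seq (Defs.Sub 0 stop idx)
    (If 0 (Seq (Fetch 2 idx) (Seq (load_label H true) (branch t (Const flag 1) (Const flag 0))))
          (Const flag 0)).

Definition increment (x : nat) (c : cmd) : cmd := Seq (Const 3 1) (Seq (Add x x 3) c).

Definition copy_to (x y : nat) (c : cmd) : cmd := Seq (Const 0 0) (Seq (Add x y 0) c).

Definition skip_body (stop : nat) (t : test) : cmd := increment 12 (check 14 12 stop t).

Definition skip_cmd (stop : nat) (t : test) : cmd :=
  Seq (check 14 12 stop t) (While 14 (skip_body stop t)).

Definition write_pair (sw : bool) : cmd := Seq (write_label H sw) (write_label H (~~ sw)).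

Definition output_body (sw : bool) (stop : nat) (t : test) : cmd :=
  Seq (write_pair sw) (increment 13 (check 14 13 stop t)).

Definition output_cmd (sw : bool) (stop : nat) (t : test) : cmd :=
  copy_to 13 12 (Seq (check 14 13 stop t) (While 14 (output_body sw stop t))).

Definition outer_start (sw : bool) : nat := if sw then 8 else 7.
Definition outer_stop (sw : bool) : nat := if sw then 9 else 8.

(** The outer label is loaded into both blocks, because tests take a pair and [active P] is
    evaluated at [(p, p)]. *)
Definition outer_body (P : pass) : cmd :=
  let sw := swapped P in
  Seq (Fetch 2 11) (Seq (load_label H false) (Seq (Fetch 2 11) (Seq (load_label H true)
    (Seq (branch (active P)
            (Seq (skip_cmd (outer_stop (~~ sw)) (before_test P))
                 (output_cmd sw (outer_stop (~~ sw)) (inside_test P))) Skip)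
      (increment 11 (Defs.Sub 10 (outer_stop sw) 11)))))).

Definition pass_cmd (P : pass) : cmd :=
  let sw := swapped P in
  copy_to 12 (outer_start (~~ sw)) (copy_to 11 (outer_start sw)
    (Seq (Defs.Sub 10 (outer_stop sw) 11) (While 10 (outer_body P)))).

Definition pair_code (sw : bool) (x : position * position) : seq nat :=
  if sw then encode_label x.2 ++ encode_label x.1 else encode_label x.1 ++ encode_label x.2.

Variable B : nat.
Hypothesis lt_B : maxn H 8 < B.

(** Labels differ in length; an array of their addresses can be traversed with unit steps, and its
    end is recognised by comparing indices. *)
Fixpoint pointers (m : nat -> nat) (i : nat) (ps : seq position) : Prop :=
  if ps is p :: ps' then [/\ label_at B m (m i) p, size p <= H & pointers m i.+1 ps']
  else True.

Lemma pointers_drop m i ps n : n <= size ps -> pointers m i ps -> pointers m (i + n) (drop n ps).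
Proof.
elim: n i ps => [|n IHn] i ps; first by rewrite addn0 drop0.
by case: ps => //= p ps le_n [_ _ h]; rewrite addnS -addSn; apply: IHn.
Qed.

(** The invariant of both inner loops: the flag anticipates the outcome at the head of [qs], whose
    label is already loaded and can be written without being fetched again. *)
Definition checked (flag : nat) (t : test) (p : position) (qs : seq position) (st : state) : Prop :=
  if qs is q :: _ then regs st flag = holds t p q /\ loaded H true q st else regs st flag = 0.

Definition check_cost (t : test) : nat := 4 + load_cost H + branch_cost t.

Definition check_regs (flag r : nat) : bool := block true r || (r == flag).

Lemma loaded_outer (R : pred nat) p st st' : (forall r, R r -> (r < 16) || odd r) ->
  keep R st st' -> loaded H false p st -> loaded H false p st'.
Proof.
move=> sub; apply: loaded_keep => r /sub; rewrite /block; case: (odd r); lia.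
Qed.

Lemma block_true r : block true r -> (r < 16) || odd r.
Proof. by rewrite /block; case: (odd r); lia. Qed.

Lemma ct_check flag idx stop t p qs st :
  4 <= flag < 16 -> 4 <= idx < 16 -> loaded H false p st -> test_ok B H t ->
  pointers (Defs.mem st) (regs st idx) qs -> regs st stop = regs st idx + size qs ->
  ct B (check flag idx stop t) st (check_cost t) (fun st' =>
    keep (check_regs flag) st st' /\ checked flag t p qs st').
Proof.
move=> flag_ok idx_ok lp ok_t hq estop.
have Rflag : check_regs flag flag by rewrite /check_regs eqxx orbT.
have R0 : check_regs flag 0 by [].
rewrite /check; eapply ct_le.
  apply: ct_seq; apply: ct_sub; rewrite estop.
  apply: (@ct_if _ _ _ _ _ (1 + (load_cost H + (1 + branch_cost t))) 1); rewrite regs_set /= => e; last first.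
    apply: ct_const; first by lia.
    have -> : qs = [::] by case: qs hq e estop => //= *; lia.
    by split; [do 2 apply: keep_set => //|rewrite /= /upd eqxx].
  case: qs hq estop e => [|q qs] /=; first by lia.
  move=> [hq le_q _] estop _.
  apply: ct_seq; apply: ct_fetch; rewrite regs_set ifF; last by lia.
  apply: ct_then.
    apply: (@ct_load_label B H lt_B true q (Defs.mem st (regs st idx))) => //.
  move=> st1 [k1 lq].
  have k1' : keep (check_regs flag) st st1.
    apply: keep_trans (keep_sub _ k1); last by move=> r br; rewrite /check_regs br.
    by do 2 apply: keep_set => //.
  have lp1 : loaded H false p st1.
    apply: (loaded_outer _ k1') lp => r /orP[/block_true//|/eqP->]; lia.
  apply: (ct_branch lp1 lq ok_t) => st2 k2.
  have k2' : keep (check_regs flag) st st2.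
    by apply: keep_trans k1' (keep_sub _ k2) => r; rewrite /check_regs /block /scratch => ->.
  have lq2 := loaded_scratch k2 lq.
  have fin b : ct B (Const flag (nat_of_bool b)) st2 1 (fun st' => keep (check_regs flag) st st' /\ (regs st' flag = b /\ loaded H true q st')).
    apply: ct_const; first by case: b; lia.
    split; first exact: keep_set.
    split; first by rewrite regs_set eqxx.
    have kf : keep (pred1 flag) st2 (set_reg st2 flag b) by apply: keep_set; rewrite /= ?eqxx.
    by apply: (loaded_keep _ kf lq2) => r /eqP->; rewrite /block; lia.
  by case: ifP => _; [apply: (fin true)|apply: (fin false)].
by rewrite /check_cost; lia.
Qed.

Lemma ct_copy x y c st T Q : y != 0 -> regs st y < B ->
  ct B c (set_reg (set_reg st 0 0) x (regs st y)) T Q -> ct B (copy_to x y c) st (2 + T) Q.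
Proof.
move=> /negPf y0 lt_y hc; apply: (@ct_le _ (1 + (1 + T))) => //; apply: ct_seq; apply: ct_const; first by lia.
by apply: ct_seq; apply: ct_add; rewrite !regs_set eqxx y0 addn0.
Qed.

Definition skip_regs (r : nat) : bool := [|| block true r, r == 12 | r == 14].

Lemma ct_skip_while stop t p qs st :
  8 <= stop < 10 -> loaded H false p st -> test_ok B H t ->
  pointers (Defs.mem st) (regs st 12) qs -> regs st stop = regs st 12 + size qs ->
  regs st stop < B -> checked 14 t p qs st ->
  let n := find (predC (holds t p)) qs in
  ct B (While 14 (skip_body stop t)) st (1 + (check_cost t + 3) * n) (fun st' =>
    keep skip_regs st st' /\ regs st' 12 = regs st 12 + n).
Proof.
move=> stop_ok; elim: qs st => [|q qs IHqs] st lp ok_t hq estop lt_stop /=.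
  move=> e; rewrite muln0; apply: ct_while_end => //; split=> //; by rewrite addn0.
case: hq => _ _ hq [e lq]; case: (boolP (holds t p q)) e => hpq e /=; last first.
  by rewrite muln0; apply: ct_while_end => //; split=> //; rewrite addn0.
eapply ct_le.
  apply: ct_while_loop; first by rewrite e.
  rewrite /skip_body /increment; apply: ct_seq; apply: ct_const; first by lia.
  apply: ct_seq; apply: ct_add; rewrite !regs_set /=; first by move: estop => /=; lia.
  set st1 := set_reg _ 12 _.
  have k1 : keep (fun r => (r == 3) || (r == 12)) st st1 by do 2 apply: keep_set => //.
  apply: ct_conseq (leqnn _) _.
    apply: (@ct_check 14 12 stop t p qs st1) => //.
    - by rewrite regs_set eqxx addn1.
    - by rewrite !regs_set /= !ifF; move: estop => /=; lia.
  move=> st2 [k2 ch].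
  have k2' : keep skip_regs st st2.
    apply: keep_trans (keep_sub _ k1) (keep_sub _ k2) => r; rewrite /skip_regs.
      by case/orP=> /eqP->.
    by case/orP=> [->|->] //; rewrite !orbT.
  have [kr km _] := k2; have [kr2 km2 _] := k2'.
  have e12 : regs st2 12 = regs st 12 + 1 by rewrite kr // regs_set eqxx.
  have es : regs st2 stop = regs st stop by rewrite kr2 // /skip_regs /block; lia.
  apply: ct_conseq (leqnn _) _.
    apply: IHqs => //.
    - by apply: (loaded_outer _ k2') lp => r /or3P[/block_true|/eqP->|/eqP->].
    - by rewrite km2 e12 addn1.
    - by rewrite es e12 estop /=; lia.
    - by rewrite es.
  move=> st3 [k3 e3]; split; first exact: keep_trans k2' k3.
  by rewrite e3 e12; lia.
by lia.
Qed.

Definition pair_cost : nat := write_cost H + write_cost H.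

Lemma ct_write_pair sw p q st : loaded H false p st -> loaded H true q st -> size p <= H -> size q <= H ->
  ct B (write_pair sw) st pair_cost (emit (pair_code sw (p, q)) scratch st).
Proof.
move=> lp lq le_p le_q; pose lab b := if b then q else p.
have l b : loaded H b (lab b) st by case: b.
have le b : size (lab b) <= H by case: b.
apply: ct_then; first exact: (ct_write_label lt_B (l sw) (le sw)).
move=> st1 k1; apply: ct_conseq (leqnn _) _.
  apply: (ct_write_label lt_B (p := lab (~~ sw))) => //; exact: loaded_emit k1 (l _).
move=> st2 k2; have := emit_trans k1 k2; by rewrite /pair_code /lab; case: sw {k1 k2}.
Qed.

Definition output_regs (r : nat) : bool := [|| block true r, r == 13 | r == 14].

Lemma loaded_outer_emit o (R : pred nat) p st st' : (forall r, R r -> (r < 16) || odd r) ->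
  emit o R st st' -> loaded H false p st -> loaded H false p st'.
Proof.
move=> sub [r m _] lp.
exact: (@loaded_outer R p st (State (regs st') (Defs.mem st') (output st))).
Qed.

Lemma ct_output_while sw stop t p qs st :
  8 <= stop < 10 -> loaded H false p st -> size p <= H -> test_ok B H t ->
  pointers (Defs.mem st) (regs st 13) qs -> regs st stop = regs st 13 + size qs ->
  regs st stop < B -> checked 14 t p qs st ->
  let qs' := take_while (holds t p) qs in
  ct B (While 14 (output_body sw stop t)) st (1 + (pair_cost + check_cost t + 3) * size qs')
    (emit (flatten [seq pair_code sw (p, q) | q <- qs']) output_regs st).
Proof.
move=> stop_ok; elim: qs st => [|q qs IHqs] st lp le_p ok_t hq estop lt_stop /=.
  move=> e; rewrite muln0; apply: ct_while_end => //; exact/keep_emit/keep_refl.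
case: hq => _ le_q hq [e lq]; rewrite /take_while /=; case: (boolP (holds t p q)) e => hpq e /=; last first.
  rewrite muln0; apply: ct_while_end => //; exact/keep_emit/keep_refl.
eapply ct_le.
  apply: ct_while_loop; first by rewrite e.
  rewrite /output_body; apply: ct_then; first exact: (@ct_write_pair sw p q).
  move=> st0 k0; have [kr0 km0 _] := k0.
  rewrite /increment; apply: ct_seq; apply: ct_const; first by lia.
  apply: ct_seq; apply: ct_add; rewrite !regs_set /= ?kr0 //; first by move: estop => /=; lia.
  set st1 := set_reg _ 13 _.
  have k1 : keep (fun r => (r == 3) || (r == 13)) st0 st1 by do 2 apply: keep_set => //.
  have lp0 : loaded H false p st0 by apply: loaded_emit k0 lp.
  have es0 : regs st1 stop = regs st stop.
    by case: k1 => -> //; rewrite ?kr0 // /scratch; lia.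
  apply: ct_conseq (leqnn _) _.
    apply: (@ct_check 14 13 stop t p qs st1) => //.
    - by rewrite regs_set eqxx addn1; case: k1 => _ -> _; rewrite km0.
    - by rewrite es0 regs_set eqxx estop /=; lia.
  move=> st2 [k2 ch].
  have k2' : emit (pair_code sw (p, q)) output_regs st st2.
    rewrite -[pair_code _ _]cats0; apply: (@emit_trans _ _ _ _ st0).
      by apply: emit_sub k0 => r; rewrite /output_regs /block /scratch => ->.
    apply: keep_emit; apply: keep_trans (keep_sub _ k1) (keep_sub _ k2) => r; rewrite /output_regs.
      by case/orP=> /eqP->.
    by case/orP=> [->|->] //; rewrite !orbT.
  have [kr _ _] := k2; have [kr2 km2 _] := k2'.
  have e13 : regs st2 13 = regs st 13 + 1 by rewrite kr // regs_set eqxx.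
  have es : regs st2 stop = regs st stop by rewrite kr2 // /output_regs /block; lia.
  apply: ct_conseq (leqnn _) _.
    apply: IHqs => //.
    - by apply: (loaded_outer_emit _ k2') lp => r /or3P[/block_true|/eqP->|/eqP->].
    - by rewrite km2 e13 addn1.
    - by rewrite es e13 estop /=; lia.
    - by rewrite es.
  move=> st3 k3; exact: emit_trans k2' k3.
by rewrite -/(take_while (holds t p) qs); lia.
Qed.

Definition pass_regs (r : nat) : bool := ~~ (7 <= r < 10).

Definition pass_factor (P : pass) : nat :=
  20 + 2 * load_cost H + branch_cost (active P) + 2 * check_cost (before_test P)
  + 2 * check_cost (inside_test P) + pair_cost.

Definition pass_test_ok (P : pass) : bool :=
  [&& test_ok B H (active P), test_ok B H (before_test P) & test_ok B H (inside_test P)].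

Let out (P : pass) (s : seq (position * position)) : seq nat :=
  flatten (map (pair_code (swapped P)) s).

(** Register 12 keeps its new value for the next outer label. The conclusion resets it inside the
    frame condition and states its change separately. *)
Lemma ct_outer_branch P p qs st : pass_test_ok P ->
  let sw := swapped P in let stop := outer_stop (~~ sw) in
  let n := find (predC (holds (before_test P) p)) qs in
  let qs' := drop n qs in let os := take_while (holds (inside_test P) p) qs' in
  loaded H false p st -> size p <= H -> pointers (Defs.mem st) (regs st 12) qs ->
  regs st stop = regs st 12 + size qs -> regs st stop < B ->
  ct B (Seq (skip_cmd stop (before_test P)) (output_cmd sw stop (inside_test P))) st
    (4 + check_cost (before_test P) + (check_cost (before_test P) + 3) * n
       + check_cost (inside_test P) + (pair_cost + check_cost (inside_test P) + 3) * size os)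
    (fun st' => emit (out P [seq (p, q) | q <- os]) (fun r => pass_regs r && (r != 11) && (r != 12)) st
       (set_reg st' 12 (regs st 12)) /\ regs st' 12 = regs st 12 + n).
Proof.
case/and3P=> _ ok_b ok_i sw stop n qs' os lp le_p hq estop lt_stop.
have stop_ok : 8 <= stop < 10 by rewrite /stop /outer_stop; case: ifP.
have skip_outer r : skip_regs r -> (r < 16) || odd r by case/or3P=> [/block_true|/eqP->|/eqP->].
have skip_stop : ~~ skip_regs stop by rewrite /skip_regs /block; lia.
eapply ct_le.
  apply: ct_then.
    rewrite /skip_cmd; apply: ct_then; first exact: (@ct_check 14 12 stop _ p qs).
    move=> st1 [k1 ch1].
    have k1' : keep skip_regs st st1.
      by apply: keep_sub k1 => r; rewrite /skip_regs => /orP[->|->]; rewrite ?orbT.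
    have [kr1 km1 _] := k1; have [kr1' _ _] := k1'.
    have e12 : regs st1 12 = regs st 12 by rewrite kr1.
    have es : regs st1 stop = regs st stop by rewrite kr1'.
    apply: ct_conseq (leqnn _) _.
      apply: (@ct_skip_while stop (before_test P) p qs st1) => //.
      - exact: loaded_outer k1' lp.
      - by rewrite km1 e12.
      - by rewrite es e12.
      - by rewrite es.
    move=> st2 [k2]; rewrite -/n e12 => e2.
    exact: (conj (keep_trans k1' k2) e2).
  move=> st2 [k2 e12]; have [kr2 km2 _] := k2.
  have es : regs st2 stop = regs st stop by rewrite kr2.
  have le_n : n <= size qs by apply: find_size.
  rewrite /output_cmd; apply: ct_copy => //; first by rewrite e12; lia.
  rewrite e12.
  set st3 := set_reg _ 13 _.
  have k3 : keep output_regs st2 st3 by do 2 apply: keep_set => //.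
  have lp3 : loaded H false p st3.
    apply: (loaded_outer _ k3); last exact: loaded_outer k2 lp.
    by move=> r /or3P[/block_true|/eqP->|/eqP->].
  have e13 : regs st3 13 = regs st 12 + n by rewrite regs_set eqxx.
  have es3 : regs st3 stop = regs st stop by case: k3 => -> //; rewrite /output_regs /block; lia.
  have hq3 : pointers (Defs.mem st3) (regs st3 13) qs'.
    by rewrite e13; case: k3 => _ -> _; rewrite km2; apply: pointers_drop.
  have estop3 : regs st3 stop = regs st3 13 + size qs'.
    by rewrite es3 e13 estop size_drop; lia.
  apply: ct_then; first exact: (@ct_check 14 13 stop (inside_test P) p qs' st3).
  move=> st4 [k4 ch4].
  have k4' : keep output_regs st3 st4.
    by apply: keep_sub k4 => r; rewrite /output_regs => /orP[->|->]; rewrite ?orbT.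
  have [kr4 km4 _] := k4; have [kr4' _ _] := k4'.
  have es4 : regs st4 stop = regs st3 stop by rewrite kr4' // /output_regs /block; lia.
  apply: ct_conseq (leqnn _) _.
    apply: (@ct_output_while sw stop (inside_test P) p qs' st4) => //.
    - by apply: (loaded_outer _ k4') lp3 => r /or3P[/block_true|/eqP->|/eqP->].
    - by rewrite km4 kr4.
    - by rewrite es4 kr4.
    - by rewrite es4 es3.
  rewrite -/os => st5 k5; have {}k5 := emit_trans (keep_emit (keep_trans k3 k4')) k5.
  have [kr5 km5 o5] := k5; split; last by rewrite kr5.
  split=> [r nr||].
  - rewrite regs_set; case: eqP => [->//|/eqP ne12].
    have nr' : ~~ (pass_regs r && (r != 11)) by move: nr; rewrite ne12 andbT.
    rewrite kr5 ?kr2 //; move: nr' ne12; rewrite /skip_regs /output_regs /pass_regs /block.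
      by clear; lia.
    by clear; lia.
  - by rewrite /= km5 km2.
  by rewrite /= o5 /out -map_comp; case: k2 => _ _ ->.
rewrite -/n -/os; lia.
Qed.

(** The amortised count. A round costs a constant, plus a multiple of the number [n'] of inner
    labels skipped, which leave [qs] for good, plus a multiple of the number of pairs output. *)
Lemma ct_outer_while P ps qs st : pass_test_ok P ->
  let sw := swapped P in
  pointers (Defs.mem st) (regs st 11) ps -> regs st (outer_stop sw) = regs st 11 + size ps ->
  pointers (Defs.mem st) (regs st 12) qs -> regs st (outer_stop (~~ sw)) = regs st 12 + size qs ->
  regs st 9 < B -> regs st 8 < B -> regs st 10 = size ps ->
  let res := pass_sweep P ps qs in
  ct B (While 10 (outer_body P)) st (1 + pass_factor P * (size ps + size qs + size res))
    (emit (out P res) pass_regs st).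
Proof.
move=> ok sw; elim: ps qs st => [|p ps IHps] qs st hp ep hq eq lt9 lt8 e10 res.
  by apply: ct_le (_ : 1 <= _) => //; apply: ct_while_end => //; apply/keep_emit/keep_refl.
case: hp => hp le_p hps.
have lt_stop b : regs st (outer_stop b) < B by case: b.
have stop_ok b : 8 <= outer_stop b < 10 by case: b.
have [ok_a _ _] := and3P ok.
set n := find (predC (holds (before_test P) p)) qs.
pose act := holds (active P) p p.
pose n' := if act then n else 0.
pose qs' := drop n' qs.
pose os := if act then take_while (holds (inside_test P) p) (drop n qs) else [::].
have eres : res = [seq (p, q) | q <- os] ++ pass_sweep P ps qs'.
  rewrite /res /pass_sweep /= /os /qs' /n' /act; case: ifP => _ //=.
  by rewrite drop0.
have le_n : n' <= size qs by rewrite /n' /n; case: ifP => _ //; apply: find_size.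
eapply ct_le.
  apply: ct_while_loop; first by rewrite e10.
  rewrite /outer_body; apply: ct_seq; apply: ct_fetch.
  apply: ct_then; first by apply: (@ct_load_label B H lt_B false p) => //; rewrite regs_set eqxx.
  move=> st1 [k1 lp1]; have {}k1 : keep (block false) st st1.
    by apply: keep_trans k1; apply: keep_set.
  have [kr1 km1 _] := k1.
  apply: ct_seq; apply: ct_fetch; rewrite km1 kr1 //.
  apply: ct_then; first by apply: (@ct_load_label B H lt_B true p (Defs.mem st (regs st 11))) => //=; rewrite km1.
  move=> st2 [k2 lq2]; have {}k2 : keep (block true) st1 st2.
    by apply: keep_trans k2; apply: keep_set.
  have lp2 : loaded H false p st2 by apply: loaded_outer lp1; [exact: block_true|exact: k2].
  have k2' : keep (fun r => ~~ (4 <= r < 16)) st st2.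
    apply: keep_trans (keep_sub _ k1) (keep_sub _ k2) => r; rewrite /block; clear; lia.
  have [kr2 km2 _] := k2'.
  apply: ct_then.
    apply: (@ct_branch _ _ _ _ _ _ _ _ (4 + check_cost (before_test P) + (check_cost (before_test P) + 3) * n'
       + check_cost (inside_test P) + (pair_cost + check_cost (inside_test P) + 3) * size os)
       (fun st' => emit (out P [seq (p, q) | q <- os]) (fun r => pass_regs r && (r != 11) && (r != 12)) st
       (set_reg st' 12 (regs st 12)) /\ regs st' 12 = regs st 12 + n') lp2 lq2 ok_a) => st3 k3.
    have k3' : keep (fun r => ~~ (4 <= r < 16)) st st3.
      by apply: keep_trans k2' (keep_sub _ k3) => r; rewrite /scratch; clear; lia.
    have [kr3 km3 ko3] := k3'.
    have kstop b : regs st3 (outer_stop b) = regs st (outer_stop b) by rewrite kr3 //; case: b.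
    have k3p : keep (fun r => pass_regs r && (r != 11) && (r != 12)) st st3.
      by apply: keep_sub k3' => r; rewrite /pass_regs; clear; lia.
    rewrite -/act /n' /os; case: ifP => _.
      apply: ct_conseq (leqnn _) _.
        apply: (@ct_outer_branch P p qs st3) => //.
        - exact: loaded_scratch k3 lp2.
        - by rewrite km3 kr3.
        - by rewrite kstop kr3.
        - by rewrite kstop.
      move=> st4 []; rewrite kr3 // -/n => -[kr4 km4 ko4] e4; split=> //; split.
      - by move=> r nr; rewrite kr4 //; case: k3p => ->.
      - by rewrite km4 km3.
      by rewrite ko4 ko3.
    apply: (@ct_le _ 1); last by lia.
    apply: ct_skip; split; last by rewrite addn0 kr3.
    apply: keep_emit; split=> [r nr||] //=; rewrite /upd.
    by case: eqP => [->//|_]; case: k3p => ->.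
  move=> st3 [[kr3 km3 ko3] e3].
  have e11 : regs st3 11 = regs st 11 by rewrite -(kr3 11).
  have es3 b : regs st3 (outer_stop b) = regs st (outer_stop b).
    by rewrite -(kr3 (outer_stop b)) ?regs_set ?ifF //; rewrite /pass_regs; case: b.
  rewrite /increment; apply: ct_seq; apply: ct_const; first by lia.
  apply: ct_seq; apply: ct_add; rewrite !regs_set /= e11; first by have := lt_stop sw; rewrite ep /=; lia.
  apply: ct_sub; rewrite !regs_set /=.
  have -> : (if outer_stop sw == 11 then regs st 11 + 1 else if outer_stop sw == 3 then 1 else regs st3 (outer_stop sw)) = regs st (outer_stop sw).
    by rewrite !ifF ?es3 //; have := stop_ok sw; lia.
  rewrite [X in X - _]ep /=.
  set st4 := set_reg _ 10 _.
  have rest r : [&& r != 3, r != 10 & r != 11] -> regs st4 r = regs st3 r.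
    by case/and3P=> n3 n10 n11; rewrite !regs_set !ifN.
  have es4 b : regs st4 (outer_stop b) = regs st (outer_stop b) by rewrite rest ?es3 //; case: b.
  have k4 : emit (out P [seq (p, q) | q <- os]) pass_regs st st4.
    split=> [r nr||]; last by rewrite -ko3.
      rewrite rest; last by move: nr; rewrite /pass_regs; lia.
      have ne12 : r != 12 by move: nr; rewrite /pass_regs; lia.
      by rewrite -(kr3 r) ?regs_set ?ifN // (negPf nr).
    by rewrite -km3.
  have m4 : Defs.mem st4 = Defs.mem st by case: k4.
  have e11' : regs st4 11 = regs st 11 + 1 by [].
  have e12' : regs st4 12 = regs st 12 + n' by rewrite rest.
  apply: ct_conseq (leqnn _) _.
    apply: (IHps qs' st4).
    - by rewrite m4 e11' addn1.
    - by rewrite es4 ep e11' /=; lia.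
    - by rewrite m4 e12'; apply: pointers_drop.
    - by rewrite es4 eq e12' size_drop; lia.
    - by rewrite (es4 true).
    - by rewrite (es4 false).
    - by rewrite regs_set /=; lia.
  move=> st5 k5; rewrite eres /out map_cat flatten_cat; exact: emit_trans k4 k5.
rewrite eres size_cat size_map /= /qs' size_drop.
have hn : (check_cost (before_test P) + 3) * n' <= pass_factor P * n'.
  by rewrite leq_mul2r /pass_factor; apply/orP; right; lia.
have ho : (pair_cost + check_cost (inside_test P) + 3) * size os <= pass_factor P * size os.
  by rewrite leq_mul2r /pass_factor; apply/orP; right; lia.
(* The three last summands pay for this round, the rest is the measure of the remaining ones. *)
have -> : (size ps).+1 + size qs + (size os + size (pass_sweep P ps (drop n' qs))) =
    (size ps + (size qs - n') + size (pass_sweep P ps (drop n' qs))) + 1 + n' + size os by lia.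
rewrite !mulnDr muln1 -!mulnDr.
have : 20 + 2 * load_cost H + branch_cost (active P) + check_cost (before_test P)
  + check_cost (inside_test P) <= pass_factor P by rewrite /pass_factor; lia.
by lia.
Qed.

Lemma ct_pass P ps qs st : pass_test_ok P ->
  pointers (Defs.mem st) (regs st 7) ps -> regs st 8 = regs st 7 + size ps ->
  pointers (Defs.mem st) (regs st 8) qs -> regs st 9 = regs st 8 + size qs ->
  regs st 9 < B ->
  let res := pass_pairs P ps qs in
  ct B (pass_cmd P) st (6 + pass_factor P * (size ps + size qs + size res))
    (emit (flatten [seq encode_label x.1 ++ encode_label x.2 | x <- res]) pass_regs st).
Proof.
move=> ok hp e8 hq e9 lt9 res.
pose sw := swapped P.
pose os := if sw then qs else ps.
pose ns := if sw then ps else qs.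
have eres : flatten [seq encode_label x.1 ++ encode_label x.2 | x <- res] = out P (pass_sweep P os ns).
  by rewrite /res /pass_pairs /out /os /ns /sw; case: (swapped P) => //; rewrite -map_comp.
have sres : size res = size (pass_sweep P os ns).
  by rewrite /res /pass_pairs /os /ns /sw; case: (swapped P); rewrite ?size_map.
have sz : size ps + size qs = size os + size ns by rewrite /os /ns; case: ifP; lia.
have start_lt b : regs st (outer_start b) < B by case: b; rewrite /=; lia.
have nst b r : 10 <= r -> (outer_start b == r) = false by case: b; rewrite /=; lia.
have nsp b r : 10 <= r -> (outer_stop b == r) = false by case: b; rewrite /=; lia.
rewrite eres sres sz; eapply ct_le.
  rewrite /pass_cmd; apply: ct_copy; [by case: (swapped P)|exact: start_lt|].
  apply: ct_copy; [by case: (swapped P)|by rewrite !regs_set !ifF ?start_lt //; case: (swapped P)|].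
  rewrite -/sw; apply: ct_seq; apply: ct_sub.
  set st1 := set_reg _ 10 _.
  have k1 : keep (fun r => pass_regs r) st st1 by do 5 apply: keep_set => //.
  have [kr1 km1 _] := k1.
  have es b : regs st1 (outer_stop b) = regs st (outer_stop b) by rewrite kr1 //; case: b.
  have e11 : regs st1 11 = regs st (outer_start sw) by rewrite /st1 /sw; case: (swapped P).
  have e12 : regs st1 12 = regs st (outer_start (~~ sw)) by rewrite /st1 /sw; case: (swapped P).
  apply: ct_conseq (leqnn _) _.
    apply: (@ct_outer_while P os ns st1) => //.
    - by rewrite km1 e11 /os /sw; case: (swapped P).
    - by rewrite es e11 /os /sw; case: (swapped P).
    - by rewrite km1 e12 /ns /sw; case: (swapped P).
    - by rewrite es e12 /ns /sw; case: (swapped P).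
    - by have -> : regs st1 8 = regs st 8 by []; lia.
    - have -> : regs st1 10 = regs st (outer_stop sw) - regs st (outer_start sw).
        by rewrite /st1 /sw; case: (swapped P).
      by rewrite /os /sw; case: (swapped P) => /=; lia.
  by move=> st2 k2; rewrite -[out _ _]cat0s; apply: emit_trans k2; apply: keep_emit.
by lia.
Qed.

End Pass.

(** * Removal of repetitions *)

Arguments encode_label : simpl never.

Section Program.
Variable H : nat.

(* Registers 4, 5 and 6: the address of the current label of the input, the
   number of labels left, and the address of the next pointer to be stored. *)
Definition next_label : cmd :=
  Seq (Fetch 0 4) (Seq (Add 4 4 0) (Seq (Add 4 4 0) (Seq (Add 4 4 0) (Seq (Add 4 4 0)
    (increment 4 (Defs.Sub 5 5 3)))))).

Definition same_label : test :=
  TAll [seq TAll [seq TEq (false, l, f) (true, l, f) | f <- iota 0 4] | l <- iota 0 H].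

(** The odd registers hold the last label kept, with which the next one is compared, so a label that
    is kept is loaded there as well. *)
Definition push_label : cmd := Seq (Store 6 4) (increment 6 (copy_to 2 4 (load_label H true))).

Definition dedup_body : cmd :=
  copy_to 2 4 (Seq (load_label H false) (Seq (branch same_label Skip push_label) next_label)).

Fixpoint sentinel_levels (h : nat) : cmd :=
  if h is h'.+1 then
    Seq (sentinel_levels h') (Seq (Const (field_reg true h' 0) 0) (Seq (Const (field_reg true h' 1) 0)
      (Seq (Const (field_reg true h' 2) 0) (Seq (Const (field_reg true h' 3) 0) (Const (field_reg true h' 4) 0)))))
  else Skip.

(* A label longer than those of the input, so that the first label of a list
   differs from it. *)
Definition sentinel : position := nseq H (inl (0, 0)).

Definition sentinel_cmd : cmd := Seq (sentinel_levels H) (Const (size_reg true) H).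

Definition first_list (c : cmd) : cmd := Seq (Const 4 0) (Seq (Fetch 5 4) (Seq (Const 4 1) c)).

Definition second_list (c : cmd) : cmd := Seq (Fetch 5 4) (increment 4 c).

Definition dedup_cmd : cmd := Seq sentinel_cmd (While 5 dedup_body).

Definition passes_cmd (Ps : seq pass) : cmd := foldr (fun P c => Seq (pass_cmd H P) c) Skip Ps.

(** The first traversal of the two lists only finds the end of the input. Behind it the two pointer
    arrays are built, so that the labels are never overwritten. *)
Definition program (Ps : seq pass) : cmd :=
  first_list (Seq (While 5 next_label) (second_list (Seq (While 5 next_label)
    (copy_to 6 4 (copy_to 7 4 (first_list (Seq dedup_cmd (copy_to 8 6
      (second_list (Seq dedup_cmd (copy_to 9 6 (passes_cmd Ps)))))))))))).

Variable B : nat.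

Definition codes (ls : seq position) : seq nat := flatten (map encode_label ls).
Arguments codes : simpl never.

Lemma size_codes_cons p ls : size (codes (p :: ls)) = size (encode_label p) + size (codes ls).
Proof. by rewrite /codes /= size_cat. Qed.

(** The lengths are strictly less than [H], which is the length of [sentinel]. *)
Fixpoint layout (m : nat -> nat) (a : nat) (ls : seq position) : Prop :=
  if ls is p :: ls' then
    [/\ label_at B m a p, size p < H & layout m (a + size (encode_label p)) ls']
  else True.

Lemma layout_nth pre ls post :
  all (fun p => size p < H) ls -> all (fun x => x < B) (pre ++ codes ls ++ post) ->
  size (pre ++ codes ls ++ post) < B ->
  layout (nth 0 (pre ++ codes ls ++ post)) (size pre) ls.
Proof.
elim: ls pre => [|p ls IHls] pre // /andP[lt_p lt_ls] lts sz.
have e : pre ++ codes (p :: ls) ++ post = (pre ++ encode_label p) ++ codes ls ++ post.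
  by rewrite /codes /= -!catA.
rewrite e in lts sz *; split=> //; last by rewrite -size_cat; apply: IHls.
split.
- move=> f lt_f; rewrite -catA nth_cat; case: ltnP => [|_]; first by lia.
  by rewrite addKn nth_cat lt_f.
- by move: sz; rewrite !size_cat; lia.
by move: lts; rewrite !all_cat => /andP[/andP[]].
Qed.

Lemma label_at_ext L m m' a p : (forall x, x < L -> m' x = m x) -> a + size (encode_label p) <= L ->
  label_at B m a p -> label_at B m' a p.
Proof. by move=> ext le [h lt al]; split=> // f lt_f; rewrite ext ?h //; lia. Qed.

Lemma layout_ext L m m' a ls : (forall x, x < L -> m' x = m x) -> a + size (codes ls) <= L ->
  layout m a ls -> layout m' a ls.
Proof.
move=> ext; elim: ls a => // p ls IHls a; rewrite size_codes_cons => le [hp lt_p hls]; split=> //.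
  by apply: (label_at_ext ext) hp; lia.
by apply: IHls hls; lia.
Qed.

Definition advance_regs (r : nat) : bool := r < 6.

Hypothesis lt_B : maxn H 8 < B.

(** A label of [n] entries fills [4 * n + 1] cells with [n] in the first: four additions of that
    cell and one increment. *)
Lemma ct_next_label p n st : label_at B (Defs.mem st) (regs st 4) p -> regs st 5 = n.+1 ->
  ct B next_label st 8 (fun st' =>
    [/\ keep advance_regs st st', regs st' 4 = regs st 4 + size (encode_label p) & regs st' 5 = n]).
Proof.
move=> hp e5; have e0 : Defs.mem st (regs st 4) = size p.
  by case: hp => /(_ 0); rewrite addn0 => ->.
have ltB : regs st 4 + (4 * size p).+1 < B by case: hp => _; rewrite size_encode_label.
rewrite size_encode_label /next_label /increment; eapply ct_le.
  apply: ct_seq; apply: ct_fetch; rewrite e0.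
  do 4 (apply: ct_seq; apply: ct_add; rewrite !regs_set /=; first by lia).
  apply: ct_seq; apply: ct_const; first by lia.
  apply: ct_seq; apply: ct_add; rewrite !regs_set /=; first by lia.
  apply: ct_sub; rewrite !regs_set /= e5; split; rewrite ?regs_set /=; [|lia|lia].
  by do 8 apply: keep_set => //.
by [].
Qed.

Lemma ct_scan ls st : layout (Defs.mem st) (regs st 4) ls -> regs st 5 = size ls ->
  ct B (While 5 next_label) st (1 + 9 * size ls) (fun st' =>
    keep advance_regs st st' /\ regs st' 4 = regs st 4 + size (codes ls)).
Proof.
elim: ls st => [|p ls IHls] st.
  by move=> _ e; rewrite muln0; apply: ct_while_end => //; split=> //; rewrite addn0.
move=> [hp _ hls] e5; eapply ct_le.
  apply: ct_while_loop; first by rewrite e5.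
  apply: ct_conseq (ct_next_label hp e5) (leqnn _) _ => st1 [k1 e4 e5'].
  have [_ m1 _] := k1; apply: ct_conseq (leqnn _) _.
    by apply: (IHls st1); rewrite ?m1 ?e4.
  move=> st2 [k2 e]; split; first exact: keep_trans k1 k2.
  by rewrite e e4 size_codes_cons addnA.
by rewrite [size (p :: ls)]/=; lia.
Qed.

Lemma ct_sentinel_levels h st : ct B (sentinel_levels h) st (1 + 5 * h) (fun st' =>
  keep (block true) st st' /\ forall l f, l < h -> f < 5 -> regs st' (field_reg true l f) = 0).
Proof.
elim: h => [|h IHh] /=; first by apply: ct_skip.
eapply ct_le.
  apply: ct_then IHh _ => st1 [k1 f1].
  do 4 (apply: ct_seq; apply: ct_const; first by lia).
  apply: ct_const; first by lia.
  split; first by do 5 (apply: keep_set; first exact: field_reg_block).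
  move=> l f; rewrite ltnS leq_eqVlt => /orP[/eqP->|lt_l] lt_f; rewrite !regs_set !field_reg_neq //.
    by rewrite !eqxx /=; case: f lt_f => [|[|[|[|[|f]]]]].
  by rewrite (ltn_eqF lt_l) /= ?andbF f1.
by lia.
Qed.

Definition sentinel_cost : nat := 2 + 5 * H.

Lemma field_sentinel l f : l < H -> field sentinel l f = 0.
Proof.
move=> lt_l; rewrite /field (onth_lt (inl (0, 0))) ?size_nseq // nth_nseq lt_l /=.
by case: f => [|[|[|[|[|f]]]]] //=; rewrite nth_nil.
Qed.

Lemma ct_sentinel st : ct B sentinel_cmd st sentinel_cost (fun st' =>
  keep (block true) st st' /\ loaded H true sentinel st').
Proof.
eapply ct_le.
  apply: ct_then (ct_sentinel_levels H st) _ => st1 [k1 f1].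
  apply: ct_const; first by lia.
  split; first exact: keep_set.
  split; first by rewrite regs_set eqxx size_nseq.
  by move=> l f lt_l lt_f; rewrite regs_set field_reg_ctl ?size_reg_lt // f1 // field_sentinel.
by rewrite /sentinel_cost; lia.
Qed.

Lemma test_ok_TAll (T : eqType) (s : seq T) (f : T -> test) :
  {in s, forall x, test_ok B H (f x)} -> test_ok B H (TAll (map f s)).
Proof.
elim: s => //= x s IHs hs; rewrite hs ?mem_head //=; apply: IHs => y ys.
by apply: hs; rewrite inE ys orbT.
Qed.

Lemma same_label_ok : test_ok B H same_label.
Proof.
apply: test_ok_TAll => l; rewrite mem_iota add0n => lt_l.
apply: test_ok_TAll => f; rewrite mem_iota add0n => lt_f.
by rewrite /= /operand_ok /=; move: lt_l lt_f; clear; lia.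
Qed.

Lemma holds_TAll_map (T : eqType) (s : seq T) (f : T -> test) p q :
  reflect {in s, forall x, holds (f x) p q} (holds (TAll (map f s)) p q).
Proof. by rewrite holds_TAll all_map; apply: allP. Qed.

(** The tag 2 of missing entries makes a difference in length visible in the fields. *)
Lemma same_labelP p q : size p <= H -> size q <= H -> holds same_label p q = (p == q).
Proof.
move=> le_p le_q; apply/idP/eqP => [|->]; last first.
  by apply/holds_TAll_map => l _; apply/holds_TAll_map => f _; rewrite holds_TEq.
move/holds_TAll_map => same; have {}same l f : l < H -> f < 4 -> field p l f = field q l f.
  move=> lt_l lt_f; have := same l; rewrite mem_iota => /(_ lt_l)/holds_TAll_map/(_ f).
  by rewrite mem_iota => /(_ lt_f); rewrite holds_TEq => /eqP.
have tag r l : l < size r -> field r l 0 != 2.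
  by move=> lt_l; rewrite /field (onth_lt (inl (0, 0)) lt_l); case: (nth _ r l) => [[? ?]|[[? ?] ?]].
have tag2 r l : size r <= l -> field r l 0 = 2 by move=> ge_l; rewrite /field onth_default.
have sz : size p = size q.
  case: (ltngtP (size p) (size q)) => // lt.
    by have := tag _ _ lt; rewrite -same ?tag2 //; apply: leq_trans le_q.
  by have := tag _ _ lt; rewrite same ?tag2 //; apply: leq_trans le_p.
apply: (@eq_from_nth _ (inl (0, 0))) => // l lt_l.
have lt_H : l < H by apply: leq_trans le_p.
move: (same l 0 lt_H isT) (same l 1 lt_H isT) (same l 2 lt_H isT) (same l 3 lt_H isT).
rewrite /field !(onth_lt (inl (0, 0))) -?sz //.
by case: (nth _ p l) => [[? ?]|[[? ?] ?]]; case: (nth _ q l) => [[? ?]|[[? ?] ?]] //= _ -> -> // ->.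
Qed.

(** With [L] the end of the input, the labels lie where nothing is ever stored; this keeps the first
    array valid while the second is built. *)
Fixpoint low_pointers (L : nat) (m : nat -> nat) (i : nat) (ps : seq position) : Prop :=
  if ps is p :: ps' then
    [/\ label_at B m (m i) p, m i + size (encode_label p) <= L, size p <= H & low_pointers L m i.+1 ps']
  else True.

Lemma low_pointersW L m i ps : low_pointers L m i ps -> pointers H B m i ps.
Proof. by elim: ps i => //= p ps IHps i [? ? ? /IHps]. Qed.

Lemma low_pointers_ext L m m' i ps : (forall x, x < L -> m' x = m x) ->
  (forall x, i <= x < i + size ps -> m' x = m x) ->
  low_pointers L m i ps -> low_pointers L m' i ps.
Proof.
move=> extL; elim: ps i => //= p ps IHps i ext [hp le lt_p hps].
have ei : m' i = m i by apply: ext; lia.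
rewrite ei; split=> //; first exact: label_at_ext extL le hp.
by apply: IHps hps => x lt_x; apply: ext; lia.
Qed.

Definition dedup_regs (r : nat) : bool := ~~ (7 <= r < 16).

Definition dedup_factor : nat := 30 + 2 * load_cost H + branch_cost same_label.

Definition stored (d : nat) (st st' : state) : Prop :=
  [/\ forall r, ~~ dedup_regs r -> regs st' r = regs st r,
      forall x, x < d -> Defs.mem st' x = Defs.mem st x & output st' = output st].

Lemma keep_stored (R : pred nat) d st st' : subpred R dedup_regs -> keep R st st' -> stored d st st'.
Proof.
move=> sub [r m o]; split=> [x nx|x _|//]; last by rewrite m.
by apply: r; apply: contra nx; apply: sub.
Qed.

Lemma stored_trans d d' st1 st2 st3 : d <= d' -> stored d st1 st2 -> stored d' st2 st3 -> stored d st1 st3.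
Proof.
move=> le [r1 m1 o1] [r2 m2 o2]; split=> [r nr|x lt_x|]; first by rewrite r2 ?r1.
  by rewrite m2 ?m1 //; apply: leq_trans le.
by rewrite o2.
Qed.

(** Labels are read below [L] and pointers are stored from [d >= L] on; [q] is the last label kept.
    Both [d] and [q] vary in the induction. *)
Lemma ct_dedup_while L d q ls st :
  layout (Defs.mem st) (regs st 4) ls -> regs st 4 + size (codes ls) <= L -> L <= d ->
  regs st 5 = size ls -> regs st 6 = d -> d + size ls < B -> loaded H true q st -> size q <= H ->
  ct B (While 5 dedup_body) st (1 + dedup_factor * size ls) (fun st' =>
    [/\ stored d st st', regs st' 4 = regs st 4 + size (codes ls),
        regs st' 6 = d + size (dedup_after q ls)
      & low_pointers L (Defs.mem st') d (dedup_after q ls)]).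
Proof.
elim: ls d q st => [|p ls IHls] d q st.
  move=> _ _ _ e5 e6 _ _ _; rewrite muln0; apply: ct_while_end => //.
  by split=> //; rewrite ?addn0.
move=> [hp lt_p hls] le_L le_d e5 e6 lt_d lq le_q.
rewrite [size (p :: ls)]/= in e5 lt_d *.
have le_p := ltnW lt_p.
have szc := size_codes_cons p ls.
have lt4 : regs st 4 < B by case: hp => _; lia.
have szp : 0 < size (encode_label p) by rewrite size_encode_label.
eapply ct_le.
  apply: ct_while_loop; first by rewrite e5.
  rewrite /dedup_body; apply: (ct_copy lt_B) => //.
  apply: ct_then; first by apply: (@ct_load_label B H lt_B false p (regs st 4)) => //.
  move=> st1 [k1 lp1]; have {}k1 : keep (block false) st st1.
    by apply: keep_trans k1; do 2 apply: keep_set => //.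
  have lq1 : loaded H true q st1.
    apply: (loaded_keep _ k1) lq => r; rewrite /block; case: (odd r) => /=; clear; lia.
  have [kr1 km1 ko1] := k1.
  apply: ct_then.
    apply: (@ct_branch _ _ _ _ _ _ _ _ (10 + load_cost H) (fun st' =>
      [/\ stored d st st', regs st' 4 = regs st 4, regs st' 5 = regs st 5 &
      let q' := if p == q then q else p in let n := nat_of_bool (p != q) in
      [/\ loaded H true q' st', regs st' 6 = d + n & p == q \/ Defs.mem st' d = regs st 4]]) lp1 lq1 same_label_ok) => st2 k2.
    have k2' : keep (fun r => ~~ (4 <= r < 16)) st st2.
      apply: keep_trans (keep_sub _ k1) (keep_sub _ k2) => r; rewrite /block /scratch; clear; lia.
    have s2 : stored d st st2.
      by apply: keep_stored k2' => r; rewrite /dedup_regs; clear; lia.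
    have [kr2 km2 ko2] := k2'.
    rewrite same_labelP //; case: (eqVneq p q) => [epq|npq].
      apply: (@ct_le _ 1); last by lia.
      apply: ct_skip; split=> //; rewrite ?kr2 //; split; last by left.
        exact: loaded_scratch k2 lq1.
      by rewrite e6 addn0.
    apply: (@ct_le _ (1 + (1 + (1 + (2 + load_cost H))))); last by lia.
    rewrite /push_label /increment.
    apply: ct_seq; apply: ct_store; rewrite !kr2 // e6.
    apply: ct_seq; apply: ct_const; first by lia.
    apply: ct_seq; apply: ct_add; rewrite !regs_set /= kr2 //; first by rewrite e6; lia.
    apply: (ct_copy lt_B) => //=; first by rewrite /upd /= kr2.
    rewrite /upd /= kr2 // -!/(upd _ _ _).
    set st3 := set_reg _ 2 _.
    have m3 : Defs.mem st3 = upd (Defs.mem st) d (regs st 4) by rewrite /= km2.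
    have hp3 : label_at B (Defs.mem st3) (regs st 4) p.
      apply: (label_at_ext (L := L)) hp; last by lia.
      by move=> x lt_x; rewrite m3 /upd ltn_eqF //; apply: leq_trans le_d.
    apply: ct_conseq (leqnn _) _.
      by apply: (@ct_load_label B H lt_B true p (regs st 4)) => //.
    move=> st4 [[kr4 km4 ko4] lp4].
    have rest r : 7 <= r < 16 -> regs st4 r = regs st r.
      move=> hr; rewrite kr4; last by rewrite /block; case: (odd r); lia.
      rewrite -[RHS]kr2; last by lia.
      by rewrite /= /upd !ifN //; lia.
    split.
    - split=> [r|x lt_x|]; first by rewrite negbK; apply: rest.
        by rewrite km4 m3 /upd ltn_eqF.
      by rewrite ko4 /= ko2.
    - by rewrite kr4 //= /upd /= kr2.
    - by rewrite kr4 //= /upd /= kr2.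
    split=> //; last by right; rewrite km4 m3 /upd eqxx.
    by rewrite kr4 //= /upd /= e6.
  move=> st2 [s2 e4 e5' [lq2 e6' stp]]; have [sr2 sm2 so2] := s2.
  have hp2 : label_at B (Defs.mem st2) (regs st2 4) p.
    by rewrite e4; apply: (label_at_ext sm2) hp; lia.
  apply: ct_conseq (ct_next_label (n := size ls) hp2 _) (leqnn _) _; first by rewrite e5' e5.
  move=> st3 [k3 e43 e53]; have [kr3 km3 ko3] := k3.
  pose n := nat_of_bool (p != q).
  have s3 : stored d st2 st3.
    by apply: keep_stored k3 => r; rewrite /advance_regs /dedup_regs; clear; lia.
  apply: ct_conseq (leqnn _) _.
    apply: (IHls (d + n) (if p == q then q else p) st3).
    - by rewrite km3 e43 e4; apply: (layout_ext sm2) hls; lia.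
    - by rewrite e43 e4; lia.
    - by lia.
    - by [].
    - by rewrite kr3.
    - by rewrite /n; case: (p != q); lia.
    - apply: (loaded_keep _ k3) lq2 => r; rewrite /advance_regs /block; clear; lia.
    - by case: ifP.
  move=> st4 [s4 e44 e64 lp4]; split.
  - by apply: stored_trans (leq_addr n d) (stored_trans (leqnn _) s2 s3) s4.
  - by rewrite e44 e43 e4 szc addnA.
  - rewrite e64 /n [dedup_after q (p :: ls)]/=; case: (p == q) => /=; lia.
  move: lp4 stp; rewrite /n [dedup_after q (p :: ls)]/=; case: (eqVneq p q) => [_|npq] /= lp4 stp; first by rewrite addn0 in lp4.
  case: stp => // md; have [_ sm4 _] := s4.
  have m4d : Defs.mem st4 d = regs st 4.
    by rewrite sm4 ?km3 ?md // /n npq addn1.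
  rewrite m4d; split=> //; last by rewrite addn1 in lp4.
    apply: (label_at_ext (L := L)) hp; last by lia.
    move=> x lt_x; have lt_xd : x < d by apply: leq_trans le_d.
    by rewrite sm4 ?km3 ?sm2 //; lia.
  by apply: leq_trans le_L; rewrite szc; apply: leq_add (leqnn _) (leq_addr _ _).
by rewrite /dedup_factor; lia.
Qed.

End Program.

(** * The whole program *)

Section Execution.
Variables (H B : nat).
Hypothesis lt_B : maxn H 8 < B.

Lemma size_dedup_after (T : eqType) (x : T) s : size (dedup_after x s) <= size s.
Proof. by elim: s x => //= y s IHs x; case: ifP => _ //=; [apply: leqW|rewrite ltnS]. Qed.

Lemma ct_dedup L d ls st :
  layout H B (Defs.mem st) (regs st 4) ls -> regs st 4 + size (codes ls) <= L -> L <= d ->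
  regs st 5 = size ls -> regs st 6 = d -> d + size ls < B ->
  ct B (dedup_cmd H) st (1 + sentinel_cost H + dedup_factor H * size ls) (fun st' =>
    [/\ stored d st st', regs st' 4 = regs st 4 + size (codes ls),
        regs st' 6 = d + size (dedup_after (sentinel H) ls)
      & low_pointers H B L (Defs.mem st') d (dedup_after (sentinel H) ls)]).
Proof.
move=> hls le_L le_d e5 e6 lt_d; eapply ct_le.
  apply: ct_then (ct_sentinel lt_B st) _ => st1 [k1 lq1]; have [kr1 km1 _] := k1.
  have s1 : stored d st st1.
    by apply: keep_stored k1 => r; rewrite /block /dedup_regs; clear; case: (odd r); lia.
  apply: ct_conseq (leqnn _) _.
    apply: (@ct_dedup_while H B lt_B L d (sentinel H) ls st1) => //.
    - by rewrite km1 kr1.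
    - by rewrite kr1.
    - by rewrite kr1.
    - by rewrite kr1.
    - by rewrite size_nseq.
  move=> st2 [s2 e4 e6' lp2]; split=> //; first exact: stored_trans (leqnn d) s1 s2.
  by rewrite e4 kr1.
by lia.
Qed.

Lemma ct_first_list c st T Q :
  ct B c (set_reg (set_reg (set_reg st 4 0) 5 (Defs.mem st 0)) 4 1) T Q ->
  ct B (first_list c) st (3 + T) Q.
Proof.
move=> hc; apply: (@ct_le _ (1 + (1 + (1 + T)))) => //; apply: ct_seq; apply: ct_const; first by lia.
by apply: ct_seq; apply: ct_fetch; apply: ct_seq; apply: ct_const; first by lia.
Qed.

Lemma ct_second_list c st T Q : regs st 4 + 1 < B ->
  ct B c (set_reg (set_reg (set_reg st 5 (Defs.mem st (regs st 4))) 3 1) 4 (regs st 4 + 1)) T Q ->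
  ct B (second_list c) st (3 + T) Q.
Proof.
move=> lt4 hc; apply: (@ct_le _ (1 + (1 + (1 + T)))) => //; apply: ct_seq; apply: ct_fetch.
apply: ct_seq; apply: ct_const; first by lia.
by apply: ct_seq; apply: ct_add; rewrite !regs_set.
Qed.

Definition passes_factor (Ps : seq pass) : nat := sumn (map (fun P => 6 + pass_factor H P) Ps).

(** The [+ 1] in the measure pays for the constant cost of a pass when lists and output are
    empty. *)
Lemma ct_passes Ps ps qs st : (forall P, List.In P Ps -> pass_test_ok H B P) ->
  pointers H B (Defs.mem st) (regs st 7) ps -> regs st 8 = regs st 7 + size ps ->
  pointers H B (Defs.mem st) (regs st 8) qs -> regs st 9 = regs st 8 + size qs ->
  regs st 9 < B ->
  let res := flatten [seq pass_pairs P ps qs | P <- Ps] in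
  ct B (passes_cmd H Ps) st (1 + passes_factor Ps * (size ps + size qs + size res + 1))
    (emit (flatten [seq encode_label x.1 ++ encode_label x.2 | x <- res]) pass_regs st).
Proof.
elim: Ps st => [|P Ps IHPs] st ok hp e8 hq e9 lt9 res.
  by apply: ct_le (_ : 1 <= _) => //; apply: ct_skip; apply/keep_emit/keep_refl.
eapply ct_le.
  apply: ct_then; first by apply: (@ct_pass H B lt_B P ps qs st) => //; apply: ok; left.
  move=> st1 k1; have [kr1 km1 _] := k1; apply: ct_conseq (leqnn _) _.
    apply: (IHPs st1); rewrite ?km1 ?(kr1 7) ?(kr1 8) ?(kr1 9) //.
    by move=> P' P'_in; apply: ok; right.
  move=> st2 k2; rewrite /res /= map_cat flatten_cat; exact: emit_trans k1 k2.
rewrite /res /= size_cat; set o1 := size (pass_pairs _ _ _); set o2 := size (flatten _).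
have -> : passes_factor (P :: Ps) = 6 + pass_factor H P + passes_factor Ps by [].
have : pass_factor H P * (size ps + size qs + o1) <= pass_factor H P * (size ps + size qs + (o1 + o2) + 1).
  by rewrite leq_mul2l; apply/orP; right; lia.
have : passes_factor Ps * (size ps + size qs + o2 + 1) <= passes_factor Ps * (size ps + size qs + (o1 + o2) + 1).
  by rewrite leq_mul2l; apply/orP; right; lia.
by rewrite !mulnDl; lia.
Qed.

(** * The whole program on an encoded input *)

Section Input.
Variables ls1 ls2 : seq position.
Let input := encode_list ls1 ++ encode_list ls2.
Hypotheses (size1 : all (fun p => size p < H) ls1) (size2 : all (fun p => size p < H) ls2).
Hypotheses (input_lt : all (fun x => x < B) input) (room : size input + size ls1 + size ls2 < B).

Let m0 := nth 0 input.
Let a2 := 1 + size (codes ls1).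

Lemma size_input : size input = a2 + 1 + size (codes ls2).
Proof. by rewrite /input size_cat /a2 /codes /=; lia. Qed.

Lemma input_count1 : m0 0 = size ls1. Proof. by []. Qed.

Lemma input_count2 : m0 a2 = size ls2.
Proof. by rewrite /m0 /input nth_cat /= -/(codes ls1) ltnn subnn. Qed.

Lemma input_layout1 : layout H B m0 1 ls1.
Proof.
have e : input = [:: size ls1] ++ codes ls1 ++ encode_list ls2 by [].
by rewrite /m0 e; apply: (@layout_nth H B [:: size ls1]) => //; rewrite -e //; lia.
Qed.

Lemma input_layout2 : layout H B m0 (a2 + 1) ls2.
Proof.
have e : input = (encode_list ls1 ++ [:: size ls2]) ++ codes ls2 ++ [::].
  by rewrite cats0 -catA.
have -> : a2 + 1 = size (encode_list ls1 ++ [:: size ls2]) by rewrite size_cat /= addn1.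
by rewrite /m0 e; apply: layout_nth => //; rewrite -e //; lia.
Qed.

Lemma ct_scan_input c T Q :
  (forall st, Defs.mem st = m0 -> output st = [::] -> regs st 6 = size input ->
     regs st 7 = size input -> ct B c st T Q) ->
  ct B (first_list (Seq (While 5 next_label) (second_list (Seq (While 5 next_label)
    (copy_to 6 4 (copy_to 7 4 c)))))) (initial_state input)
    (12 + 9 * (size ls1 + size ls2) + T) Q.
Proof.
move=> hc; have szi := size_input; eapply ct_le.
  apply: ct_first_list; apply: ct_then.
    by apply: (@ct_scan H B lt_B ls1) => //=; exact: input_layout1.
  move=> st1 [[kr1 km1 ko1] e4]; rewrite regs_set /= in e4.
  have lt4 : regs st1 4 + 1 < B by rewrite e4 -/a2; lia.
  apply: (ct_second_list lt4); rewrite km1 [Defs.mem _]/= -/m0 e4 -/a2 input_count2.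
  apply: ct_then.
    by apply: (@ct_scan H B lt_B ls2) => //=; rewrite km1; exact: input_layout2.
  move=> st2 [[kr2 km2 ko2] e4']; rewrite regs_set /= -szi in e4'.
  have lt4' : regs st2 4 < B by rewrite e4'; lia.
  apply: (ct_copy lt_B) => //; apply: (ct_copy lt_B) => //.
  apply: hc => //=; rewrite ?km2 ?ko2 //=.
by lia.
Qed.

Lemma ct_dedup_input c st T Q :
  let d1 := dedup_after (sentinel H) ls1 in let d2 := dedup_after (sentinel H) ls2 in
  Defs.mem st = m0 -> output st = [::] -> regs st 6 = size input -> regs st 7 = size input ->
  (forall st', output st' = [::] -> pointers H B (Defs.mem st') (regs st' 7) d1 ->
     regs st' 8 = regs st' 7 + size d1 -> pointers H B (Defs.mem st') (regs st' 8) d2 ->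
     regs st' 9 = regs st' 8 + size d2 -> regs st' 9 < B -> ct B c st' T Q) ->
  ct B (first_list (Seq (dedup_cmd H) (copy_to 8 6 (second_list (Seq (dedup_cmd H) (copy_to 9 6 c))))))
    st (12 + 2 * sentinel_cost H + dedup_factor H * (size ls1 + size ls2) + T) Q.
Proof.
move=> d1 d2 em eo e6 e7 hc; have szi := size_input.
have sz1 := size_dedup_after (sentinel H) ls1; have sz2 := size_dedup_after (sentinel H) ls2.
rewrite -/d1 -/d2 in sz1 sz2.
have lt_d1 : size input + size d1 < B.
  by apply: leq_ltn_trans room; rewrite -addnA leq_add2l; apply: leq_trans sz1 (leq_addr _ _).
have lt_d1' : size input + size d1 + size ls2 < B.
  by apply: leq_ltn_trans room; rewrite leq_add2r leq_add2l.
have lt_d2 : size input + size d1 + size d2 < B.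
  by apply: leq_ltn_trans lt_d1'; rewrite leq_add2l.
eapply ct_le.
  apply: ct_first_list; apply: ct_then.
    apply: (@ct_dedup (size input) (size input) ls1) => //=; rewrite ?em.
    - exact: input_layout1.
    - by change (1 + size (codes ls1) <= size input); rewrite szi /a2; lia.
    - exact: input_count1.
    - by change (size input + size ls1 < B); lia.
  move=> st1 [[sr1 sm1 so1] e14 e16 lp1]; rewrite regs_set /= -/a2 in e14.
  have e17 : regs st1 7 = size input by rewrite sr1.
  apply: (ct_copy lt_B) => //; first by rewrite e16 -/d1.
  set st2 := set_reg _ 8 _.
  have lt_a2 : a2 < size input by rewrite szi; apply: ltn_addr; rewrite addn1.
  have lt_a2B : a2 + 1 < B.
    by apply: leq_ltn_trans lt_d1; rewrite addn1; apply: leq_trans lt_a2 (leq_addr _ _).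
  have ma2 : Defs.mem st2 (regs st2 4) = size ls2.
    by rewrite /= /upd /= e14 sm1 //= em input_count2.
  have e24 : regs st2 4 = a2 by [].
  apply: ct_second_list; first by rewrite e24.
  rewrite ma2 e24; set st3 := set_reg _ 4 _.
  have m3 : Defs.mem st3 = Defs.mem st1 by [].
  have e36 : regs st3 6 = size input + size d1 by [].
  have e38 : regs st3 8 = size input + size d1 by [].
  have e37 : regs st3 7 = size input by [].
  apply: ct_then.
    apply: (@ct_dedup (size input) (size input + size d1) ls2 st3) => //.
    - rewrite m3; apply: (layout_ext (L := size input)) input_layout2; last by rewrite szi.
      by move=> x lt_x; rewrite sm1 //= em.
    - by rewrite regs_set eqxx szi.
    - exact: leq_addr.
  move=> st4 [[sr4 sm4 so4] e44 e46 lp4].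
  apply: (ct_copy lt_B) => //; first by rewrite e46 -/d2.
  apply: hc => /=; rewrite /upd /= ?(sr4 7) ?(sr4 8) // ?e37 ?e38 ?e46 //.
  - by rewrite so4 /= so1.
  (* The second removal of repetitions stores only from [size input + size d1] on, behind the input
     and the first array. *)
  - apply: (low_pointersW (L := size input)); apply: (low_pointers_ext lt_B) lp1.
      by move=> x lt_x; rewrite sm4 ?m3 //; apply: ltn_addr.
    by rewrite -/d1 => x /andP[_ lt_x]; rewrite sm4 ?m3.
  - exact: low_pointersW lp4.
by rewrite mulnDr; lia.
Qed.

Definition program_factor (Ps : seq pass) : nat :=
  40 + 2 * sentinel_cost H + dedup_factor H + passes_factor Ps.

Lemma program_time s d p n m X : n + 1 <= X -> m <= X ->
  12 + 9 * n + (12 + 2 * s + d * n + (1 + p * m)) <= (40 + 2 * s + d + p) * X.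
Proof.
move=> le_n le_m.
have hp : p * m <= p * X by rewrite leq_mul2l le_m orbT.
have hd : d * n <= d * X by rewrite leq_mul2l; apply/orP; right; lia.
have hs : 2 * s <= 2 * s * X by rewrite leq_pmulr //; lia.
by rewrite !mulnDl; lia.
Qed.

Lemma ct_program Ps : (forall P, List.In P Ps -> pass_test_ok H B P) ->
  let res := flatten [seq pass_pairs P (dedup_after (sentinel H) ls1) (dedup_after (sentinel H) ls2) | P <- Ps] in
  ct B (program H Ps) (initial_state input)
    (program_factor Ps * (size ls1 + size ls2 + size res + 1))
    (fun st' => output st' = flatten [seq encode_label x.1 ++ encode_label x.2 | x <- res]).
Proof.
move=> ok res; eapply ct_le.
  apply: ct_scan_input => st1 em eo e6 e7.
  apply: ct_dedup_input => // st2 eo2 hp e8 hq e9 lt9.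
  apply: ct_conseq (leqnn _) _; first exact: (ct_passes ok hp e8 hq e9 lt9).
  by move=> st3 [_ _ ->]; rewrite eo2.
apply: program_time; first by rewrite leq_add2r leq_addr.
by rewrite !leq_add2r; apply: leq_add; apply: size_dedup_after.
Qed.

End Input.
End Execution.

(** * Word size *)

Section Words.
Variable H : nat.

Lemma test_ok_leq B B' t : B <= B' -> test_ok B H t -> test_ok B' H t.
Proof.
move=> le_B; elim: t => //= [x n|x n|a IHa b IHb]; try by case/andP=> -> /leq_trans->.
by case/andP=> /IHa -> /IHb.
Qed.

(** A test contains finitely many constants, all taken from the grammar, so some word range admits
    it and hence all larger ones do; no explicit bound is needed. *)
Definition fits (t : test) : Prop := exists B, test_ok B H t.

Lemma fits_TAnd a b : fits a -> fits b -> fits (TAnd a b).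
Proof.
move=> [B1 ok1] [B2 ok2]; exists (maxn B1 B2); rewrite /=.
by rewrite (test_ok_leq (leq_maxl _ _) ok1) (test_ok_leq (leq_maxr _ _) ok2).
Qed.

Lemma fits_TNot a : fits a -> fits (TNot a).
Proof. by case=> B ok; exists B. Qed.

Lemma fits_TOr a b : fits a -> fits b -> fits (TOr a b).
Proof. by move=> fa fb; apply/fits_TNot/fits_TAnd; apply: fits_TNot. Qed.

Lemma fits_TTrue : fits TTrue. Proof. by exists 0. Qed.

Lemma fits_TLt x y : operand_ok H x -> operand_ok H y -> fits (TLt x y).
Proof. by move=> okx oky; exists 0; rewrite /= okx oky. Qed.

Lemma fits_TEqc x n : operand_ok H x -> fits (TEqc x n).
Proof. by move=> okx; exists n.+1; rewrite /= okx /=. Qed.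

Lemma fits_TLtc x n : operand_ok H x -> fits (TLtc x n).
Proof. by move=> okx; exists n.+1; rewrite /= okx /=. Qed.

Lemma fits_TAll (T : eqType) (s : seq T) (f : T -> test) :
  {in s, forall x, fits (f x)} -> fits (TAll (map f s)).
Proof.
elim: s => [|x s IHs] fs; first exact: fits_TTrue.
apply: fits_TAnd; first by apply: fs; rewrite mem_head.
by apply: IHs => y ys; apply: fs; rewrite inE ys orbT.
Qed.

Lemma fits_TAny (T : eqType) (s : seq T) (f : T -> test) :
  {in s, forall x, fits (f x)} -> fits (TAny (map f s)).
Proof.
elim: s => [|x s IHs] fs; first exact/fits_TNot/fits_TTrue.
apply: fits_TOr; first by apply: fs; rewrite mem_head.
by apply: IHs => y ys; apply: fs; rewrite inE ys orbT.
Qed.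

Lemma fits_same_upto d : d <= H -> fits (same_upto d).
Proof.
move=> le_d; apply: fits_TAll => l; rewrite mem_iota add0n => /andP[_ lt_l].
have ok b : operand_ok H (b, l, 4) by rewrite /operand_ok /= andbT; apply: leq_trans le_d.
by apply: fits_TAnd; apply/fits_TNot/fits_TLt.
Qed.

Lemma fits_precedes d : d <= H -> fits (precedes d).
Proof.
elim: d => [|d IHd] lt_d; first exact/fits_TNot/fits_TTrue.
have ok b : operand_ok H (b, d, 4) by rewrite /operand_ok /= andbT.
apply: fits_TOr; first exact/IHd/ltnW.
by apply: fits_TAnd; [exact/fits_same_upto/ltnW|exact: fits_TLt].
Qed.

Lemma fits_pass P : depth P <= H -> fits (active P) -> fits (below P) -> fits (within P) ->
  exists B, pass_test_ok H B P.
Proof.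
move=> le_d fa fb fw.
have [B1 ok1] := fa.
have [B2 ok2] : fits (before_test P).
  by apply: fits_TOr; [exact: fits_precedes|apply: fits_TAnd => //; exact: fits_same_upto].
have [B3 ok3] : fits (inside_test P) by apply: fits_TAnd => //; exact: fits_same_upto.
exists (maxn B1 (maxn B2 B3)); apply/and3P; split.
- by apply: test_ok_leq ok1; apply: leq_maxl.
- by apply: test_ok_leq ok2; lia.
by apply: test_ok_leq ok3; lia.
Qed.

Lemma pass_test_ok_leq B B' P : B <= B' -> pass_test_ok H B P -> pass_test_ok H B' P.
Proof. by move=> le /and3P[o1 o2 o3]; apply/and3P; split; apply: test_ok_leq le _. Qed.

End Words.

Section Grammar.
Variables (Sigma Gamma : finType) (G : grammar Sigma Gamma) (cyc : seq (seq pedge)).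

Lemma fits_composite_entry H b d k i : d < H -> fits H (composite_entry b d k i).
Proof.
move=> lt_d; have ok f : f < 5 -> operand_ok H (b, d, f) by rewrite /operand_ok /= lt_d.
by do 3 (apply: fits_TAnd; first exact/fits_TEqc/ok); exact: fits_TTrue.
Qed.

(** The test also reads the level after [d]. Together with the length of [sentinel] this is why
    [H = D.+1] is used for labels of length at most [D]. *)
Lemma fits_recursive_active H rel d : d.+1 < H -> fits H (recursive_active G cyc rel d).
Proof.
move=> lt_d; apply: fits_TAny => s _; apply: fits_TAny => e _; apply: fits_TAny => i _.
apply: fits_TAnd; last exact: fits_composite_entry.
have ok f : f < 5 -> operand_ok H (false, d, f) by rewrite /operand_ok /= (ltnW lt_d).
by do 2 (apply: fits_TAnd; first exact/fits_TEqc/ok); exact: fits_TTrue.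
Qed.

Lemma fits_pass_at D x : x \in pass_indices G D ->
  exists B, pass_test_ok D.+1 B (pass_at G cyc x.1 x.2).
Proof.
case: x => d c; rewrite mem_pass_indices => dc.
have le_d : d <= D by move: dc; clear; lia.
have le_dH := leqW le_d.
have ok b : d < D.+1 -> operand_ok D.+1 (b, d, 4) by rewrite /operand_ok /= => ->.
have later_ok : fits D.+1 (later d) by apply: fits_TLt; apply: ok.
case: c dc => [|[|[|j]]] dc; apply: fits_pass => //=.
- exact: fits_TTrue.
- exact/fits_TNot/fits_TTrue.
- exact: fits_TTrue.
- by apply: fits_recursive_active; move: dc; clear; lia.
- by apply: fits_recursive_active; move: dc; clear; lia.
- apply: fits_TAny => k _; apply: fits_TAny => i _; exact: fits_composite_entry.
- exact/fits_TLtc/ok.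
exact/fits_TEqc/ok.
Qed.

Lemma fits_passes D : exists B, forall P,
  List.In P [seq pass_at G cyc x.1 x.2 | x <- pass_indices G D] -> pass_test_ok D.+1 B P.
Proof.
have : {subset pass_indices G D <= pass_indices G D} by [].
elim: {1 3}(pass_indices G D) => [|x s IHs] sub; first by exists 0.
have [B1 ok1] := fits_pass_at (sub _ (mem_head _ _)).
have [|B2 ok2] := IHs; first by move=> y ys; apply: sub; rewrite inE ys orbT.
exists (maxn B1 B2) => P /= [<-|/ok2 ok].
  by apply: pass_test_ok_leq ok1; apply: leq_maxl.
by apply: pass_test_ok_leq ok; apply: leq_maxr.
Qed.

(** An elementary operation writes at most one number; this gives the lower bound on the time. *)
Lemma exec_output_size B c st t st' : exec B c st t st' -> size (output st') <= size (output st) + t.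
Proof. by elim=> //= *; rewrite ?size_rcons; lia. Qed.

(** Needed for [0 < w]: with [w = 0] the words would have no bits, whatever the factor [c]. *)
Lemma derived_nodes_neq0 (hspec : specification G) (hcoarse : coarse_grained G) g :
  derived G g -> 0 < size (nodes g).
Proof.
elim=> //= {}g v k _ _ _ lt_k _; have /andP[_ uW] := rhs_ofP hspec hcoarse lt_k.
by rewrite size_cat size_map size_iota; have := source_lt uW; lia.
Qed.

Lemma size_codes D ls : all (fun p => size p < D.+1) ls -> size (codes ls) <= (4 * D).+1 * size ls.
Proof.
elim: ls => [|p ls IHls] // /andP[lt_p /IHls le]; rewrite size_codes_cons size_encode_label.
by rewrite [size (p :: ls)]/= mulnS; apply: leq_add => //; move: lt_p; clear; lia.
Qed.

End Grammar.

(** Words must hold the numbers of the input, the constants of the program ([a]), the level bound,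
    and the addresses of the input and of both arrays. A factor [E.+1] on [2 ^ w] is enough and
    costs [E * w] more bits. Of the [10 * D.+1] in [E], the part [8 * D.+1] covers labels and
    pointers; the rest is slack. *)
Lemma word_size a D n1 n2 L w : 0 < w -> n1 < 2 ^ w -> n2 < 2 ^ w ->
  L <= 2 + (4 * D).+1 * (n1 + n2) ->
  [/\ 2 ^ w <= 2 ^ ((1 + (a + 10 * D.+1)) * w), a < 2 ^ ((1 + (a + 10 * D.+1)) * w),
      maxn D.+1 8 < 2 ^ ((1 + (a + 10 * D.+1)) * w) & L + n1 + n2 < 2 ^ ((1 + (a + 10 * D.+1)) * w)].
Proof.
move=> w_gt0 lt1 lt2 le_L; set E := a + 10 * D.+1.
have lt_E : E < 2 ^ (E * w) by apply: (@leq_trans (2 ^ E)); [exact: ltn_expl|rewrite leq_pexp2l // leq_pmulr].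
have le2 : 2 <= 2 ^ w by rewrite -{1}(expn1 2) leq_pexp2l.
have le_EB : 2 ^ w * E.+1 <= 2 ^ ((1 + E) * w).
  by rewrite mulnDl mul1n expnD leq_mul2l lt_E orbT.
have hD : (4 * D).+1 * (n1 + n2) + (n1 + n2) <= 2 ^ w * (8 * D.+1).
  have -> : (4 * D).+1 * (n1 + n2) + (n1 + n2) = (4 * D + 2) * (n1 + n2) by rewrite -mulSnr; congr muln; lia.
  have -> : 2 ^ w * (8 * D.+1) = (4 * D.+1) * (2 ^ w + 2 ^ w) by rewrite addnn -mul2n; lia.
  apply: leq_mul; lia.
have hE : 2 ^ w * E.+1 = 2 ^ w * (8 * D.+1) + 2 ^ w * (a + 2 * D.+1 + 1).
  by rewrite -mulnDr; congr muln; rewrite /E; lia.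
have h2 : 2 * (a + 2 * D.+1 + 1) <= 2 ^ w * (a + 2 * D.+1 + 1) by rewrite leq_mul2r le2 orbT.
have h8 : 2 * (8 * D.+1) <= 2 ^ w * (8 * D.+1) by rewrite leq_mul2r le2 orbT.
split; apply: leq_trans le_EB; rewrite ?hE; try lia.
Qed.

(* The program and the constant depend on the grammar only.  The word parameter
   [w] is any number of bits that suffices for the size of the run and for the
   numbers in the input; machine words have [c * w] bits.  The second part is
   the optimality of the bound: every program needs at least one step per
   answer. *)
Theorem mainTheorem3 (Sigma Gamma : finType) (G : grammar Sigma Gamma)
    (cyc : seq (seq pedge))
    (hspec : specification G) (hcoarse : coarse_grained G)
    (hslr : strictly_linear_recursive G) (hcyc : cycle_enumeration G cyc) :
  (exists (P : cmd) (c : nat),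
     forall (g : graph Sigma Gamma) (l1 l2 : seq node) (w : nat),
       run G g -> query_list G cyc g l1 -> query_list G cyc g l2 ->
       size (nodes g) < 2 ^ w ->
       all (fun a => a < 2 ^ w) (query_input G cyc l1 l2) ->
       exists (t : nat) (pairs : seq (node * node)),
         [/\ is_answer g l1 l2 pairs,
             computes G cyc (2 ^ (c * w)) P l1 l2 t pairs
           & t <= c * (size l1 + size l2 + size pairs + 1)])
  /\
  (forall (P : cmd) (B : nat) (g : graph Sigma Gamma) (l1 l2 : seq node)
          (t : nat) (pairs : seq (node * node)),
     run G g -> query_list G cyc g l1 -> query_list G cyc g l2 ->
     is_answer g l1 l2 pairs -> computes G cyc B P l1 l2 t pairs ->
     size pairs <= t).
Proof.
split; last first.
  move=> P B g l1 l2 t pairs _ _ _ _ [st ex out].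
  have := exec_output_size ex; rewrite out /= add0n; apply: leq_trans.
  (* The code of a label is never empty, as it begins with the length. *)
  by elim: pairs {out} => //= uv pairs IH; rewrite !size_cat /=; lia.
have [D hD] := psi_size_bounded hcyc hslr.
pose Ps := [seq pass_at G cyc x.1 x.2 | x <- pass_indices G D].
have [B0 okB0] := fits_passes G cyc D.
pose H := D.+1.
(* One constant serves as factor of the time bound and of the word length, hence the sum. *)
pose c := program_factor H Ps + (1 + (B0 + 10 * D.+1)).
exists (program H Ps), c => g l1 l2 w [dg _] hl1 hl2 lt_w lts.
have [sub1 _] := hl1; have [sub2 _] := hl2.
pose ls1 := map (psi G cyc) l1; pose ls2 := map (psi G cyc) l2.
have size_ls l : {subset l <= nodes g} -> all (fun p => size p < H) (map (psi G cyc) l).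
  by move=> sub; rewrite all_map; apply/allP => v /sub v_in; rewrite /= ltnS; apply: hD dg v v_in.
have w_gt0 : 0 < w.
  by case: w lt_w {lts} => // ; have := derived_nodes_neq0 hspec hcoarse dg; case: (size _).
have szi : size (query_input G cyc l1 l2) <= 2 + (4 * D).+1 * (size l1 + size l2).
  have := size_codes (size_ls _ sub1); have := size_codes (size_ls _ sub2).
  by rewrite /query_input size_cat /= -!/(codes _) !size_map mulnDr; lia.
(* The length of each list is itself a number of the input. *)
have lt1 : size l1 < 2 ^ w by move: lts; rewrite /query_input /= size_map => /andP[].
have lt2 : size l2 < 2 ^ w by move: lts; rewrite /query_input all_cat /= !size_map => /andP[_ /andP[]].
have [le_wB lt_aB lt_HB room] := word_size B0 w_gt0 lt1 lt2 szi.
have le_B : 2 ^ ((1 + (B0 + 10 * D.+1)) * w) <= 2 ^ (c * w).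
  by rewrite leq_pexp2l // leq_mul2r leq_addl orbT.
have lt_B : maxn H 8 < 2 ^ (c * w) by apply: leq_trans le_B.
have okB P : List.In P Ps -> pass_test_ok H (2 ^ (c * w)) P.
  by move/okB0; apply: pass_test_ok_leq; apply: ltnW; apply: leq_trans le_B.
have inB : all (fun x => x < 2 ^ (c * w)) (encode_list ls1 ++ encode_list ls2).
  by apply: sub_all lts => x /leq_trans; apply; apply: leq_trans le_B.
have roomB : size (encode_list ls1 ++ encode_list ls2) + size ls1 + size ls2 < 2 ^ (c * w).
  by rewrite !size_map; apply: leq_trans le_B.
(* [sentinel] is longer than every label and so occurs in neither list. *)
have dd l : query_list G cyc g l ->
    dedup_after (sentinel H) (map (psi G cyc) l) = undup (map (psi G cyc) l).
  move=> hl; apply: (dedup_after_sorted (r := postorder_le)).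
  - apply/negP => /(allP (size_ls _ (proj1 hl))); by rewrite size_nseq ltnn.
  - exact: query_pairwise hl.
  exact: (query_anti hspec hcoarse hcyc dg hl).
have := ct_program lt_B (size_ls _ sub1) (size_ls _ sub2) inB roomB okB.
have <- : [seq (psi G cyc uv.1, psi G cyc uv.2) | uv <- answer G cyc D l1 l2] =
    flatten [seq pass_pairs P (dedup_after (sentinel H) (map (psi G cyc) l1))
                              (dedup_after (sentinel H) (map (psi G cyc) l2)) | P <- Ps].
  by rewrite !dd // (answer_labels hspec hcoarse hcyc dg (hD g dg) hl1 hl2) /Ps -map_comp.
move=> [t [st [ex le_t out]]]; exists t, (answer G cyc D l1 l2); split.
- exact: (answerP hspec hcoarse hcyc dg (hD g dg) hl1 hl2).
- by exists st => //; rewrite out -map_comp.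
apply: leq_trans le_t _; rewrite !size_map leq_mul2r; apply/orP; right.
exact: leq_addr.
Qed.
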